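(* Let $\{X(t)\}_{t\ge 0}$ be the stochastic replicator process with payoff matrix $A\in\mathbb{R}^{n\times n}$, noise parameters $\sigma_1,\dots,\sigma_n$ and initial value $\mathbf{x}_0\in\operatorname{int}\Delta$, and let $\tilde A=(a_{ij}-\tfrac12\sigma_i^2)_{i,j}$. Suppose there exists $\mathbf{p}\in\mathbb{R}^n\setminus\{\mathbf{e}_1,\dots,\mathbf{e}_n\}$ such that $\{\tilde A\mathbf{p}\}_1=\cdots=\{\tilde A\mathbf{p}\}_n$ and $p_1+\cdots+p_n=1$. Suppose further that $\tilde A$ (or, equivalently, $A$) is conditionally positive definite. Then $$\min\{X_i(t):i\in I^+\}\to0\quad\text{a.s. as }t\to\infty,\qquad\text{where } I^+=\{i:p_i>0\}.$$ In particular, $\{X(t)\}$ is transient.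
   Context: Setting. $n\ge2$; $A=(a_{ij})\in\mathbb{R}^{n\times n}$ is an arbitrary payoff matrix; $\sigma_1,\dots,\sigma_n>0$; $W=(W_1,\dots,W_n)^T$ is a standard $n$-dimensional Brownian motion (independent components). $\Delta=\{\mathbf{y}\in[0,1]^n:y_1+\cdots+y_n=1\}$, $\operatorname{int}\Delta=\{\mathbf{y}\in\Delta: y_i>0\ \forall i\}$ and $\operatorname{bd}\Delta=\Delta\setminus\operatorname{int}\Delta$. The stochastic replicator process $\{X(t)\}$ is a strong solution of the Itô equation $$dX(t)=\mathbf{b}(X(t))\,dt+C(X(t))\,dW(t),\qquad X(0)=\mathbf{x}_0\in\operatorname{int}\Delta,$$ with $\mathbf{b}(\mathbf{x})=[\operatorname{diag}(x_1,\dots,x_n)-\mathbf{x}\mathbf{x}^T][A-\operatorname{diag}(\sigma_1^2,\dots,\sigma_n^2)]\mathbf{x}$ and $C(\mathbf{x})=[\operatorname{diag}(x_1,\dots,x_n)-\mathbf{x}\mathbf{x}^T]\operatorname{diag}(\sigma_1,\dots,\sigma_n)$ for $\mathbf{x}\in\Delta$. Equivalently, $X_i=Z_i/(Z_1+\cdots+Z_n)$ where $dZ_i(t)=Z_i(t)[\{AX(t)\}_i\,dt+\sigma_i\,dW_i(t)]$, $Z_i(0)>0$. Almost surely $X(t)\in\operatorname{int}\Delta$ for all $t\ge0$. $\{\mathbf{v}\}_i$ denotes the $i$th component of $\mathbf{v}$, and $\mathbf{e}_k$ is the $k$th standard basis vector of $\mathbb{R}^n$. An $n\times n$ matrix $B$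 (not necessarily symmetric) is conditionally positive definite if $\mathbf{y}^TB\mathbf{y}>0$ for all $\mathbf{y}\in\mathbb{R}^n\setminus\{\mathbf{0}\}$ with $y_1+\cdots+y_n=0$. ($\tilde A$ is conditionally positive definite if and only if $A$ is.) $\{X(t)\}$ is transient if $P_{\mathbf{x}_0}\{X(t)\to\operatorname{bd}\Delta\}=1$, i.e. almost surely the distance of $X(t)$ to $\operatorname{bd}\Delta$ tends to $0$ as $t\to\infty$. *)

(* Defs.v *)
From HB Require Import structures.
From mathcomp Require Import all_boot all_order all_algebra.
From mathcomp Require Import all_classical all_reals all_analysis.
Import Order.TTheory GRing.Theory Num.Theory.
Import numFieldNormedType.Exports.

Set Implicit Arguments.
Unset Strict Implicit.
Unset Printing Implicit Defensive.

Local Open Scope classical_set_scope.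
Local Open Scope ring_scope.

Section Simplex.
Context {R : realType} {n : nat}.
Implicit Types x y : 'cV[R]_n.

Definition simplex : set 'cV[R]_n :=
  [set y | (forall i, 0 <= y i 0 <= 1) /\ \sum_i y i 0 = 1].

Definition int_simplex : set 'cV[R]_n :=
  [set y | simplex y /\ forall i, 0 < y i 0].

Definition bd_simplex : set 'cV[R]_n := simplex `\` int_simplex.

Definition eucl_dist x y : R := Num.sqrt (\sum_i (x i 0 - y i 0) ^+ 2).

Definition dist_to (D : set 'cV[R]_n) x : R := inf [set eucl_dist x y | y in D].

Definition cond_pos_def (B : 'M[R]_n) :=
  forall y : 'cV[R]_n, y != 0 -> \sum_i y i 0 = 0 ->
    0 < (y^T *m B *m y) 0 0.

(* The minimum of x over I; the default value 1 is only returned for empty I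
   provided that x lies in the simplex, since then all coordinates are <= 1. *)
Definition min_coord (I : {pred 'I_n}) x : R :=
  \big[Num.min/1]_(i in I) x i 0.

End Simplex.

Section Replicator.
Context {R : realType} {n : nat}.
Variables (A : 'M[R]_n) (sigma : 'I_n -> R).

Definition tilde : 'M[R]_n := \matrix_(i, j) (A i j - sigma i ^+ 2 / 2).

Definition replicator_drift (x : 'cV[R]_n) : 'cV[R]_n :=
  (diag_mx x^T - x *m x^T) *m (A - diag_mx (\row_i sigma i ^+ 2)) *m x.

Definition replicator_diffusion (x : 'cV[R]_n) : 'M[R]_n :=
  (diag_mx x^T - x *m x^T) *m diag_mx (\row_i sigma i).

Lemma cond_pos_def_tilde : cond_pos_def tilde <-> cond_pos_def A.
Proof.
suff E (y : 'cV[R]_n) : \sum_i y i 0 = 0 ->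
    (y^T *m tilde *m y) 0 0 = (y^T *m A *m y) 0 0.
  by split=> H y y0 ys; [rewrite -E//|rewrite E//]; exact: H.
move=> ys; rewrite -!mulmxA !mxE; apply: eq_bigr => i _; congr (_ * _).
rewrite !mxE; under eq_bigr do rewrite mxE mulrBl.
by rewrite sumrB -mulr_sumr ys mulr0 subr0.
Qed.

End Replicator.

(* Processes are functions R -> T -> _ of which only the times t >= 0 matter. *)
Section Stochastic.
Context {R : realType} {d : measure_display} {T : measurableType d}.
Variable P : probability T R.

(* Taking some of the B i equal to setT gives the product rule for
   subfamilies. *)
Definition mutually_independent (I : finType) (Y : I -> T -> R) :=
  forall B : I -> set R, (forall i, measurable (B i)) ->
    P (\bigcap_(i in [set: I]) Y i @^-1` B i) =
    (\prod_(i : I) P (Y i @^-1` B i))%E.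

(* Increments over consecutive intervals of a time grid, taken over all
   coordinates, are jointly independent: this expresses both the independence
   of increments and the independence of the coordinates.  The second argument
   of normal_prob is the standard deviation. *)
Definition standard_brownian_motion (n : nat) (W : 'I_n -> R -> T -> R) :=
  [/\ forall j t, 0 <= t -> measurable_fun [set: T] (W j t),
      {ae P, forall w, forall j, W j 0 w = 0},
      forall j w, {within `[0, +oo[, continuous (fun t => W j t w)},
      forall j s t, 0 <= s -> s < t -> forall B : set R, measurable B ->
        P ((fun w => W j t w - W j s w) @^-1` B) =
        normal_prob 0 (Num.sqrt (t - s)) B &
      forall (m : nat) (tau : nat -> R), 0 <= tau 0 ->
        (forall k, (k < m)%N -> tau k <= tau k.+1) ->
        mutually_independent (fun (jk : 'I_n * 'I_m) w =>
          W jk.1 (tau jk.2.+1) w - W jk.1 (tau jk.2) w)].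

(* The filtration generated by W, augmented by the P-null events. *)
Definition brownian_filtration (n : nat) (W : 'I_n -> R -> T -> R) (t : R) :
    set (set T) :=
  <<s [set E | exists j s, 0 <= s <= t /\
               exists2 B : set R, measurable B & E = W j s @^-1` B] `|`
      [set E | measurable E /\ P E = 0%E] >>.

Section Ito.
Variable F : R -> set (set T).

Definition F_measurable (t : R) (Y : T -> R) :=
  forall B : set R, measurable B -> F t (Y @^-1` B).

Record step_process := StepProcess {
  step_size : nat;
  step_time : nat -> R;
  step_val : nat -> T -> R }.

Definition elementary (t : R) (phi : step_process) :=
  [/\ step_time phi 0 = 0, step_time phi (step_size phi) = t,
      forall k, (k < step_size phi)%N ->
        step_time phi k <= step_time phi k.+1,
      forall k, (k < step_size phi)%N ->
        F_measurable (step_time phi k) (step_val phi k) &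
      exists M : R, forall k w, (k < step_size phi)%N ->
        `|step_val phi k w| <= M].

Definition step_fun (phi : step_process) (s : R) (w : T) : R :=
  \sum_(k < step_size phi)
    step_val phi k w * \1_(`[step_time phi k, step_time phi k.+1[) s.

Definition step_integral (phi : step_process) (B : R -> T -> R) (w : T) : R :=
  \sum_(k < step_size phi)
    step_val phi k w * (B (step_time phi k.+1) w - B (step_time phi k) w).

(* I is (a version of) the Ito integral of H against the Brownian motion B over
   [0, t], for H an adapted process in L^2([0, t] x T): it is the L^2 limit of
   the integrals of some sequence of elementary processes converging to H. *)
Definition is_ito_integral (B H : R -> T -> R) (t : R) (I : T -> R) :=
  measurable_fun [set: T] I /\
  exists phi : nat -> step_process,
    [/\ forall k, elementary t (phi k),
        (fun k => \int[P]_w \int[lebesgue_measure]_(s in `[0%R, t])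
           ((H s w - step_fun (phi k) s w) ^+ 2)%:E)%E @ \oo --> 0%E &
        (fun k => \int[P]_w ((I w - step_integral (phi k) B w) ^+ 2)%:E)%E
           @ \oo --> 0%E].

End Ito.

(* dX = b(X) dt + C(X) dW, X(0) = x0.  The state space is a parameter D, on
   which the coefficients are assumed to be bounded, so that the integrands of
   the stochastic integrals are square integrable. *)
Definition strong_solution (n : nat) (D : set 'cV[R]_n)
    (b : 'cV[R]_n -> 'cV[R]_n) (C : 'cV[R]_n -> 'M[R]_n) (x0 : 'cV[R]_n)
    (W : 'I_n -> R -> T -> R) (X : R -> T -> 'cV[R]_n) :=
  let F := brownian_filtration W in
  [/\ {ae P, forall w, X 0 w = x0},
      {ae P, forall w, forall t, 0 <= t -> D (X t w)},
      forall i w, {within `[0, +oo[, continuous (fun t => X t w i 0)},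
      forall t i, 0 <= t -> F_measurable F t (fun w => X t w i 0) &
      forall t i, 0 <= t -> exists I : 'I_n -> T -> R,
        (forall j, is_ito_integral F (W j) (fun s w => C (X s w) i j) t (I j))
        /\ {ae P, forall w, X t w i 0 = x0 i 0
             + \int[lebesgue_measure]_(s in `[0, t]) b (X s w) i 0
             + \sum_j I j w}].

Definition stochastic_replicator (n : nat) (A : 'M[R]_n) (sigma : 'I_n -> R)
    (x0 : 'cV[R]_n) (W : 'I_n -> R -> T -> R) (X : R -> T -> 'cV[R]_n) :=
  strong_solution simplex (replicator_drift A sigma)
    (replicator_diffusion sigma) x0 W X.

Definition transient (n : nat) (X : R -> T -> 'cV[R]_n) :=
  {ae P, forall w, dist_to bd_simplex (X t w) @[t --> +oo] --> (0 : R)}.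

End Stochastic.

(* Main.v *)
Require Import Defs.
From HB Require Import structures.
From mathcomp Require Import all_boot all_order all_algebra.
From mathcomp Require Import all_classical all_reals all_analysis.
From mathcomp Require Import ring lra.
From mathcomp Require Import measurable_realfun.
Import Order.TTheory GRing.Theory Num.Theory.
Import numFieldNormedType.Exports.
Set Implicit Arguments.
Unset Strict Implicit.
Unset Printing Implicit Defensive.
Local Open Scope classical_set_scope.
Local Open Scope ring_scope.

(* For an exponent vector eps p with small eps > 0, let f be the product of the
   powers (x_i + eta)^(eps p_i).  Applying the generator L of the diffusion to f
   gives eps f times the drift of sum_i p_i log x_i, up to a quadratic term in eps
   and an error of order eta / x_j.  This drift equals
     - (x - p)^T At (x - p) - 1/2 sum_i sigma_i^2 x_i (1 - x_i),  At = tilde A,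
   which is negative on the simplex because At is conditionally positive definite
   and p is not a vertex; by compactness it is bounded away from 0.  Hence
   L f <= - c f + O(eta) (1 + sum_j (x_j + eta)^-2), and the moments of
   (x_j + eta)^-2 stay bounded on bounded time intervals uniformly in eta.  Letting
   eta tend to 0 in Doob's maximal inequality shows that, after time t, the
   coordinates in I^+ all exceed a given mu with probability O(exp(- c t)), as f
   is bounded below where they do.

   Ito's formula is replaced by one-step Euler expansions with error O(h^(3/2)),
   summed up by a discrete Gronwall argument; they only use that a stochastic
   integral over [s, t] is orthogonal to the sigma-algebra at time s and satisfies
   an L^2 bound. *)

(** * Second order expansion of power products *)

(** Three limits are taken, in this order. The constants of the one-step expansions depend on [eta],
    so the step size tends to 0 first, with [eta] fixed; then [eta] tends to 0 on a fixed finite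
    time grid; only at the end is the grid refined, by continuity of the paths. The shift by [eta]
    is forced: p may have coordinates of either sign, and unshifted power products are in general
    neither bounded nor smooth at the boundary. The relative error of the shift, eta / (x_j + eta),
    is not small near the boundary and is controlled in mean only. This works because both
    coefficients of the ith equation contain the factor x_i: the generator applied to any power
    product, divided by that product, is bounded uniformly in [eta]. Negative moments therefore grow
    at most exponentially from their finite value at the interior point x0. Conditional expectations
    are replaced by weights: an estimate starting at time s is tested against every bounded [zeta]
    measurable for [F s]. Each time carries its own versions of the stochastic integrals, so
    everything up to the maximal inequality concerns finitely many times. *)

Section Taylor.
Context {R : realType}.
Implicit Types x y z u : R.

(** The conditions |x| <= |y| and 0 <= x * y describe the segment from 0 to y whatever the sign of
    y. *)
Lemma MVT0_bound (f df : R -> R) (y M : R) : f 0 = 0 -> 0 <= M ->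
  (forall x, `|x| <= `|y| -> 0 <= x * y -> is_derive x 1 f (df x)) ->
  (forall x, `|x| <= `|y| -> 0 <= x * y -> `|df x| <= M) ->
  `|f y| <= M * `|y|.
Proof.
move=> f0 M0 fdf dfM; have [->|y0] := eqVneq y 0; first by rewrite f0 !normr0 mulr0.
have [yp|yn] := ltP 0 y.
- have H x : x \in `[0, y] -> `|x| <= `|y| /\ 0 <= x * y.
    rewrite in_itv/= => /andP[x0 xy]; split; last by rewrite mulr_ge0// ltW.
    by rewrite !ger0_norm// ltW.
  have [c cy] : exists2 c, c \in `]0, y[ & f y - f 0 = df c * (y - 0).
    apply: MVT => //.
      by move=> x /subset_itv_oo_cc/H[]; exact: fdf.
    apply: derivable_within_continuous => x /H[xy xy0].
    by have [] := fdf _ xy xy0.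
  rewrite f0 !subr0 => ->; rewrite normrM ler_wpM2r//.
  by have [] := H _ (subset_itv_oo_cc cy); exact: dfM.
- have {}yn : y < 0 by rewrite lt_neqAle y0.
  have H x : x \in `[y, 0] -> `|x| <= `|y| /\ 0 <= x * y.
    rewrite in_itv/= => /andP[x0 xy]; split; last by rewrite mulr_le0// ltW.
    by rewrite !ler0_norm ?lerN2// ltW.
  have [c cy] : exists2 c, c \in `]y, 0[ & f 0 - f y = df c * (0 - y).
    apply: MVT => //.
      by move=> x /subset_itv_oo_cc/H[]; exact: fdf.
    apply: derivable_within_continuous => x /H[xy xy0].
    by have [] := fdf _ xy xy0.
  rewrite f0 !sub0r -normrN => ->; rewrite normrM normrN ler_wpM2r//.
  by have [] := H _ (subset_itv_oo_cc cy); exact: dfM.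
Qed.

Lemma expR_taylor0 y : `|expR y - 1| <= `|y| * expR `|y|.
Proof.
have h1 := expR_ge1Dx y; have h2 := expR_ge1Dx (- y).
have e0 : 0 < expR y := expR_gt0 y.
have {}h2 : expR y - 1 <= y * expR y.
  move: h2; rewrite expRN -(ler_pM2r e0) mulVf ?gt_eqF//; lra.
have [y0|/ltW y0] := leP 0 y.
  by rewrite !ger0_norm//; lra.
have he : expR y <= 1 by rewrite -expR0 ler_expR.
rewrite (@ler0_norm _ (_ - 1)) ?subr_le0// (@ler0_norm _ y)//.
rewrite opprB mulNr -mulrN.
have h3 : 1 <= expR (- y) by rewrite -expR0 ler_expR oppr_ge0.
have : 0 <= - y * (expR (- y) - 1) by rewrite mulr_ge0 ?oppr_ge0// subr_ge0.
lra.
Qed.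

(** Each Taylor remainder of the exponential has the preceding one as derivative, so [MVT0_bound]
    gains one power of |y| per order. The constants are not sharp. *)
Lemma expR_taylor1 y : `|expR y - 1 - y| <= `|y| ^+ 2 * expR `|y|.
Proof.
rewrite expr2 mulrAC.
apply: (@MVT0_bound (fun y => expR y - 1 - y) (fun y => expR y - 1)).
- by rewrite expR0; lra.
- by rewrite mulr_ge0// expR_ge0.
- by move=> x _ _; apply: is_derive_eq; rewrite subr0.
- move=> x xy _; apply: (le_trans (expR_taylor0 x)).
  by rewrite ler_pM// ?expR_ge0// ler_expR.
Qed.

Lemma expR_taylor2 y :
  `|expR y - 1 - y - y ^+ 2 / 2| <= `|y| ^+ 3 * expR `|y|.
Proof.
rewrite (exprS `|y|) -mulrA [leRHS]mulrC.
apply: (@MVT0_bound (fun y => expR y - 1 - y - y ^+ 2 / 2)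
  (fun y => expR y - 1 - y)).
- by rewrite expR0; lra.
- by rewrite mulr_ge0// expR_ge0.
- move=> x _ _; apply: is_derive_eq.
  by rewrite subr0 /= /GRing.scale/=; field.
- move=> x xy _; apply: (le_trans (expR_taylor1 x)).
  by rewrite ler_pM// ?expR_ge0// ?ler_expR// lerXn2r// ?nnegrE.
Qed.

(** The remainder has derivative x^2 / (1 + x). Since [a <= 1], the lower bound [a] for 1 + u holds
    along the whole segment from 0 to u and controls the denominator. *)
Lemma ln1D_taylor2 a u : 0 < a -> a <= 1 -> a <= 1 + u ->
  `|ln (1 + u) - u + u ^+ 2 / 2| <= a^-1 * `|u| ^+ 3.
Proof.
move=> a0 a1 au; rewrite (exprSr _ 2) mulrA.
pose df x := (1 + x)^-1 - 1 + x.
have H x : `|x| <= `|u| -> 0 <= x * u -> a <= 1 + x.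
  move=> xu.
  have [x0|x0] := leP 0 x; first by lra.
  rewrite nmulr_rge0// => u0; move: xu.
  by rewrite !ler0_norm ?(ltW x0)//; lra.
apply: (@MVT0_bound (fun u => ln (1 + u) - u + u ^+ 2 / 2) df).
- by rewrite addr0 ln1; lra.
- by rewrite mulr_ge0// ?invr_ge0 ?exprn_ge0// ltW.
- move=> x xu xu0; have {}xu0 := H _ xu xu0; rewrite /df.
  have x0 : 0 < 1 + x by lra.
  have h : is_derive x 1 (fun u => ln (1 + u)) (1 + x)^-1.
    have h1 : is_derive x 1 (+%R 1 : R -> R) 1.
      rewrite -[X in is_derive _ _ X _]/(cst 1 + id).
      by apply: is_derive_eq; rewrite add0r.
    by apply: is_derive_eq (is_derive1_comp (is_derive1_ln x0) h1) _; rewrite mulr1.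
  apply: is_derive_eq.
  by rewrite /= /GRing.scale/=; field; lra.
- move=> x xu xu0; have {}xu0 := H _ xu xu0; rewrite /df.
  have x0 : 0 < 1 + x by lra.
  have -> : (1 + x)^-1 - 1 + x = (1 + x)^-1 * x ^+ 2 by field; lra.
  rewrite normrM normrX ler_pM// ?exprn_ge0// ?lerXn2r ?nnegrE//.
  by rewrite gtr0_norm ?invr_gt0// lef_pV2 ?posrE.
Qed.

End Taylor.

Section Potential.
Context {R : realType} {n : nat}.
Implicit Types (q : 'I_n -> R) (eta : R) (x y : 'cV[R]_n).

(* The power product of the [x i 0 + eta] with exponents [q i]; [eta > 0] keeps it
   smooth up to the boundary of the simplex. *)
Definition pot q eta x : R := expR (\sum_i q i * ln (x i 0 + eta)).

Lemma pot_gt0 q eta x : 0 < pot q eta x.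
Proof. exact: expR_gt0. Qed.

Definition in_box x := forall i, 0 <= x i 0 <= 1.

Lemma in_box_addr_gt0 x eta i : 0 < eta -> in_box x -> 0 < x i 0 + eta.
Proof. by move=> e0 /(_ i)/andP[]; lra. Qed.

Lemma ler_normM_sum (a b : 'I_n -> R) :
  `|\sum_i a i * b i| <= (\sum_i `|a i|) * (\sum_i `|b i|).
Proof.
apply: (le_trans (ler_norm_sum _ _ _)); rewrite mulr_suml ler_sum// => i _.
rewrite normrM ler_wpM2l// (bigD1 i)//= lerDl sumr_ge0//.
Qed.

Lemma ler_norm_half (x : R) : `|x / 2| <= `|x|.
Proof. by rewrite normrM (@ger0_norm _ 2^-1) ?invr_ge0// ler_piMr//; lra. Qed.

Lemma pot_ub q eta : 0 < eta -> eta <= 1 ->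
  exists2 K : R, 0 < K & forall x, in_box x -> pot q eta x <= K.
Proof.
move=> e0 e1; exists (expR ((\sum_i `|q i|) * (\sum_(i < n) (`|ln eta| + ln 2)))).
  exact: expR_gt0.
move=> x bx; rewrite ler_expR; apply: (le_trans (ler_norm _)).
apply: (le_trans (ler_normM_sum _ _)); rewrite ler_wpM2l ?sumr_ge0// ler_sum//.
move=> i _; have := bx i => /andP[x0 x1].
have h1 : ln eta <= ln (x i 0 + eta) by rewrite ler_ln ?posrE; lra.
have h2 : ln (x i 0 + eta) <= ln 2 by rewrite ler_ln ?posrE; lra.
have h3 : 0 <= ln 2 :> R by rewrite ln_ge0; lra.
have h4 := ler_norm (- ln eta); rewrite normrN in h4.
have h5 := normr_ge0 (ln eta).
rewrite ler_norml; apply/andP; split; lra.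
Qed.

(** The expansion has two stages. With u_i the relative increments, the exponent changes by S =
    sum_i q_i ln (1 + u_i), which is S1 - S2 / 2 up to third order, and exp S is 1 + S + S^2 / 2 up
    to third order. The second order is kept because squared increments of a diffusion have the size
    of the time step. *)
Lemma pot_taylor q eta : 0 < eta -> eta <= 1 ->
  exists2 K : R, 0 < K & forall x y (u : 'I_n -> R),
    in_box x -> in_box y -> (forall i, u i = (y i 0 - x i 0) / (x i 0 + eta)) ->
    `| pot q eta y - pot q eta x * (1 + \sum_i q i * u i
        + (\sum_i q i * u i) ^+ 2 / 2 - (\sum_i q i * u i ^+ 2) / 2)|
    <= K * (\sum_i `|y i 0 - x i 0|) ^+ 3.
Proof.
(* The least possible value of 1 + u_i = (y_i + eta) / (x_i + eta) for points of the box. *)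
move=> e0 e1; pose a : R := eta / (1 + eta).
have a0 : 0 < a by rewrite divr_gt0//; lra.
have a1 : a <= 1 by rewrite ler_pdivrMr; lra.
have [K0 K00 K0E] := pot_ub q e0 e1.
pose Q : R := \sum_i `|q i|; have Q0 : 0 <= Q by exact: sumr_ge0.
(* [B] bounds D = sum_i |u_i|; [K1] bounds |ln (1 + u_i)| / |u_i|; [K2 * D ^+ 2] bounds the distance
   of S to its linear part S1; [E] absorbs the exponential in the remainder of exp S; [K3] adds up
   the third order errors. *)
pose B : R := n%:R / eta.
have B0 : 0 <= B by rewrite divr_ge0// ltW.
pose K1 : R := 1 + B + a^-1 * B ^+ 2.
have K10 : 0 <= K1 by rewrite !addr_ge0// mulr_ge0 ?invr_ge0 ?exprn_ge0// ltW.
pose K2 : R := Q * (1 + a^-1 * B).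
have K20 : 0 <= K2.
  by rewrite mulr_ge0// addr_ge0// mulr_ge0// invr_ge0 ltW.
pose E : R := expR (K1 * Q * B).
pose K3 : R := (K1 * Q) ^+ 3 * E + Q * a^-1 + K2 * (K1 + 1) * Q.
have K30 : 0 <= K3.
  rewrite /K3; apply: addr_ge0; first apply: addr_ge0.
  - by rewrite mulr_ge0 ?expR_ge0// exprn_ge0// mulr_ge0.
  - by rewrite mulr_ge0// invr_ge0 ltW.
  - by apply: mulr_ge0 => //; apply: mulr_ge0 => //; rewrite addr_ge0.
exists (K0 * (K3 * eta^-1 ^+ 3) + 1).
  rewrite ltr_wpDl//; apply: mulr_ge0; first exact: ltW.
  by apply: mulr_ge0 => //; rewrite exprn_ge0 ?invr_ge0 ?ltW.
move=> x y u bx byy uE.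
pose D : R := \sum_i `|u i|; have D0 : 0 <= D by exact: sumr_ge0.
pose z i := ln (1 + u i).
have ui i : `|u i| <= eta^-1 * `|y i 0 - x i 0|.
  rewrite uE normrM mulrC ler_wpM2r// gtr0_norm ?invr_gt0 ?in_box_addr_gt0//.
  by rewrite lef_pV2 ?posrE ?in_box_addr_gt0//; have /andP[] := bx i; lra.
have DS : D <= eta^-1 * \sum_i `|y i 0 - x i 0|.
  by rewrite mulr_sumr; apply: ler_sum => i _; exact: ui.
have DB : D <= B.
  apply: (le_trans DS); rewrite /B mulrC ler_wpM2r ?invr_ge0 ?(ltW e0)//.
  rewrite -[leRHS](_ : \sum_(i < n) 1 = _); last first.
    by rewrite sumr_const card_ord.
  apply: ler_sum => i _; have /andP[? ?] := bx i; have /andP[? ?] := byy i.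
  by rewrite ler_norml; apply/andP; split; lra.
have uD i : `|u i| <= D by rewrite /D (bigD1 i)//= lerDl sumr_ge0.
have au i : a <= 1 + u i.
  have x0 := in_box_addr_gt0 i e0 bx.
  have -> : 1 + u i = (y i 0 + eta) / (x i 0 + eta) by rewrite uE; field; lra.
  have /andP[? ?] := bx i; have /andP[? ?] := byy i.
  by rewrite ler_pM ?invr_ge0 ?(ltW e0)//; [lra|lra|rewrite lef_pV2 ?posrE; lra].
have zi i : ln (y i 0 + eta) = ln (x i 0 + eta) + z i.
  have x0 := in_box_addr_gt0 i e0 bx.
  rewrite /z -lnM ?posrE//; last by rewrite (lt_le_trans a0)//.
  by congr ln; rewrite uE; field; lra.
pose S : R := \sum_i q i * z i.
pose S1 : R := \sum_i q i * u i.
pose S2 : R := \sum_i q i * u i ^+ 2.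
have fy : pot q eta y = pot q eta x * expR S.
  rewrite /pot -expRD; congr expR; rewrite -big_split/=.
  by apply: eq_bigr => i _; rewrite zi mulrDr.
have zu i : `|z i - u i + u i ^+ 2 / 2| <= a^-1 * `|u i| ^+ 3.
  exact: ln1D_taylor2.
have DXle k : (\sum_i `|u i| ^+ k.+1) <= D ^+ k.+1.
  rewrite exprSr mulr_sumr; apply: ler_sum => i _.
  by rewrite exprSr ler_wpM2r// lerXn2r ?nnegrE.
have a'0 : 0 <= a^-1 by rewrite invr_ge0 ltW.
have SS : `|S - S1 + S2 / 2| <= Q * a^-1 * D ^+ 3.
  have -> : S - S1 + S2 / 2 = \sum_i q i * (z i - u i + u i ^+ 2 / 2).
    rewrite /S /S1 /S2 mulr_suml -sumrB -big_split/=.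
    by apply: eq_bigr => i _; ring.
  apply: (le_trans (ler_normM_sum _ _)); rewrite -mulrA ler_wpM2l//.
  apply: le_trans (_ : \sum_i a^-1 * `|u i| ^+ 3 <= _); first exact: ler_sum.
  by rewrite -mulr_sumr ler_wpM2l.
have S2b : `|S2| <= Q * D ^+ 2.
  apply: (le_trans (ler_normM_sum _ _)); rewrite ler_wpM2l//.
  apply: le_trans (DXle 1%N); apply: ler_sum => i _; by rewrite normrX.
have S1b : `|S1| <= Q * D by exact: ler_normM_sum.
have SS1 : `|S - S1| <= K2 * D ^+ 2.
  have -> : S - S1 = (S - S1 + S2 / 2) - S2 / 2 by ring.
  apply: (le_trans (ler_normB _ _)).
  have h1 : Q * a^-1 * D ^+ 3 <= Q * a^-1 * B * D ^+ 2.
    by rewrite (exprS _ 2) mulrA ler_wpM2r ?exprn_ge0// ler_wpM2l ?mulr_ge0.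
  have h2 : `|S2 / 2| <= Q * D ^+ 2.
    by apply: le_trans S2b; exact: ler_norm_half.
  by rewrite /K2; move: SS h1 h2; lra.
have Sb : `|S| <= K1 * Q * D.
  apply: (le_trans (ler_normM_sum _ _)); rewrite (mulrC K1) -mulrA ler_wpM2l//.
  rewrite mulr_sumr; apply: ler_sum => i _.
  have -> : z i = (z i - u i + u i ^+ 2 / 2) - u i ^+ 2 / 2 + u i by ring.
  apply: (le_trans (ler_normD _ _)).
  have h1 := ler_normB (z i - u i + u i ^+ 2 / 2) (u i ^+ 2 / 2).
  have h2 : a^-1 * `|u i| ^+ 3 <= a^-1 * B ^+ 2 * `|u i|.
    rewrite exprSr mulrA ler_wpM2r// ler_wpM2l// lerXn2r ?nnegrE//.
    exact: le_trans DB.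
  have h3 : `|u i ^+ 2 / 2| <= B * `|u i|.
    apply: (le_trans (ler_norm_half _)); rewrite normrX expr2 ler_wpM2r//.
    exact: le_trans (uD i) DB.
  rewrite /K1; move: (zu i) h1 h2 h3; lra.
have EE : `|expR S - 1 - S - S ^+ 2 / 2| <= (K1 * Q) ^+ 3 * E * D ^+ 3.
  apply: (le_trans (expR_taylor2 S)).
  rewrite [leRHS]mulrAC -exprMn.
  rewrite ler_pM ?exprn_ge0 ?expR_ge0// ?lerXn2r ?nnegrE ?mulr_ge0//.
  rewrite ler_expR; apply: (le_trans Sb); rewrite ler_wpM2l ?mulr_ge0//.
have SQ : `|(S ^+ 2 - S1 ^+ 2) / 2| <= K2 * (K1 + 1) * Q * D ^+ 3.
  have -> : (S ^+ 2 - S1 ^+ 2) / 2 = (S - S1) * ((S + S1) / 2) by ring.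
  have -> : K2 * (K1 + 1) * Q * D ^+ 3 = (K2 * D ^+ 2) * ((K1 + 1) * Q * D) by ring.
  rewrite normrM ler_pM//.
  have h0 := normr_ge0 (S + S1).
  have h := ler_norm_half (S + S1).
  by have := ler_normD S S1; move: Sb S1b; lra.
have T3 : `|expR S - (1 + S1 + S1 ^+ 2 / 2 - S2 / 2)| <= K3 * D ^+ 3.
  have -> : expR S - (1 + S1 + S1 ^+ 2 / 2 - S2 / 2) =
    (expR S - 1 - S - S ^+ 2 / 2) + (S - S1 + S2 / 2) + (S ^+ 2 - S1 ^+ 2) / 2.
    by ring.
  apply: (le_trans (ler_normD _ _)).
  have := ler_normD (expR S - 1 - S - S ^+ 2 / 2) (S - S1 + S2 / 2).
  by rewrite /K3; move: EE SS SQ; lra.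
rewrite fy -mulrBr normrM (ger0_norm (ltW (pot_gt0 _ _ _))).
rewrite mulrDl mul1r ler_wpDr ?exprn_ge0 ?sumr_ge0//.
rewrite -(mulrA K0) ler_pM ?(ltW (pot_gt0 _ _ _)) ?K0E//.
rewrite -mulrA -exprMn.
apply: (le_trans T3); rewrite ler_wpM2l// lerXn2r ?nnegrE//.
by rewrite mulr_ge0 ?invr_ge0 ?(ltW e0) ?sumr_ge0.
Qed.

End Potential.

(** * Expectations and Gaussian moments *)

Section Expectation.
Context {d : measure_display} {T : measurableType d} {R : realType}.
Variable P : probability T R.
Implicit Types f g : T -> R.

Definition Ex f : R := \int[P]_w f w.

Definition intg f := P.-integrable setT (EFin \o f).

Definition sq_intg f := measurable_fun setT f /\ intg (fun w => f w ^+ 2).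

Lemma intg_meas f : intg f -> measurable_fun setT f.
Proof. by move=> /measurable_int/measurable_EFinP. Qed.

Lemma le_intg f g : measurable_fun setT f -> (forall w, `|f w| <= `|g w|) ->
  intg g -> intg f.
Proof.
move=> mf fg ig; apply: le_integrable ig => //; first exact/measurable_EFinP.
by move=> w _; rewrite /= lee_fin.
Qed.

Lemma intg_cst (c : R) : intg (fun=> c).
Proof. exact: finite_measure_integrable_cst. Qed.

Lemma intg_bounded f (M : R) : measurable_fun setT f ->
  (forall w, `|f w| <= M) -> intg f.
Proof.
move=> mf fM; apply: le_intg (intg_cst M) => // w.
by rewrite (le_trans (fM w))// ler_norm.
Qed.

Lemma intgD f g : intg f -> intg g -> intg (fun w => f w + g w).
Proof. by move=> fi gi; exact: (integrableD measurableT fi gi). Qed.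

Lemma intgZ (c : R) f : intg f -> intg (fun w => c * f w).
Proof. by move=> fi; exact: (integrableZl measurableT c fi). Qed.

Lemma intgN f : intg f -> intg (fun w => - f w).
Proof. by move=> /(intgZ (-1)); under eq_fun do rewrite mulN1r. Qed.

Lemma intgB f g : intg f -> intg g -> intg (fun w => f w - g w).
Proof. by move=> fi gi; exact/intgD/intgN. Qed.

Lemma intg_norm f : intg f -> intg (fun w => `|f w|).
Proof. by move=> fi; exact: (integrable_norm fi). Qed.

Lemma intg_sum I (r : seq I) (Q : pred I) (F : I -> T -> R) :
  (forall i, Q i -> intg (F i)) -> intg (fun w => \sum_(i <- r | Q i) F i w).
Proof.
move=> FI; elim: r => [|i r IH].
  by under eq_fun do rewrite big_nil; exact: intg_cst.
under eq_fun do rewrite big_cons.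
case Qi: (Q i) => //.
by apply: intgD => //; exact: FI.
Qed.

Lemma intgM_bounded f g (M : R) : measurable_fun setT f ->
  (forall w, `|f w| <= M) -> intg g -> intg (fun w => f w * g w).
Proof.
move=> mf fM ig; apply: le_intg (intgZ M ig).
  by apply: measurable_funM => //; exact: intg_meas.
move=> w; rewrite !normrM ler_wpM2r// (le_trans (fM w))//; exact: ler_norm.
Qed.

Lemma sq_intgM f g : sq_intg f -> sq_intg g -> intg (fun w => f w * g w).
Proof.
move=> [mf fi] [mg gi]; apply: le_intg (intgD fi gi).
  exact: measurable_funM.
move=> w; rewrite normrM (@ger0_norm _ (_ + _)) ?addr_ge0 ?sqr_ge0//.
rewrite -(real_normK (num_real (f w))) -(real_normK (num_real (g w))).
have := sqr_ge0 (`|f w| - `|g w|); have := sqr_ge0 (`|f w|).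
have := sqr_ge0 (`|g w|); rewrite sqrrB; lra.
Qed.

Lemma sq_intg_bounded f (M : R) : measurable_fun setT f ->
  (forall w, `|f w| <= M) -> sq_intg f.
Proof.
move=> mf fM; split=> //; apply: (@intg_bounded _ (M ^+ 2)).
  exact: measurable_funX.
by move=> w; rewrite normrX lerXn2r ?nnegrE// (le_trans _ (fM w)).
Qed.

Lemma sq_intg_intg f : sq_intg f -> intg f.
Proof.
move=> h; have /(sq_intgM h) : sq_intg (fun=> 1 : R).
  by apply: (@sq_intg_bounded _ `|1|).
by under eq_fun do rewrite mulr1.
Qed.

Lemma sq_intgD f g : sq_intg f -> sq_intg g -> sq_intg (fun w => f w + g w).
Proof.
move=> hf hg; have fg := sq_intgM hf hg; case: hf hg => [mf fi] [mg gi].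
split; first exact: measurable_funD.
under eq_fun do rewrite sqrrD.
by apply: intgD => //; apply: intgD => //; under eq_fun do rewrite -mulr_natl; exact: intgZ.
Qed.

Lemma sq_intgM_bounded f g (M : R) : measurable_fun setT f ->
  (forall w, `|f w| <= M) -> sq_intg g -> sq_intg (fun w => f w * g w).
Proof.
move=> mf fM [mg gi]; split; first exact: measurable_funM.
under eq_fun do rewrite exprMn.
apply: (@intgM_bounded _ _ (M ^+ 2)) => //; first exact: measurable_funX.
by move=> w; rewrite normrX lerXn2r ?nnegrE// (le_trans _ (fM w)).
Qed.

Lemma sq_intgZ (c : R) f : sq_intg f -> sq_intg (fun w => c * f w).
Proof. by apply: (@sq_intgM_bounded (fun=> c) f `|c|). Qed.

Lemma sq_intgN f : sq_intg f -> sq_intg (fun w => - f w).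
Proof. by move=> /(sq_intgZ (-1)); under eq_fun do rewrite mulN1r. Qed.

Lemma sq_intgB f g : sq_intg f -> sq_intg g -> sq_intg (fun w => f w - g w).
Proof. by move=> hf hg; apply: sq_intgD => //; exact: sq_intgN. Qed.

Lemma sq_intg_sum I (r : seq I) (F : I -> T -> R) :
  (forall i, sq_intg (F i)) -> sq_intg (fun w => \sum_(i <- r) F i w).
Proof.
move=> FI; elim: r => [|i r IH].
  under eq_fun do rewrite big_nil.
  by apply: (@sq_intg_bounded (fun=> 0) 0) => // w; rewrite normr0.
under eq_fun do rewrite big_cons.
by apply: sq_intgD.
Qed.

Lemma eq_Ex f g : f =1 g -> Ex f = Ex g.
Proof. by move=> fg; apply: eq_Rintegral => w _. Qed.

Lemma ExD f g : intg f -> intg g -> Ex (fun w => f w + g w) = Ex f + Ex g.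
Proof. by move=> fi gi; rewrite /Ex RintegralD. Qed.

Lemma ExB f g : intg f -> intg g -> Ex (fun w => f w - g w) = Ex f - Ex g.
Proof. by move=> fi gi; rewrite /Ex RintegralB. Qed.

Lemma ExZ (c : R) f : intg f -> Ex (fun w => c * f w) = c * Ex f.
Proof. by move=> fi; rewrite /Ex RintegralZl. Qed.

Lemma Ex_cst (c : R) : Ex (fun=> c) = c.
Proof.
rewrite /Ex Rintegral_cst//.
have -> : fine (P [set: T]) = 1 by rewrite probability_setT.
by rewrite mulr1.
Qed.

Lemma Ex_sum I (r : seq I) (F : I -> T -> R) : (forall i, intg (F i)) ->
  Ex (fun w => \sum_(i <- r) F i w) = \sum_(i <- r) Ex (F i).
Proof.
move=> FI; elim: r => [|i r IH].
  by rewrite big_nil -[RHS](Ex_cst 0); apply: eq_Ex => w; rewrite big_nil.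
rewrite big_cons -IH -ExD//; last exact: intg_sum.
by apply: eq_Ex => w; rewrite big_cons.
Qed.

Lemma le_Ex f g : intg f -> intg g -> (forall w, f w <= g w) -> Ex f <= Ex g.
Proof. by move=> fi gi fg; apply: le_Rintegral. Qed.

Lemma Ex_ge0 f : (forall w, 0 <= f w) -> 0 <= Ex f.
Proof. by move=> f0; apply: Rintegral_ge0. Qed.

(** Provides the sample point from which [0 <= M] follows when M bounds the absolute value of a
    weight. *)
Lemma probability_inhabited : exists w : T, True.
Proof.
have [/eqP T0|/set0P[w _]] := boolP ([set: T] == set0); last by exists w.
by have := probability_setT P; rewrite T0 measure0 => /eqP; rewrite eqe eq_sym oner_eq0.
Qed.

Lemma ler_norm_Ex f : intg f -> `|Ex f| <= Ex (fun w => `|f w|).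
Proof. by move=> fi; apply: le_normr_Rintegral. Qed.

Lemma ler_norm_Ex_le f g : intg f -> intg g -> (forall w, `|f w| <= g w) ->
  `|Ex f| <= Ex g.
Proof.
move=> fi gi fg; apply: (le_trans (ler_norm_Ex fi)); apply: le_Ex => //.
exact: intg_norm.
Qed.

Lemma Ex_indic A : measurable A -> (Ex \1_A)%:E = P A.
Proof.
move=> mA; rewrite /Ex /Rintegral integral_indic// setIT fineK//.
exact: fin_num_measure.
Qed.

Lemma intg_indic A : measurable A -> intg \1_A.
Proof.
move=> mA; apply: (@intg_bounded _ 1) => // w.
by rewrite ger0_norm// indicE lern1 leq_b1.
Qed.

Lemma ae_eq_Ex f g : measurable_fun setT f -> measurable_fun setT g ->
  {ae P, forall w, f w = g w} -> Ex f = Ex g.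
Proof.
move=> mf mg fg; rewrite /Ex /Rintegral; congr fine.
apply: ae_eq_integral => //; [exact/measurable_EFinP|exact/measurable_EFinP|].
by apply: filterS fg => w /= -> _.
Qed.

Lemma ae_eq_intg f g : measurable_fun setT g -> {ae P, forall w, f w = g w} ->
  intg f -> intg g.
Proof.
move=> mg fg fi; have mf := intg_meas fi; move: fi => /integrableP[_ h].
apply/integrableP; split; first exact/measurable_EFinP.
rewrite -(@ge0_ae_eq_integral _ _ _ _ _ (fun w => `|(f w)%:E|%E))//.
- by apply: measurableT_comp => //; exact/measurable_EFinP.
- by apply: measurableT_comp => //; exact/measurable_EFinP.
- by apply: filterS fg => w /= -> _.
Qed.

Lemma Ex_cvg (f_ : nat -> T -> R) f g : (forall k, measurable_fun setT (f_ k)) ->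
  measurable_fun setT f -> intg g -> (forall k w, `|f_ k w| <= g w) ->
  (forall w, f_ ^~ w @ \oo --> f w) -> Ex (f_ k) @[k --> \oo] --> Ex f.
Proof.
move=> mf_ mf gi f_g f_f; rewrite /Ex /Rintegral.
have f_f' : {ae P, forall w, setT w -> (EFin \o f_ n) w @[n --> \oo] --> (EFin \o f) w}.
  by apply: aeW => w _; apply: cvg_EFin (f_f w); exact: nearW.
have f_g' : {ae P, forall w n, setT w -> (`|(EFin \o f_ n) w| <= (EFin \o g) w)%E}.
  by apply: aeW => w k _; rewrite /= lee_fin.
have mf_' k : measurable_fun setT (EFin \o f_ k) by exact/measurable_EFinP.
have mf' : measurable_fun setT (EFin \o f) by exact/measurable_EFinP.
have [fi _ h] := dominated_convergence measurableT mf_' mf' f_f' gi f_g'.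
by apply: fine_cvg; rewrite fineK; [exact: h|exact: integrable_fin_num].
Qed.

End Expectation.

(** * Integration against a measure with a density *)

Section Density.
Context {d : measure_display} {T : measurableType d} {R : realType}.
Variables (mu nu : {measure set T -> \bar R}) (p : T -> R).
Hypothesis mp : measurable_fun setT p.
Hypothesis p0 : forall x, 0 <= p x.
Hypothesis nuE : forall V, measurable V -> nu V = (\int[mu]_(x in V) (p x)%:E)%E.

Import HBNNSimple.

Let density_nnsfun (h : {nnsfun T >-> R}) :
  (\int[nu]_x (h x)%:E = \int[mu]_x ((h x)%:E * (p x)%:E))%E.
Proof.
under [LHS]eq_integral do rewrite fimfunE -fsumEFin//.
rewrite [LHS]ge0_integral_fsum//; last 2 first.
- by move=> r; exact/measurable_EFinP/measurableT_comp.
- by move=> r x _; rewrite EFinM nnfun_muleindic_ge0.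
under [RHS]eq_integral.
  move=> x xD; rewrite fimfunE -fsumEFin// ge0_mule_fsuml; last first.
    by move=> r; rewrite EFinM nnfun_muleindic_ge0.
  over.
rewrite [RHS]ge0_integral_fsum//; last 2 first.
- move=> r; apply: emeasurable_funM; last exact/measurable_EFinP.
  by apply/measurable_EFinP/measurableT_comp.
- by move=> r x _; rewrite mule_ge0 ?lee_fin// -lee_fin EFinM nnfun_muleindic_ge0.
apply: eq_fsbigr => r _.
have [r0|r0] := ltP r 0.
  rewrite preimage_nnfun0//.
  rewrite !integral0_eq// => x _; by rewrite indic0 mulr0 // mul0e.
under [LHS]eq_integral do rewrite EFinM.
rewrite ge0_integralZl//; last exact/measurable_EFinP.
rewrite integral_indic// setIT nuE//.
under [RHS]eq_integral do rewrite EFinM -muleA.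
rewrite ge0_integralZl//.
- rewrite [in LHS]integral_mkcond; congr (_ * _)%E.
  apply: eq_integral => x _; rewrite patchE indicE.
  by case: ifPn => _; rewrite ?mul1e ?mul0e.
- apply: emeasurable_funM; last exact/measurable_EFinP.
  exact/measurable_EFinP.
- by move=> x _; rewrite mule_ge0// lee_fin.
Qed.

(** Simple functions come first, by linearity and the hypothesis on sets, then monotone convergence
    on both sides. *)
Lemma ge0_integral_density (f : T -> \bar R) : measurable_fun setT f ->
  (forall x, 0 <= f x)%E ->
  (\int[nu]_x f x = \int[mu]_x (f x * (p x)%:E))%E.
Proof.
move=> mf f0; pose f_ := nnsfun_approx measurableT mf.
transitivity (lim (\int[nu]_x (f_ n x)%:E @[n --> \oo])%E).
  rewrite -monotone_convergence//=.
  - apply: eq_integral => x xD; apply/esym/cvg_lim => //=.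
    by apply: cvg_nnsfun_approx => //; rewrite inE in xD.
  - by move=> n; exact/measurable_EFinP/measurable_funTS.
  - by move=> n ? _; rewrite lee_fin.
  - by move=> ? _ ? ? mn; rewrite lee_fin; exact/lefP/nd_nnsfun_approx.
transitivity (lim (\int[mu]_x ((f_ n x)%:E * (p x)%:E) @[n --> \oo])%E).
  by apply: congr_lim; apply/funext => n; exact: density_nnsfun.
rewrite -monotone_convergence//=.
- apply: eq_integral => x xD; apply/cvg_lim => //=.
  apply: cvgeMr => //.
  by apply: cvg_nnsfun_approx => //; rewrite inE in xD.
- move=> n; apply: emeasurable_funM; exact/measurable_EFinP/measurable_funTS.
- by move=> n ? _; rewrite mule_ge0// lee_fin.
- move=> x _ a b ab; rewrite lee_wpmul2r// lee_fin//.
  exact/lefP/nd_nnsfun_approx.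
Qed.

End Density.

Section GaussianMoments.
Context {R : realType}.

(** Completing the square: exp (theta x) times the centred density is a constant times the density
    with mean theta s^2, which integrates to 1. *)
Lemma normal_mgf (s theta : R) : s != 0 ->
  (\int[normal_prob 0 s]_x (expR (theta * x))%:E)%E =
  (expR (theta ^+ 2 * s ^+ 2 / 2))%:E.
Proof.
move=> s0.
rewrite (@ge0_integral_density _ _ _ lebesgue_measure _ (normal_pdf 0 s))//.
- transitivity (\int[lebesgue_measure]_x
      ((expR (theta ^+ 2 * s ^+ 2 / 2))%:E *
        (normal_pdf (theta * s ^+ 2) s x)%:E))%E.
    apply: eq_integral => x _; rewrite -!EFinM; congr EFin.
    rewrite !normal_pdfE//= mulrCA [RHS]mulrCA; congr (_ * _).
    rewrite /normal_fun -!expRD; congr expR.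
    by rewrite -mulr_natr; field.
  rewrite ge0_integralZl//.
  + by rewrite integral_normal_pdf mule1.
  + by apply/measurable_EFinP; exact: measurable_normal_pdf.
  + by move=> x _; rewrite lee_fin normal_pdf_ge0.
- exact: measurable_normal_pdf.
- by move=> x; exact: normal_pdf_ge0.
- by apply/measurable_EFinP; apply: measurableT_comp.
Qed.

(** Raise z <= exp z at z = y / k to the power k. *)
Lemma expr_le_expR (k : nat) (y : R) : 0 <= y -> y ^+ k <= k%:R ^+ k * expR y.
Proof.
case: k => [|k] y0; first by rewrite !expr0 mul1r -expR0 ler_expR.
have h : y / k.+1%:R <= expR (y / k.+1%:R).
  by apply: le_trans (expR_ge1Dx _); rewrite lerDr.
rewrite -ler_pdivrMl ?exprn_gt0// -exprVn -exprMn mulrC.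
apply: (@le_trans _ _ (expR (y / k.+1%:R) ^+ k.+1)).
  by rewrite lerXn2r ?nnegrE ?divr_ge0// expR_ge0.
by rewrite -expRM_natl mulrC divfK.
Qed.

Lemma norm_le_eps_eq0 (a C : R) :
  (forall t : R, 0 < t -> t <= 1 -> `|a| <= C * t) -> a = 0.
Proof.
move=> h; apply/eqP; rewrite -normr_le0.
have C0 : 0 <= C by have := h 1 ltr01 (lexx _); rewrite mulr1; exact: le_trans.
apply/ler_addgt0Pl => e e0; rewrite addr0.
pose t := Num.min 1 (e / (C + 1)).
have t0 : 0 < t by rewrite lt_min ltr01 divr_gt0//; lra.
have t1 : t <= 1 by rewrite ge_min lexx.
apply: (le_trans (h _ t0 t1)).
have : t <= e / (C + 1) by rewrite ge_min lexx orbT.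
rewrite ler_pdivlMr; last lra.
by nra.
Qed.

(** Reads off two Taylor coefficients from a cubic error bound, so that moments follow from the
    moment generating function without differentiating under the expectation. *)
Lemma poly2_cancel (a b C : R) :
  (forall t : R, 0 < t -> t <= 1 -> `|a * t + b * t ^+ 2| <= C * t ^+ 3) ->
  a = 0 /\ b = 0.
Proof.
move=> h.
have C0 : 0 <= C.
  by have := h 1 ltr01 (lexx _); rewrite !expr1n !mulr1; apply: le_trans.
have a0 : a = 0.
  apply: (@norm_le_eps_eq0 _ (C + `|b|)) => t t0 t1.
  have h2 : `|a + b * t| <= C * t ^+ 2.
    have := h _ t0 t1.
    have -> : a * t + b * t ^+ 2 = t * (a + b * t) by ring.
    have -> : C * t ^+ 3 = t * (C * t ^+ 2) by ring.
    by rewrite normrM (gtr0_norm t0) ler_pM2l.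
  have h3 : `|a| <= `|a + b * t| + `|b * t|.
    by rewrite -{1}(addrK (b * t) a); exact: ler_normB.
  rewrite normrM (gtr0_norm t0) in h3.
  have h4 : C * t ^+ 2 <= C * t by rewrite ler_wpM2l// expr2 ler_piMr// ltW.
  by lra.
split=> //; apply: (@norm_le_eps_eq0 _ C) => t t0 t1.
have := h _ t0 t1; rewrite a0 mul0r add0r normrM (@ger0_norm _ (t ^+ 2)) ?sqr_ge0//.
by rewrite (exprS _ 2) mulrA ler_pM2r// exprn_gt0.
Qed.

Context {d : measure_display} {T : measurableType d} (P : probability T R).

Lemma gaussian_mgf (Y : T -> R) (s theta : R) : s != 0 ->
  measurable_fun setT Y ->
  (forall B, measurable B -> P (Y @^-1` B) = normal_prob 0 s B) ->
  intg P (fun w => expR (theta * Y w)) /\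
  Ex P (fun w => expR (theta * Y w)) = expR (theta ^+ 2 * s ^+ 2 / 2).
Proof.
move=> s0 mY lawY.
have me : measurable_fun setT (fun x : R => expR (theta * x)).
  by apply: measurableT_comp => //; exact: measurable_funM.
have mYe : measurable_fun setT (fun w => expR (theta * Y w)).
  exact: (measurableT_comp me mY).
have E : (\int[P]_w (expR (theta * Y w))%:E)%E = (expR (theta ^+ 2 * s ^+ 2 / 2))%:E.
  rewrite -normal_mgf//.
  transitivity (\int[pushforward P (Y : T -> measurableTypeR R)]_x (expR (theta * x))%:E)%E.
    by rewrite ge0_integral_pushforward//; exact/measurable_EFinP.
  by apply: eq_measure_integral => B mB _; exact: lawY.
split; last by rewrite /Ex /Rintegral E.
apply/integrableP; split; first exact/measurable_EFinP.
under eq_integral do rewrite /= ger0_norm ?expR_ge0//.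
by rewrite E ltry.
Qed.

Lemma expR_normM_le (c y : R) : 0 <= c -> expR (c * `|y|) <= expR (c * y) + expR (- c * y).
Proof.
move=> c0; have [y0|y0] := leP 0 y.
  by rewrite ger0_norm// lerDl expR_ge0.
by rewrite ler0_norm ?(ltW y0)// mulrN mulNr lerDr expR_ge0.
Qed.

Lemma normr_exp4 (x : R) : `|x| ^+ 4 = x ^+ 4.
Proof. by rewrite (exprM _ 2 2) real_normK ?num_real// -exprM. Qed.

Lemma expR_half_le2 : expR (2^-1 : R) <= 2.
Proof.
have h := expR_ge1Dx (- 2^-1 : R); have e0 := expR_gt0 (2^-1 : R).
rewrite expRN -(ler_pM2r e0) mulVf ?gt_eqF// in h; lra.
Qed.

(** Mean and variance: for small t, the expectation of the second order expansion of exp (t Y) is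
    compared with the expansion of exp (t^2 s^2 / 2). Fourth moment: y^4 <= 4^4 exp y at y = |Y| /
    |s|, and E exp (|Y| / |s|) <= 2 exp (1/2) <= 4, whence 1024 = 256 * 4. *)
Lemma gaussian_moments (Y : T -> R) (s : R) : s != 0 ->
  measurable_fun setT Y ->
  (forall B, measurable B -> P (Y @^-1` B) = normal_prob 0 s B) ->
  [/\ Ex P Y = 0, Ex P (fun w => Y w ^+ 2) = s ^+ 2,
      intg P (fun w => Y w ^+ 4) &
      Ex P (fun w => Y w ^+ 4) <= 1024 * s ^+ 4].
Proof.
move=> s0 mY lawY.
have mgf theta := gaussian_mgf theta s0 mY lawY.
have mYe (c : R) : measurable_fun setT (fun w => expR (c * `|Y w|)).
  by apply: measurableT_comp => //; apply: measurable_funM => //; exact: measurableT_comp.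
have iabs (c : R) : 0 <= c -> intg P (fun w => expR (c * `|Y w|)).
  move=> c0; apply: le_intg (intgD (mgf c).1 (mgf (- c)).1) => // w.
  rewrite (ger0_norm (expR_ge0 _)); apply: le_trans (ler_norm _).
  exact: (expR_normM_le (Y w) c0).
have iX k : intg P (fun w => `|Y w| ^+ k * expR `|Y w|).
  apply: le_intg (intgZ (k%:R ^+ k) (iabs 2 _)) => //.
    apply: measurable_funM; first exact/measurable_funX/measurableT_comp.
    by have := mYe 1; under eq_fun do rewrite mul1r.
  move=> w; move: `|Y w| (normr_ge0 (Y w)) => y y0.
  rewrite !ger0_norm ?mulr_ge0 ?expR_ge0 ?exprn_ge0//.
  rewrite (_ : 2 * y = y + y); last by ring.
  by rewrite expRD mulrA ler_wpM2r ?expR_ge0// expr_le_expR.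
have iY k : intg P (fun w => Y w ^+ k).
  apply: le_intg (iX k); first exact: measurable_funX.
  move=> w; rewrite normrX normrM; move: `|Y w| (normr_ge0 (Y w)) => y y0.
  rewrite ger0_norm ?exprn_ge0// ger0_norm ?expR_ge0//.
  by rewrite ler_peMr ?exprn_ge0// -expR0 ler_expR.
pose m1 := Ex P Y; pose m2 := Ex P (fun w => Y w ^+ 2).
pose C := Ex P (fun w => `|Y w| ^+ 3 * expR `|Y w|).
pose v := s ^+ 2 / 2.
have iY1 : intg P Y by exact: (iY 1%N).
have key (t : R) : 0 < t -> t <= 1 ->
    `|m1 * t + ((m2 - s ^+ 2) / 2) * t ^+ 2| <= (C + v ^+ 2 * expR v) * t ^+ 3.
  move=> t0 t1.
  have h1 : `|expR (t ^+ 2 * s ^+ 2 / 2) - 1 - m1 * t - m2 / 2 * t ^+ 2| <= C * t ^+ 3.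
    have <- : Ex P (fun w => expR (t * Y w) - 1 - t * Y w - (t ^+ 2 / 2) * Y w ^+ 2) =
        expR (t ^+ 2 * s ^+ 2 / 2) - 1 - m1 * t - m2 / 2 * t ^+ 2.
      rewrite ExB; last 2 first.
      - apply: intgB; last exact: intgZ.
        by apply: intgB; [exact: (mgf t).1|exact: intg_cst].
      - exact: intgZ.
      rewrite ExB; last 2 first.
      - by apply: intgB; [exact: (mgf t).1|exact: intg_cst].
      - exact: intgZ.
      rewrite ExB; [|exact: (mgf t).1|exact: intg_cst].
      rewrite (mgf t).2 Ex_cst !ExZ// -/m1 -/m2.
      by congr (_ - _ - _); ring.
    rewrite [leRHS]mulrC -ExZ; last exact: iX.
    apply: ler_norm_Ex_le; last 1 first.
    - move=> w.
      have -> : t ^+ 2 / 2 * Y w ^+ 2 = (t * Y w) ^+ 2 / 2 by ring.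
      apply: (le_trans (expR_taylor2 _)).
      rewrite normrM (gtr0_norm t0) exprMn -mulrA ler_wpM2l ?exprn_ge0 ?(ltW t0)//.
      by rewrite ler_wpM2l ?exprn_ge0// ler_expR ler_piMl.
    - apply: intgB; last exact: intgZ.
      apply: intgB; last exact: intgZ.
      by apply: intgB; [exact: (mgf t).1|exact: intg_cst].
    - exact: intgZ.
  have v0 : 0 <= v by rewrite divr_ge0 ?sqr_ge0.
  have t21 : t ^+ 2 <= 1 by rewrite exprn_ile1// ltW.
  have h2 : `|expR (t ^+ 2 * s ^+ 2 / 2) - 1 - t ^+ 2 * v| <= v ^+ 2 * expR v * t ^+ 3.
    rewrite -mulrA -/v; apply: (le_trans (expR_taylor1 _)).
    have tv0 : 0 <= t ^+ 2 * v by rewrite mulr_ge0// sqr_ge0.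
    rewrite (ger0_norm tv0).
    have -> : (t ^+ 2 * v) ^+ 2 * expR (t ^+ 2 * v) =
      v ^+ 2 * (expR (t ^+ 2 * v) * t ^+ 4) by ring.
    rewrite -mulrA ler_wpM2l ?sqr_ge0// ler_pM ?expR_ge0 ?exprn_ge0 ?(ltW t0)//.
      by rewrite ler_expR ler_piMl.
    by rewrite (exprSr _ 3) ler_piMr// exprn_ge0// ltW.
  have -> : m1 * t + (m2 - s ^+ 2) / 2 * t ^+ 2 =
      (expR (t ^+ 2 * s ^+ 2 / 2) - 1 - t ^+ 2 * v) -
      (expR (t ^+ 2 * s ^+ 2 / 2) - 1 - m1 * t - m2 / 2 * t ^+ 2).
    by rewrite /v; ring.
  apply: (le_trans (ler_normB _ _)); move: h1 h2; lra.
have [h1 h2] := poly2_cancel key.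
split=> //; first by move: h2; rewrite -/m2; lra.
have ns0 : 0 < `|s| by rewrite normr_gt0.
pose c : R := `|s|^-1.
have c0 : 0 <= c by rewrite invr_ge0.
apply: (@le_trans _ _ (Ex P (fun w => (4 ^+ 4 * s ^+ 4) * (expR (c * Y w) + expR (- c * Y w))))).
  apply: le_Ex => //.
    by apply: intgZ; apply: intgD; [exact: (mgf _).1|exact: (mgf _).1].
  move=> w; have h := @expr_le_expR 4 (c * `|Y w|) (mulr_ge0 c0 (normr_ge0 _)).
  rewrite -[leLHS](_ : s ^+ 4 * (c * `|Y w|) ^+ 4 = _); last first.
    by rewrite exprMn normr_exp4 mulrA -(normr_exp4 s) -exprMn divff ?normr_eq0// expr1n mul1r.
  have -> z : 4 ^+ 4 * s ^+ 4 * z = s ^+ 4 * (4 ^+ 4 * z) by ring.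
  apply: ler_wpM2l; first by rewrite -normr_exp4 exprn_ge0.
  apply: (le_trans h); apply: ler_wpM2l; first by rewrite exprn_ge0.
  exact: (expR_normM_le (Y w) c0).
rewrite ExZ; last by apply: intgD; [exact: (mgf _).1|exact: (mgf _).1].
rewrite ExD; [|exact: (mgf _).1|exact: (mgf _).1].
rewrite !(mgf _).2 sqrrN.
have -> : c ^+ 2 * s ^+ 2 / 2 = 2^-1.
  by rewrite /c exprVn real_normK ?num_real// mulVf ?mul1r// sqrf_eq0.
have := expR_half_le2.
have : 0 <= s ^+ 4 by rewrite -normr_exp4 exprn_ge0.
have -> : 4 ^+ 4 = 256 :> R by ring.
nra.
Qed.

End GaussianMoments.

(** * Brownian increments and the Brownian filtration *)

Section OrthogonalEvents.
Context {d : measure_display} {T : measurableType d} {R : realType}.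
Variable P : probability T R.

Definition orth_event (Y : T -> R) (G : set T) :=
  measurable G /\ Ex P (fun w => \1_G w * Y w) = 0.

Lemma intg_indicM (G : set T) (Y : T -> R) : measurable G -> intg P Y ->
  intg P (fun w => \1_G w * Y w).
Proof.
move=> mG iY; apply: (@intgM_bounded _ _ _ _ _ _ 1) => // w.
by rewrite ger0_norm// indicE lern1 leq_b1.
Qed.

Lemma Ex_indicM (G : set T) (Y : T -> R) : measurable G ->
  (Ex P (fun w => \1_G w * Y w)) = fine (\int[P]_(w in G) (Y w)%:E).
Proof.
move=> mG; rewrite /Ex /Rintegral [in RHS]integral_mkcond; congr fine.
apply: eq_integral => w _; rewrite patchE indicE.
by case: (w \in G); rewrite ?mul1r ?mul0r.
Qed.

Lemma orth_event_dynkin (Y : T -> R) : intg P Y -> Ex P Y = 0 ->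
  dynkin (orth_event Y).
Proof.
move=> iY EY; split.
- by split=> //; rewrite -[RHS]EY; apply: eq_Ex => w; rewrite indicT mul1r.
- move=> G [mG EG]; split; first exact: measurableC.
  have : Ex P (fun w => Y w - \1_G w * Y w) = 0.
    by rewrite ExB ?EY ?EG ?subrr//; exact: intg_indicM.
  move=> <-; apply: eq_Ex => w.
  by rewrite !indicE in_setC; case: (w \in G); rewrite ?mul1r ?mul0r ?subrr ?subr0.
- move=> F tF GF; have mF k : measurable (F k) by have [] := GF k.
  have mU : measurable (\bigcup_k F k) by exact: bigcup_measurable.
  split=> //; rewrite Ex_indicM// integral_bigcup//.
  + rewrite eseries0//= => k _ _; have [_] := GF k.
    rewrite Ex_indicM// => h; rewrite -[LHS]fineK ?h//.
    by apply: integrable_fin_num => //; exact: (integrableS measurableT).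
  + exact: (integrableS measurableT).
Qed.

(** This expresses that the conditional expectation of [Y] given the generated sigma-algebra
    vanishes. The events over which a centred [Y] integrates to 0 form a Dynkin system, so a
    generating pi-system suffices. *)
Lemma orth_event_sigma (Y : T -> R) (Pi : set (set T)) : intg P Y -> Ex P Y = 0 ->
  setI_closed Pi -> (forall G, Pi G -> orth_event Y G) ->
  forall G, <<s Pi >> G -> orth_event Y G.
Proof.
move=> iY EY PiI PiO G; rewrite -(setI_closed_g_dynkin_g_sigma_algebra PiI) => h.
by apply: h; split; [exact: orth_event_dynkin|exact: PiO].
Qed.

Import HBNNSimple.

Let orth_ge0 (xi Y : T -> R) : measurable_fun setT xi -> intg P Y ->
  (forall B, measurable B -> orth_event Y (xi @^-1` B)) ->
  (forall w, 0 <= xi w) ->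
  intg P (fun w => xi w * Y w) -> Ex P (fun w => xi w * Y w) = 0.
Proof.
move=> mxi iY hB xi0 ixiY.
(* The approximation is built on the real line, so that its level sets, pulled back along [xi], are
   events generated by [xi], to which [hB] applies. *)
pose f (x : R) : \bar R := (Num.max x 0)%:E.
have mf : measurable_fun setT f.
  apply/measurable_EFinP; exact: measurable_maxr.
pose g := nnsfun_approx measurableT mf.
have f0 x : [set: R] x -> (0 <= f x)%E by rewrite lee_fin le_max lexx orbT.
have gf k x : g k x <= Num.max x 0.
  by rewrite nnsfun_approxE -lee_fin; exact: (le_approx k f0).
have E0 k : Ex P (fun w => g k (xi w) * Y w) = 0.
  pose s := fset_set (range (g k)).
  pose r i := (finmap.enum_fset s)`_i.
  pose A i := xi @^-1` (g k @^-1` [set r i]).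
  have mA i : measurable (A i) by have [] := hB (g k @^-1` [set r i]) _.
  have E w : g k (xi w) * Y w =
      \sum_(i < size (finmap.enum_fset s)) r i * (\1_(A i) w * Y w).
    by rewrite fimfunEord mulr_suml; apply: eq_bigr => i _; rewrite mulrA.
  rewrite (eq_Ex P E) Ex_sum; last by move=> i; apply/intgZ/intg_indicM.
  rewrite big1// => i _; rewrite ExZ; last exact: intg_indicM.
  by have [|_ ->] := hB (g k @^-1` [set r i]) _; rewrite ?mulr0.
have h : Ex P (fun w => g k (xi w) * Y w) @[k --> \oo] --> Ex P (fun w => xi w * Y w).
  apply: (@Ex_cvg _ _ _ _ _ _ (fun w => `|xi w * Y w|)).
  - move=> k; apply: measurable_funM; last exact: intg_meas iY.
    exact: measurableT_comp.
  - by apply: measurable_funM => //; exact: intg_meas iY.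
  - exact: intg_norm.
  - move=> k w; rewrite !normrM ler_wpM2r// !ger0_norm//.
    by apply: (le_trans (gf _ _)); rewrite ge_max lexx/=.
  - move=> w; apply: cvgM; last exact: cvg_cst.
    have := @cvg_approx _ _ _ _ f (xi w) f0 I (ltry _).
    rewrite /= max_l// => h; apply: cvg_trans h.
    by apply: near_eq_cvg; apply: nearW => k; rewrite /g nnsfun_approxE.
move: h; rewrite (_ : (fun k => _) = (fun=> 0)); last exact/funext.
by move=> /cvg_lim <- //; rewrite lim_cst.
Qed.

(** The passage from events to random factors: simple functions of [xi], dominated convergence with
    the bound |xi Y|, and the splitting of [xi] into positive and negative part. *)
Lemma orth_ExM (xi Y : T -> R) : measurable_fun setT xi -> intg P Y ->
  (forall B, measurable B -> orth_event Y (xi @^-1` B)) ->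
  intg P (fun w => xi w * Y w) -> Ex P (fun w => xi w * Y w) = 0.
Proof.
move=> mxi iY hB ixiY.
pose xp w := Num.max (xi w) 0; pose xn w := Num.max (- xi w) 0.
have mxp : measurable_fun setT xp by exact: measurable_maxr.
have mxn : measurable_fun setT xn by apply: measurable_maxr => //; exact: measurable_funN.
have xE w : xi w * Y w = xp w * Y w - xn w * Y w.
  by rewrite -mulrBl /xp /xn; congr (_ * _); case: (leP (xi w) 0); case: (leP (- xi w) 0); lra.
have xple w : `|xp w| <= `|xi w|.
  by rewrite /xp; case: (leP (xi w) 0) => // _; rewrite normr0.
have xnle w : `|xn w| <= `|xi w|.
  by rewrite /xn; case: (leP (- xi w) 0) => // _; rewrite ?normr0 ?normrN.
have ip : intg P (fun w => xp w * Y w).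
  apply: le_intg ixiY; first by apply: measurable_funM => //; exact: intg_meas iY.
  by move=> w; rewrite !normrM ler_wpM2r.
have im : intg P (fun w => xn w * Y w).
  apply: le_intg ixiY; first by apply: measurable_funM => //; exact: intg_meas iY.
  by move=> w; rewrite !normrM ler_wpM2r.
have mp : measurable_fun setT (fun x : R => Num.max x 0) by exact: measurable_maxr.
have mn : measurable_fun setT (fun x : R => Num.max (- x) 0).
  by apply: measurable_maxr => //; exact: measurable_funN.
rewrite (eq_Ex P xE) ExB// !orth_ge0 ?subrr// => [B mB|w|B mB|w].
- have := hB ((fun x => Num.max (- x) 0) @^-1` B); apply.
  by rewrite -[X in measurable X]setTI; exact: mn.
- by rewrite /xn le_max lexx orbT.
- have := hB ((fun x => Num.max x 0) @^-1` B); apply.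
  by rewrite -[X in measurable X]setTI; exact: mp.
- by rewrite /xp le_max lexx orbT.
Qed.

End OrthogonalEvents.

Section SortedGrid.
Context {R : realType}.

(** The independence of Brownian increments is formulated for a single time grid; this puts the
    times of a cylinder event into one whose last interval is [u, v]. *)
Lemma sorted_grid (ts : seq R) (u v : R) : 0 <= u -> u <= v ->
  (forall s, s \in ts -> 0 <= s <= u) ->
  exists m (tau : nat -> R),
    [/\ tau 0 = 0, (forall k, (k <= m)%N -> tau k <= tau k.+1),
        tau m = u, tau m.+1 = v &
        forall s, s \in ts -> exists2 k, (k <= m)%N & s = tau k].
Proof.
move=> u0 uv tsu; pose l := sort <=%R (0 :: ts).
have sl : sorted <=%R l by exact: sort_le_sorted.
have lE s : s \in l = (s \in 0 :: ts) by rewrite mem_sort.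
have lu s : s \in l -> 0 <= s <= u.
  by rewrite lE inE => /predU1P[->|/tsu//]; rewrite lexx.
have szl : (0 < size l)%N by rewrite size_sort.
(* The list carries u at index [size l]; every later index returns the default v. *)
exists (size l), (nth v (rcons l u)); split.
- rewrite nth_rcons szl; apply/le_anti/andP; split.
    have /(nthP v)[k kl <-] : 0 \in l by rewrite lE mem_head.
    case: k kl => // k kl; exact: (sorted_ltn_nth le_trans).
  by have /lu/andP[] : nth v l 0 \in l by exact: mem_nth.
- move=> k; rewrite leq_eqVlt => /predU1P[->|kl].
    by rewrite nth_rcons ltnn eqxx nth_default ?size_rcons.
  rewrite !nth_rcons kl; case: ifPn => [kl'|].
    exact: (sorted_ltn_nth le_trans).
  rewrite -leqNgt => lk; have -> : k.+1 = size l by apply/eqP; rewrite eqn_leq kl.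
  by rewrite eqxx; have /lu/andP[] : nth v l k \in l by exact: mem_nth.
- by rewrite nth_rcons ltnn eqxx.
- by rewrite nth_default ?size_rcons.
- move=> s sts; have : s \in l by rewrite lE inE sts orbT.
  move=> /(nthP v)[k kl <-]; exists k; first exact: ltnW.
  by rewrite nth_rcons kl.
Qed.

End SortedGrid.

Section BrownianFiltration.
Context {R : realType} {d : measure_display} {T : measurableType d}.
Variable P : probability T R.
Context {n : nat} (W : 'I_n -> R -> T -> R).
Hypothesis BW : standard_brownian_motion P W.
Local Notation F := (brownian_filtration P W).

Lemma bm_meas j t : 0 <= t -> measurable_fun setT (W j t).
Proof. by case: BW => + _ _ _ _; apply. Qed.

Lemma bm_law j s t : 0 <= s -> s < t -> forall B : set R, measurable B ->
  P ((fun w => W j t w - W j s w) @^-1` B) = normal_prob 0 (Num.sqrt (t - s)) B.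
Proof. by case: BW => _ _ _ + _; apply. Qed.

Lemma filtration_sub s t : s <= t -> F s `<=` F t.
Proof.
move=> st; apply: sub_smallest2r; first exact: smallest_sigma_algebra.
move=> G [[j [r [/andP[r0 rs] h]]]|h]; last by right.
by left; exists j, r; rewrite r0 (le_trans rs st).
Qed.

Lemma filtration_measurable t G : F t G -> measurable G.
Proof.
move=> h; apply: h; split; first exact: sigma_algebra_measurable.
move=> E [[j [r [/andP[r0 _] [B mB ->]]]]|[]//].
by rewrite -[X in measurable X]setTI; exact: bm_meas.
Qed.

(** Finite-dimensional cylinder events are encoded by lists of constraints: intersection becomes
    concatenation, which makes them a pi-system. *)
Fixpoint cyl (V : 'I_n -> R -> T -> R) (L : seq ('I_n * R * set R)) : set T :=
  if L is (i, s, B) :: L' then V i s @^-1` B `&` cyl V L' else setT.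

Fixpoint cyl_times (Q : R -> Prop) (L : seq ('I_n * R * set R)) : Prop :=
  if L is (_, s, B) :: L' then [/\ Q s, measurable B & cyl_times Q L'] else True.

Lemma cyl_cat V L1 L2 : cyl V (L1 ++ L2) = cyl V L1 `&` cyl V L2.
Proof. by elim: L1 => [|[[i s] B] L1 IH]/=; rewrite ?setTI// IH setIA. Qed.

Lemma cyl_times_cat Q L1 L2 : cyl_times Q L1 -> cyl_times Q L2 ->
  cyl_times Q (L1 ++ L2).
Proof. by elim: L1 => [//|[[i s] B] L1 IH]/= [? ? ?] ?; split=> //; exact: IH. Qed.

Lemma measurable_cyl V L : (forall i s, 0 <= s -> measurable_fun setT (V i s)) ->
  cyl_times (fun s => 0 <= s) L -> measurable (cyl V L).
Proof.
move=> mV; elim: L => [_|[[i s] B] L IH /= [s0 mB hL]]; first exact: measurableT.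
apply: measurableI; last exact: IH.
by rewrite -[X in measurable X]setTI; exact: mV.
Qed.

(** Grid increments determine [W] only up to its initial value, which is 0 merely almost surely; the
    change back to [W] happens in [filtration_orth]. *)
Let W0 i s w := W i s w - W i 0 w.

Section Grid.
Variables (m : nat) (tau : nat -> R).
Hypothesis tau0 : tau 0 = 0.
Hypothesis tauS : forall k, (k <= m)%N -> tau k <= tau k.+1.

Let incr (q : 'I_n * 'I_m.+1) (w : T) : R := W q.1 (tau q.2.+1) w - W q.1 (tau q.2) w.

Let tau_ge0 k : (k <= m.+1)%N -> 0 <= tau k.
Proof.
elim: k => [_|k IH km]; first by rewrite tau0.
by apply: le_trans (tauS _) => //; exact/IH/ltnW.
Qed.

Let mincr q : measurable_fun setT (incr q).
Proof.
by apply: measurable_funB; apply: bm_meas; apply: tau_ge0 => //; exact: ltnW.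
Qed.

Let mincrV q B : measurable B -> measurable (incr q @^-1` B).
Proof. by move=> mB; rewrite -[X in measurable X]setTI; exact: mincr. Qed.

Let rect (B : 'I_n * 'I_m.+1 -> set R) : set T :=
  \bigcap_(q in [set: 'I_n * 'I_m.+1]) incr q @^-1` B q.

(** The only free slot is the last increment of coordinate [j]. The last increments of the other
    coordinates may be constrained, as mixed moments of increments require. *)
Let rects (j : 'I_n) : set (set T) :=
  [set E | exists2 B, (forall q, measurable (B q)) /\ B (j, ord_max) = setT & E = rect B].

Let Prect B : (forall q, measurable (B q)) ->
  P (rect B) = (\prod_q P (incr q @^-1` B q))%E.
Proof.
case: BW => _ _ _ _ /(_ m.+1 tau) h mB; apply: h => //; first by rewrite tau0.
Qed.

Let mrect B : (forall q, measurable (B q)) -> measurable (rect B).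
Proof.
by move=> mB; apply: fin_bigcap_measurable => // q _; exact: mincrV.
Qed.

Variables (j : 'I_n) (phi : R -> R).
Let Dj := incr (j, ord_max).
Hypothesis mphi : measurable_fun setT phi.
Hypothesis iphi : intg P (phi \o Dj).
Hypothesis Ephi : Ex P (phi \o Dj) = 0.

(** By the product rule, the centred indicator of a rectangle is orthogonal to every event of
    [phi \o Dj]. Hence [orth_ExM] is applied with exchanged roles: [phi \o Dj] is the factor and the
    centred indicator the variable. *)
Let rects_orth G : rects j G -> orth_event P (phi \o Dj) G.
Proof.
move=> [B [mB Bj] ->]; have mR := mrect mB; split => //.
pose c := Ex P \1_(rect B).
have ic : intg P (fun w => \1_(rect B) w - c).
  by apply: intgB; [exact: intg_indic|exact: intg_cst].
have i1 : intg P (fun w => (phi \o Dj) w * (\1_(rect B) w - c)).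
  under eq_fun do rewrite mulrC.
  apply: (@intgM_bounded _ _ _ _ _ _ (1 + `|c|)) => //; first exact: intg_meas ic.
  move=> w; apply: (le_trans (ler_normB _ _)); rewrite lerD2r.
  by rewrite ger0_norm// indicE lern1 leq_b1.
have : Ex P (fun w => (phi \o Dj) w * (\1_(rect B) w - c)) = 0.
  apply: orth_ExM ic _ i1; first by apply: measurableT_comp => //; exact: mincr.
  move=> B' mB'.
  have mB'' : measurable (phi @^-1` B') by rewrite -[X in measurable X]setTI; exact: mphi.
  have mG : measurable ((phi \o Dj) @^-1` B') by exact: mincrV mB''.
  split=> //.
  (* The constraint on [phi \o Dj] fills the free slot, so the intersection is again a product
     event. *)
  pose B2 q := if q == (j, ord_max) then phi @^-1` B' else B q.
  have mB2 q : measurable (B2 q) by rewrite /B2; case: ifPn.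
  have rE : (phi \o Dj) @^-1` B' `&` rect B = rect B2.
    apply/seteqP; split=> w /=.
      move=> [h1 h2] q _; rewrite /B2 /=; case: ifPn => [/eqP ->//|_].
      exact: h2.
    move=> h; split.
      by have := h (j, ord_max) I; rewrite /B2 eqxx.
    move=> q _; have := h q I; rewrite /B2 /=; case: ifPn => [/eqP ->//|_//].
    by rewrite Bj.
  have PE : P (rect B2) = (P ((phi \o Dj) @^-1` B') * P (rect B))%E.
    rewrite !Prect// (bigD1 (j, ord_max))//= [in RHS](bigD1 (j, ord_max))//=.
    rewrite Bj preimage_setT probability_setT mul1e /B2 eqxx; congr (_ * _)%E.
    by apply: eq_bigr => q /negbTE ->.
  have -> : Ex P (fun w => \1_((phi \o Dj) @^-1` B') w * (\1_(rect B) w - c)) =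
      Ex P (fun w => \1_(rect B2) w - c * \1_((phi \o Dj) @^-1` B') w).
    by apply: eq_Ex => w; rewrite -rE indicI /GRing.mul_fun mulrBr [c * _]mulrC.
  rewrite ExB; [|exact/intg_indic/mrect|exact/intgZ/intg_indic].
  rewrite ExZ; last exact: intg_indic.
  apply/eqP; rewrite subr_eq0 -eqe EFinM !Ex_indic//; last exact: mrect.
  by rewrite PE muleC.
have E w : (phi \o Dj) w * (\1_(rect B) w - c) =
    \1_(rect B) w * (phi \o Dj) w - c * (phi \o Dj) w by ring.
rewrite (eq_Ex P E) ExB; [|exact: intg_indicM|exact: intgZ].
by rewrite ExZ// Ephi mulr0 subr0.
Qed.

Let rects_setI : setI_closed (rects j).
Proof.
move=> G H [B [mB Bj] ->] [C [mC Cj] ->].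
exists (fun q => B q `&` C q).
  by split=> [q|]; [exact: measurableI|rewrite Bj Cj setTI].
by rewrite /rect bigcapI.
Qed.

Lemma grid_sigma_orth G : <<s rects j >> G -> orth_event P (phi \o Dj) G.
Proof. exact: orth_event_sigma rects_setI rects_orth _. Qed.

Let rects_incr q B : measurable B -> q != (j, ord_max) -> rects j (incr q @^-1` B).
Proof.
move=> mB qj; exists (fun q' => if q' == q then B else setT).
  by split=> [q'|]; [case: ifPn|rewrite eq_sym (negbTE qj)].
apply/seteqP; split=> w /=.
  by move=> h q' _ /=; case: ifPn => // /eqP ->.
by move=> /(_ q I) /=; rewrite eqxx.
Qed.

Lemma grid_incr_last i B : measurable B -> (i = j -> B = setT) ->
  <<s rects j >> (incr (i, ord_max) @^-1` B).
Proof.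
move=> mB ijB; have [ij|ij] := eqVneq i j.
  by rewrite (ijB ij) preimage_setT; exact: (@measurableT _ (g_sigma_algebraType (rects j))).
apply: sub_sigma_algebra; apply: rects_incr mB _.
by apply/eqP => -[ij']; rewrite ij' eqxx in ij.
Qed.

(** A telescoping sum of increments with index below m, hence without the last one. *)
Lemma grid_value i k B : (k <= m)%N -> measurable B ->
  <<s rects j >> ((fun w => W i (tau k) w - W i 0 w) @^-1` B).
Proof.
move=> km mB.
suff : measurable_fun [set: g_sigma_algebraType (rects j)]
    (fun w => W i (tau k) w - W i 0 w).
  by move=> /(_ measurableT _ mB); rewrite setTI.
elim: k km => [_|k IH km].
  by rewrite tau0; under eq_fun do rewrite subrr; exact: measurable_cst.
have E w : W i (tau k.+1) w - W i 0 w =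
    (W i (tau k) w - W i 0 w) + incr (i, inord k) w.
  by rewrite /incr/= inordK ?ltnS ?(ltnW km)//; ring.
rewrite (funext E); apply: measurable_funD; first by apply: IH; exact: ltnW.
move=> _ C mC; rewrite setTI; apply: sub_sigma_algebra; apply: rects_incr mC _.
apply/eqP => -[_ /(congr1 val)/=]; rewrite inordK ?ltnS ?(ltnW km)// => kE.
by rewrite kE ltnn in km.
Qed.

Lemma grid_cyl_orth i L B : cyl_times (fun s => exists2 k, (k <= m)%N & s = tau k) L ->
  measurable B -> (i = j -> B = setT) ->
  orth_event P (phi \o Dj) (cyl W0 L `&` incr (i, ord_max) @^-1` B).
Proof.
move=> hL mB ijB; apply: grid_sigma_orth.
apply: (@measurableI _ (g_sigma_algebraType (rects j))); last exact: grid_incr_last.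
elim: L hL => [_|[[i' s] C] L IH /= [[k km ->] mC hL]].
  exact: (@measurableT _ (g_sigma_algebraType (rects j))).
apply: (@measurableI _ (g_sigma_algebraType (rects j))); last exact: IH.
exact: grid_value.
Qed.

End Grid.

Section Increment.
Variables (u v : R).
Hypotheses (u0 : 0 <= u) (uv : u <= v).
Let D i w := W i v w - W i u w.
Variables (j : 'I_n) (phi : R -> R).
Hypothesis mphi : measurable_fun setT phi.
Hypothesis iphi : intg P (phi \o D j).
Hypothesis Ephi : Ex P (phi \o D j) = 0.

Let mD i : measurable_fun setT (D i).
Proof. by apply: measurable_funB; apply: bm_meas => //; exact: le_trans uv. Qed.

Let mDV i B : measurable B -> measurable (D i @^-1` B).
Proof. by move=> mB; rewrite -[X in measurable X]setTI; exact: mD. Qed.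

Variables (i : 'I_n) (B : set R).
Hypotheses (mB : measurable B) (ijB : i = j -> B = setT).

Let Y w := \1_(D i @^-1` B) w * phi (D j w).

Let iY : intg P Y.
Proof. by apply: intg_indicM => //; exact: mDV. Qed.

Let cyl0_orth L : cyl_times (fun s => 0 <= s <= u) L -> Ex P (fun w => \1_(cyl W0 L) w * Y w) = 0.
Proof.
move=> hL.
pose ts := [seq x.1.2 | x <- L].
have tsu s : s \in ts -> 0 <= s <= u.
  rewrite /ts; elim: L hL {ts} => [//|[[i' s'] C] L IH /= [su mC hL]].
  by rewrite inE => /predU1P[->//|]; exact: IH.
have [m [tau [tau0 tauS taum taumS tsE]]] := sorted_grid u0 uv tsu.
have hL' : cyl_times (fun s => exists2 k, (k <= m)%N & s = tau k) L.
  move: tsE; rewrite /ts; elim: L hL {tsu ts} => [//|[[i' s'] C] L IH /= [su mC hL] tsE].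
  split=> //; first by apply: tsE; rewrite mem_head.
  by apply: IH => // s sL; apply: tsE; rewrite inE sL orbT.
have DE i' : D i' = fun w => W i' (tau m.+1) w - W i' (tau m) w by rewrite taumS taum.
have [|//|_] := @grid_cyl_orth m tau tau0 tauS j phi mphi _ _ i L B hL' mB ijB.
- by rewrite /= -DE.
- by rewrite /= -DE.
rewrite /= -!DE => <-; apply: eq_Ex => w.
by rewrite indicI /GRing.mul_fun /Y /D taumS taum mulrA.
Qed.

Let filtration_pi : set (set T) := [set G | measurable G /\
  (P G = 0%E \/ exists2 L, cyl_times (fun s => 0 <= s <= u) L & G = cyl W L)].

(** [F u] is generated by a pi-system, the cylinder events with times up to u together with the null
    events, and null events are trivially orthogonal. The extra indicator of an event of [D i]
    serves products of increments of two coordinates; with [B = setT] it disappears. *)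
Lemma filtration_orth G : F u G -> orth_event P Y G.
Proof.
move=> FG.
have {}FG : <<s filtration_pi >> G.
  move: FG; apply: sub_smallest2r; first exact: smallest_sigma_algebra.
  move=> E [[i' [s [su [C mC ->]]]]|[mE E0]]; split => //.
  - rewrite -[X in measurable X]setTI; apply: bm_meas => //.
    by case/andP: su.
  - by right; exists [:: (i', s, C)] => //=; rewrite setIT.
  - by left.
apply: orth_event_sigma FG => //.
- rewrite -[RHS](@cyl0_orth [::])//=.
  by apply: eq_Ex => w; rewrite indicT mul1r.
- move=> E1 E2 [mE1 h1] [mE2 h2]; split; first exact: measurableI.
  have null_setI (A B' : set T) : measurable A -> measurable B' -> P A = 0%E ->
      P (A `&` B') = 0%E.
    move=> mA mB' A0; apply/eqP; rewrite -measure_le0 -A0.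
    by rewrite le_measure ?inE//; exact: measurableI.
  case: h1 => [h1|[L1 hL1 EL1]]; first by left; exact: null_setI.
  case: h2 => [h2|[L2 hL2 EL2]]; last first.
    by right; exists (L1 ++ L2); [exact: cyl_times_cat|rewrite cyl_cat EL1 EL2].
  by left; rewrite setIC; apply: null_setI.
- move=> E [mE [E0|[L hL EL]]]; split => //.
    rewrite -[RHS](Ex_cst P 0); apply: ae_eq_Ex => //.
      by apply: measurable_funM => //; exact: intg_meas iY.
    exists E; split=> // w /= h; apply: contrapT => wE; apply: h.
    by rewrite indicE memNset// mul0r.
  have hL0 : cyl_times (fun s => 0 <= s) L.
    by elim: L hL {EL} => [//|[[i' s] C] L IH /= [/andP[s0 _] mC hL]]; split=> //; exact: IH.
  have mW0 i' s : 0 <= s -> measurable_fun setT (W0 i' s).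
    by move=> s0; apply: measurable_funB; exact: bm_meas.
  rewrite -[RHS](cyl0_orth hL); apply: ae_eq_Ex.
  + by apply: measurable_funM => //; exact: intg_meas iY.
  + apply: measurable_funM; last exact: intg_meas iY.
    by apply: measurable_indic; exact: measurable_cyl.
  (* Where the Brownian motion starts at 0, the cylinders of [W] and of [W0] coincide. *)
  + case: BW => _ + _ _ _; apply: filterS => w w0.
    congr (_ * _); rewrite EL !indicE; congr (_%:R); congr nat_of_bool.
    apply/idP/idP; rewrite !inE; elim: L {hL EL hL0} => [//|[[i' s] C] L IH /=].
      by move=> [h /IH h2]; split=> //; rewrite /= /W0 w0 subr0.
    by move=> [h /IH h2]; split=> //; move: h; rewrite /= /W0 w0 subr0.
Qed.

End Increment.

Let gens (t : R) : set (set T) := [set E | exists j s, 0 <= s <= t /\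
  exists2 B : set R, measurable B & E = W j s @^-1` B] `|`
  [set E | measurable E /\ P E = 0%E].

(** Makes the closure properties of measurable functions available for adaptedness. *)
Lemma F_measurableP t (Y : T -> R) :
  F_measurable F t Y <-> measurable_fun [set: g_sigma_algebraType (gens t)] Y.
Proof.
split=> [h _ B mB|h B mB]; first by rewrite setTI; exact: h.
by have := h measurableT B mB; rewrite setTI.
Qed.

Lemma F_measurable_meas t Y : F_measurable F t Y -> measurable_fun setT Y.
Proof.
by move=> h _ B mB; rewrite setTI; exact: filtration_measurable (h B mB).
Qed.

Lemma F_measurable_le s t Y : s <= t -> F_measurable F s Y -> F_measurable F t Y.
Proof. by move=> st h B mB; exact: filtration_sub st _ (h B mB). Qed.

Lemma F_measurable_comp t (f : R -> R) Y : measurable_fun setT f ->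
  F_measurable F t Y -> F_measurable F t (fun w => f (Y w)).
Proof.
by move=> mf /F_measurableP h; apply/F_measurableP; exact: measurableT_comp.
Qed.

Lemma F_measurable_cst t (c : R) : F_measurable F t (fun=> c).
Proof. by apply/F_measurableP; exact: measurable_cst. Qed.

Lemma F_measurableM t X Y : F_measurable F t X -> F_measurable F t Y ->
  F_measurable F t (fun w => X w * Y w).
Proof.
by move=> /F_measurableP h /F_measurableP k; apply/F_measurableP; exact: measurable_funM.
Qed.

Lemma F_measurableD t X Y : F_measurable F t X -> F_measurable F t Y ->
  F_measurable F t (fun w => X w + Y w).
Proof.
by move=> /F_measurableP h /F_measurableP k; apply/F_measurableP; exact: measurable_funD.
Qed.

Lemma F_measurable_sum t I (r : seq I) (X : I -> T -> R) :
  (forall i, F_measurable F t (X i)) ->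
  F_measurable F t (fun w => \sum_(i <- r) X i w).
Proof.
move=> h; elim: r => [|i r IH].
  by under eq_fun do rewrite big_nil; exact: F_measurable_cst.
by under eq_fun do rewrite big_cons; exact: F_measurableD.
Qed.

Lemma F_measurable_indic t G : F t G -> F_measurable F t \1_G.
Proof.
move=> FG; apply/F_measurableP.
by apply: (@measurable_indic _ (g_sigma_algebraType (gens t))).
Qed.

Lemma F_measurable_bm j s t : 0 <= s <= t -> F_measurable F t (W j s).
Proof.
move=> st B mB; apply: sub_sigma_algebra; left.
by exists j, s; split=> //; exists B.
Qed.

Lemma F_null t N : measurable N -> P N = 0%E -> F t N.
Proof. by move=> mN N0; apply: sub_sigma_algebra; right. Qed.

Lemma bm_incr_meas j u v : 0 <= u -> u <= v ->
  measurable_fun setT (fun w => W j v w - W j u w).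
Proof.
by move=> u0 uv; apply: measurable_funB; apply: bm_meas => //; exact: le_trans uv.
Qed.

Lemma bm_incr_moments j u v : 0 <= u -> u <= v ->
  [/\ Ex P (fun w => W j v w - W j u w) = 0,
      Ex P (fun w => (W j v w - W j u w) ^+ 2) = v - u,
      sq_intg P (fun w => W j v w - W j u w),
      sq_intg P (fun w => (W j v w - W j u w) ^+ 2) &
      Ex P (fun w => (W j v w - W j u w) ^+ 4) <= 1024 * (v - u) ^+ 2].
Proof.
move=> u0; rewrite le_eqVlt => /predU1P[<-|uv].
  have E (k : nat) : (fun w => (W j u w - W j u w) ^+ k.+1) = (fun=> 0).
    by apply/funext => w; rewrite subrr expr0n.
  have E0 : (fun w => W j u w - W j u w) = (fun=> 0).
    by apply/funext => w; rewrite subrr.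
  have s0 : sq_intg P (fun=> 0).
    by apply: (@sq_intg_bounded _ _ _ _ _ 0) => // w; rewrite normr0.
  by rewrite !E E0 Ex_cst !subrr expr0n mulr0.
have mY := bm_incr_meas j u0 (ltW uv).
have s0 : Num.sqrt (v - u) != 0 by rewrite gt_eqF// sqrtr_gt0 subr_gt0.
have vu0 : 0 <= v - u by rewrite subr_ge0 ltW.
have [h1 h2 h4 h4'] := gaussian_moments s0 mY (bm_law j u0 uv).
have m2 : measurable_fun setT (fun w => (W j v w - W j u w) ^+ 2) by exact: measurable_funX.
have h2' : sq_intg P (fun w => (W j v w - W j u w) ^+ 2).
  by split=> //; under eq_fun do rewrite -exprM.
split => //.
- by rewrite h2 sqr_sqrtr.
- by split=> //; exact: sq_intg_intg.
- by rewrite (exprM _ 2 2) sqr_sqrtr in h4'.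
Qed.

Lemma F_bm_mean0 j u v xi : 0 <= u -> u <= v -> F_measurable F u xi ->
  sq_intg P xi -> Ex P (fun w => xi w * (W j v w - W j u w)) = 0.
Proof.
move=> u0 uv Fxi sxi; have [h1 _ sD _ _] := bm_incr_moments j u0 uv.
apply: orth_ExM; [exact: F_measurable_meas Fxi|exact: sq_intg_intg| |exact: sq_intgM].
move=> B mB.
have := @filtration_orth u v u0 uv j id (@measurable_id _ _ _)
  (sq_intg_intg sD) h1 j setT measurableT (fun=> erefl) _ (Fxi _ mB).
by under eq_fun do rewrite preimage_setT indicT mul1r.
Qed.

Lemma F_bm_var j u v xi (M : R) : 0 <= u -> u <= v -> F_measurable F u xi ->
  (forall w, `|xi w| <= M) ->
  Ex P (fun w => xi w * (W j v w - W j u w) ^+ 2) = (v - u) * Ex P xi.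
Proof.
move=> u0 uv Fxi xiM; have [_ h2 sD sD2 _] := bm_incr_moments j u0 uv.
have mxi := F_measurable_meas Fxi.
pose phi (x : R) := x ^+ 2 - (v - u).
have mphi : measurable_fun setT phi.
  by apply: measurable_funB => //; exact: measurable_funX.
have i2 := sq_intg_intg sD2.
have iphi : intg P (fun w => phi (W j v w - W j u w)).
  by apply: intgB => //; exact: intg_cst.
have Ephi : Ex P (fun w => phi (W j v w - W j u w)) = 0.
  by rewrite ExB//; [rewrite h2 Ex_cst subrr|exact: intg_cst].
have ixi := intg_bounded P mxi xiM.
have : Ex P (fun w => xi w * phi (W j v w - W j u w)) = 0.
  apply: orth_ExM => //; last exact: intgM_bounded xiM iphi.
  move=> B mB.
  have := @filtration_orth u v u0 uv j phi mphi iphi Ephi j setT measurableT (fun=> erefl) _ (Fxi _ mB).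
  by under eq_fun do rewrite preimage_setT indicT mul1r.
have E w : xi w * phi (W j v w - W j u w) =
    xi w * (W j v w - W j u w) ^+ 2 - (v - u) * xi w by rewrite /phi; ring.
rewrite (eq_Ex P E) ExB; [|exact: intgM_bounded xiM i2|exact: intgZ].
by rewrite ExZ// => /eqP; rewrite subr_eq0 => /eqP.
Qed.

(** The factors are split off one at a time: the increment of coordinate [i] by means of its own
    events, then [xi] by means of events of [F u]. What remains is [filtration_orth] with two
    different coordinates. *)
Lemma F_bm_cross i j u v xi (M : R) : 0 <= u -> u <= v -> i != j ->
  F_measurable F u xi -> (forall w, `|xi w| <= M) ->
  Ex P (fun w => xi w * ((W i v w - W i u w) * (W j v w - W j u w))) = 0.
Proof.
move=> u0 uv ij Fxi xiM; have [h1 _ sD _ _] := bm_incr_moments j u0 uv.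
have [_ _ sDi _ _] := bm_incr_moments i u0 uv.
have mxi := F_measurable_meas Fxi.
have iY : intg P (fun w => xi w * (W j v w - W j u w)).
  exact: intgM_bounded xiM (sq_intg_intg sD).
have mDi := bm_incr_meas i u0 uv.
have iDD := sq_intgM sDi sD.
rewrite (eq_Ex P (g := fun w => (W i v w - W i u w) * (xi w * (W j v w - W j u w)))); last first.
  by move=> w; ring.
apply: orth_ExM => //; last first.
  by under eq_fun do rewrite mulrCA; exact: intgM_bounded xiM iDD.
move=> B mB; split; first by rewrite -[X in measurable X]setTI; exact: mDi.
set G := _ @^-1` _.
have mG : measurable G by rewrite -[X in measurable X]setTI; exact: mDi.
rewrite (eq_Ex P (g := fun w => xi w * (\1_G w * (W j v w - W j u w)))); last first.
  by move=> w; ring.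
apply: orth_ExM => //.
- by apply: intg_indicM => //; exact: sq_intg_intg.
- move=> C mC.
  apply: (@filtration_orth u v u0 uv j id (@measurable_id _ _ _)
    (sq_intg_intg sD) h1 i B mB _ _ (Fxi _ mC)).
  by move=> ijE; rewrite ijE eqxx in ij.
- by apply: intgM_bounded xiM _ => //; apply: intg_indicM => //; exact: sq_intg_intg.
Qed.

End BrownianFiltration.

(** * Increments of stochastic integrals *)

Lemma lebesgue_itv_lty {R : realType} (a b : R) :
  (lebesgue_measure `[a, b]%classic < +oo)%E.
Proof. exact/compact_finite_measure/segment_compact. Qed.

Section StepIntegrals.
Context {R : realType} {d : measure_display} {T : measurableType d}.
Variable P : probability T R.
Context {n : nat} (W : 'I_n -> R -> T -> R).
Hypothesis BW : standard_brownian_motion P W.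
Local Notation F := (brownian_filtration P W).
Variable t : R.

(* A summand [xi * 1_[lo, hi)] of an elementary process.  The intervals of a list
   of terms may overlap arbitrarily, so that differences of elementary processes
   need no common refinement of their time grids. *)
Record term := Term {
  term_val : T -> R;
  term_lo : R;
  term_hi : R;
  term_lo_ge0 : 0 <= term_lo;
  term_le : term_lo <= term_hi;
  term_hi_le : term_hi <= t;
  term_adapted : F_measurable F term_lo term_val;
  term_bounded : exists M : R, forall w, `|term_val w| <= M }.

Arguments term_lo_ge0 : clear implicits.
Arguments term_le : clear implicits.
Arguments term_hi_le : clear implicits.
Arguments term_adapted : clear implicits.
Arguments term_bounded : clear implicits.

Definition term_int j (x : term) (w : T) : R :=
  term_val x w * (W j (term_hi x) w - W j (term_lo x) w).

Definition terms_int j (L : seq term) (w : T) : R := \sum_(x <- L) term_int j x w.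

Definition terms_fun (L : seq term) (r : R) (w : T) : R :=
  \sum_(x <- L) term_val x w * \1_(`[term_lo x, term_hi x[) r.

(** The length of the intersection of the two time intervals. *)
Definition overlap (x y : term) : R :=
  Num.max 0 (Num.min (term_hi x) (term_hi y) - Num.max (term_lo x) (term_lo y)).

Lemma term_val_meas x : measurable_fun setT (term_val x).
Proof. by apply: (F_measurable_meas BW (term_adapted x)). Qed.

Lemma term_int_sq j x : sq_intg P (term_int j x).
Proof.
have [M hM] := term_bounded x.
apply: sq_intgM_bounded hM _; first exact: term_val_meas.
by have [_ _ ? _ _] := bm_incr_moments BW j (term_lo_ge0 x) (term_le x).
Qed.

Lemma terms_int_sq j L : sq_intg P (terms_int j L).
Proof. by apply: sq_intg_sum => x; exact: term_int_sq. Qed.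

Let xi2 (x y : term) w := term_val x w * term_val y w.

Let xi2_bounded x y : exists M, forall w, `|xi2 x y w| <= M.
Proof.
have [M hM] := term_bounded x; have [N hN] := term_bounded y.
by exists (M * N) => w; rewrite normrM ler_pM.
Qed.

Let xi2_intg x y : intg P (xi2 x y).
Proof.
have [M hM] := xi2_bounded x y; apply: intg_bounded hM.
by apply: measurable_funM; exact: term_val_meas.
Qed.

Let term_cov_le j x y : term_lo x <= term_lo y ->
  Ex P (fun w => term_int j x w * term_int j y w) = overlap x y * Ex P (xi2 x y).
Proof.
move=> xy; set a := term_lo x; set b := term_hi x; set a' := term_lo y; set b' := term_hi y.
have a0 : 0 <= a := term_lo_ge0 x.
have a'0 : 0 <= a' := term_lo_ge0 y.
have [M hM] := xi2_bounded x y.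
have Fxi : F_measurable F a' (xi2 x y).
  apply: F_measurableM; last exact: term_adapted.
  by apply: (F_measurable_le xy); exact: term_adapted.
have mxi := F_measurable_meas BW Fxi.
have sqD p q : 0 <= p -> p <= q -> sq_intg P (fun w => xi2 x y w * (W j q w - W j p w)).
  move=> p0 pq; apply: sq_intgM_bounded hM _ => //.
  by have [_ _ ? _ _] := bm_incr_moments BW j p0 pq.
have sqD' p q : 0 <= p -> p <= q -> sq_intg P (fun w => W j q w - W j p w).
  by move=> p0 pq; have [_ _ ? _ _] := bm_incr_moments BW j p0 pq.
have FD p q r : 0 <= p -> p <= q -> q <= r -> a' <= r ->
    F_measurable F r (fun w => xi2 x y w * (W j q w - W j p w)).
  move=> p0 pq qr a'r; apply: F_measurableM; first exact: F_measurable_le Fxi.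
  apply: F_measurableD; first by apply: F_measurable_bm; rewrite qr (le_trans p0).
  apply: (@F_measurable_comp _ _ _ _ _ _ _ -%R) => //.
  by apply: F_measurable_bm; rewrite p0 (le_trans pq).
have zero p q r s : 0 <= p -> p <= q -> q <= r -> r <= s -> a' <= r ->
    Ex P (fun w => (xi2 x y w * (W j q w - W j p w)) * (W j s w - W j r w)) = 0.
  move=> p0 pq qr rs a'r; apply: (F_bm_mean0 BW) => //.
  - exact: le_trans (le_trans p0 pq) qr.
  - exact: FD.
  - exact: sqD.
have [ba'|a'b] := leP b a'.
  rewrite (eq_Ex P (g := fun w => (xi2 x y w * (W j b w - W j a w)) * (W j b' w - W j a' w))); last first.
    by move=> w; rewrite /term_int /xi2; ring.
  rewrite zero ?term_le// /overlap max_l ?mul0r//.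
  rewrite subr_le0 ge_min; apply/orP; left; rewrite le_max; apply/orP; right.
  exact: ba'.
(* From the later start a' on, both intervals run up to c, and then only one of them runs up to e.
   The product becomes a square over [a', c] plus products of increments over non-overlapping
   intervals, which have mean 0. *)
pose c := Num.min b b'; pose e := Num.max b b'.
have a'c : a' <= c by rewrite le_min (ltW a'b) term_le.
have cb : c <= b by rewrite ge_min lexx.
have ce : c <= e by rewrite ge_min le_max lexx.
have E w : term_int j x w * term_int j y w =
    (xi2 x y w * (W j a' w - W j a w)) * (W j b' w - W j a' w) +
    (xi2 x y w * (W j c w - W j a' w) ^+ 2 +
     (xi2 x y w * (W j c w - W j a' w)) * (W j e w - W j c w)).
  rewrite /c /e /term_int /xi2 -/a -/b -/a' -/b'.
  by case: (leP b b') => _; ring.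
have c0 : 0 <= c := le_trans a'0 a'c.
have i2 : intg P (fun w => xi2 x y w * (W j c w - W j a' w) ^+ 2).
  apply: intgM_bounded hM _ => //.
  by have [_ _ [_ ?] _ _] := bm_incr_moments BW j a'0 a'c.
rewrite (eq_Ex P E) ExD; last 2 first.
- by apply: sq_intgM; [exact: sqD|exact/sqD'/term_le].
- by apply: intgD => //; apply: sq_intgM; [exact: sqD|exact: sqD'].
rewrite ExD//; last by apply: sq_intgM; [exact: sqD|exact: sqD'].
rewrite !zero ?term_le// add0r addr0 (F_bm_var BW _ _ _ _ hM)//.
congr (_ * _); rewrite /overlap -/a -/b -/a' -/b' max_r//.
  by rewrite (max_r xy).
by rewrite (max_r xy) subr_ge0.
Qed.

Lemma term_cov j x y :
  Ex P (fun w => term_int j x w * term_int j y w) =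
  overlap x y * Ex P (fun w => term_val x w * term_val y w).
Proof.
have [xy|/ltW yx] := leP (term_lo x) (term_lo y); first exact: term_cov_le.
under eq_Ex do rewrite mulrC; rewrite term_cov_le//.
rewrite /overlap (minC (term_hi y)) (maxC (term_lo y)); congr (_ * _).
by apply: eq_Ex => w; rewrite /xi2 mulrC.
Qed.

Let ind (x : term) (r : R) : R := \1_(`[term_lo x, term_hi x[) r.

Let mind x : measurable_fun setT (ind x).
Proof. exact: measurable_indic. Qed.

Let overlap_integral x y :
  (\int[lebesgue_measure]_(r in `[0%R, t]) (ind x r * ind y r)%:E = (overlap x y)%:E)%E.
Proof.
transitivity (\int[lebesgue_measure]_(r in `[0%R, t])
    (\1_(`[Num.max (term_lo x) (term_lo y), Num.min (term_hi x) (term_hi y)[%classic) r)%:E)%E.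
  apply: eq_integral => r _; congr EFin; rewrite /ind /= !indicE !mem_setE !in_itv/= ge_max lt_min.
  by rewrite -natrM mulnb andbACA.
rewrite integral_indic// setIidl; last first.
  move=> r /=; rewrite !in_itv/= ge_max lt_min => /andP[/andP[xr _] /andP[rx _]].
  by rewrite (le_trans (term_lo_ge0 x) xr)/= (le_trans (ltW rx))// term_hi_le.
apply: etrans (lebesgue_measure_itv _) _; rewrite /= lte_fin /overlap.
set b := Num.min _ _; set a := Num.max (term_lo x) _.
by have [h|h] := ltP a b; [rewrite max_r// subr_ge0 ltW|rewrite max_l// subr_le0].
Qed.

Let ind_integrable x y :
  lebesgue_measure.-integrable `[0%R, t] (fun r : R => (ind x r * ind y r)%:E).
Proof.
apply: measurable_bounded_integrable => //.
- exact: lebesgue_itv_lty.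
- by apply: measurable_funTS; apply: measurable_funM; exact: mind.
- exists 1; split; first exact: num_real.
  move=> M M1 r _; apply: le_trans (ltW M1).
  rewrite /ind !indicE.
  by do 2!case: (_ \in _); rewrite ?mul1r ?mul0r ?normr1 ?normr0.
Qed.

Lemma terms_fun_meas L : measurable_fun setT (fun p : T * R => terms_fun L p.2 p.1).
Proof.
rewrite /terms_fun; apply: measurable_sum => x.
apply: measurable_funM.
  exact: (measurableT_comp (term_val_meas x)).
exact: (measurableT_comp (mind x)).
Qed.

(** After expanding both squares, each pair of terms contributes its overlap times the mean of the
    product of its values: on the left by integration in time, on the right by [term_cov]. *)
Lemma terms_isometry j L :
  (\int[P]_w \int[lebesgue_measure]_(r in `[0%R, t]) ((terms_fun L r w) ^+ 2)%:E)%E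
  = (Ex P (fun w => terms_int j L w ^+ 2))%:E.
Proof.
pose Q w := \sum_(x <- L) \sum_(y <- L) overlap x y * (term_val x w * term_val y w).
have inner w : (\int[lebesgue_measure]_(r in `[0%R, t]) ((terms_fun L r w) ^+ 2)%:E)%E = (Q w)%:E.
  under eq_integral => r _.
    rewrite /terms_fun expr2 mulr_suml.
    under eq_bigr => x _ do rewrite mulr_sumr.
    rewrite -sumEFin; under eq_bigr => x _ do rewrite -sumEFin.
    over.
  have int1 x y : lebesgue_measure.-integrable `[0%R, t] (fun r : R =>
      (term_val x w * \1_`[(term_lo x), (term_hi x)[ r *
        (term_val y w * \1_`[(term_lo y), (term_hi y)[ r))%:E).
    rewrite (_ : (fun r => _) = (fun r => (term_val x w * term_val y w)%:E * (ind x r * ind y r)%:E)%E); last first.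
      by apply/funext => r; rewrite -EFinM; congr EFin; rewrite /ind; ring.
    exact: integrableZl.
  rewrite integral_sum//; last by move=> x; exact: integrable_sum.
  rewrite /Q -sumEFin; apply: eq_bigr => x _.
  rewrite integral_sum// -sumEFin; apply: eq_bigr => y _.
  transitivity (\int[lebesgue_measure]_(r in `[0%R, t])
      ((term_val x w * term_val y w)%:E * (ind x r * ind y r)%:E))%E.
    by apply: eq_integral => r _; rewrite -EFinM; congr EFin; rewrite /ind; ring.
  rewrite integralZl//.
  by rewrite overlap_integral -EFinM mulrC.
under eq_integral do rewrite inner.
have iQ x y : intg P (fun w => overlap x y * (term_val x w * term_val y w)).
  exact/intgZ/xi2_intg.
have -> : (\int[P]_w (Q w)%:E)%E = (Ex P Q)%:E.
  rewrite /Ex /Rintegral fineK//; apply: integrable_fin_num => //.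
  by apply: intg_sum => x _; apply: intg_sum.
congr EFin; rewrite /Q Ex_sum; last by move=> x; exact: intg_sum.
transitivity (\sum_(x <- L) \sum_(y <- L) Ex P (fun w => term_int j x w * term_int j y w)).
  apply: eq_bigr => x _; rewrite Ex_sum//; apply: eq_bigr => y _.
  by rewrite ExZ ?term_cov//; exact: xi2_intg.
have iTT x y : intg P (fun w => term_int j x w * term_int j y w).
  by apply: sq_intgM; exact: term_int_sq.
under eq_bigr => x _ do rewrite -Ex_sum//.
rewrite -Ex_sum; last by move=> x; exact: intg_sum.
apply: eq_Ex => w; rewrite /terms_int expr2 mulr_suml; apply: eq_bigr => x _.
by rewrite mulr_sumr.
Qed.

End StepIntegrals.

Arguments term_lo_ge0 {R d T P n W t} _.
Arguments term_le {R d T P n W t} _.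
Arguments term_hi_le {R d T P n W t} _.
Arguments term_adapted {R d T P n W t} _.
Arguments term_bounded {R d T P n W t} _.

(** * Expectations of time integrals *)

Section IntegralInterval.
Context {d : measure_display} {T : measurableType d} {R : realType}.
Variable P : probability T R.
Variables (g : T -> R -> R) (a b : R).
Hypothesis mg : measurable_fun setT (fun p : T * R => g p.1 p.2).
Hypothesis g0 : forall w r, 0 <= g w r.

Let f (p : T * measurableTypeR R) : \bar R := (g p.1 p.2 * \1_(`[a, b]%classic) p.2)%:E.

Let mf : measurable_fun setT f.
Proof.
apply/measurable_EFinP; apply: measurable_funM; first exact: mg.
have m1 : measurable_fun setT (\1_(`[a, b]%classic) : R -> R) by exact: measurable_indic.
have := measurableT_comp m1 (@measurable_snd _ _ T R); exact.
Qed.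

Let f0 p : (0 <= f p)%E.
Proof. by rewrite lee_fin mulr_ge0. Qed.

Let fE w : (\int[lebesgue_measure]_(r in `[a, b]) (g w r)%:E =
  \int[lebesgue_measure]_r f (w, r))%E.
Proof.
rewrite integral_mkcond; apply: eq_integral => r _.
by rewrite /f patchE/= indicE; case: (r \in _); rewrite ?mulr1 ?mulr0.
Qed.

Lemma measurable_integral_itv :
  measurable_fun setT (fun w => \int[lebesgue_measure]_(r in `[a, b]) (g w r)%:E)%E.
Proof.
have -> : (fun w => \int[lebesgue_measure]_(r in `[a, b]) (g w r)%:E)%E =
    (fun w => \int[lebesgue_measure]_r f (w, r))%E by apply/funext => w; exact: fE.
exact: (measurable_fun_fubini_tonelli_F (m2 := lebesgue_measure) f).
Qed.

Lemma fubini_tonelli_itv :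
  (\int[P]_w \int[lebesgue_measure]_(r in `[a, b]) (g w r)%:E =
   \int[lebesgue_measure]_(r in `[a, b]) \int[P]_w (g w r)%:E)%E.
Proof.
under eq_integral do rewrite fE.
rewrite (@fubini_tonelli _ _ _ _ _ P lebesgue_measure f)// [RHS]integral_mkcond.
apply: eq_integral => r _; rewrite patchE /f/= indicE.
case: (r \in _); first by under eq_integral do rewrite mulr1.
by under eq_integral do rewrite mulr0; rewrite integral0.
Qed.

End IntegralInterval.

Section DoubleIntegral.
Context {d : measure_display} {T : measurableType d} {R : realType}.
Variable P : probability T R.
Local Notation mu := (@lebesgue_measure R).
Implicit Types (g h : T -> R -> R) (a b : R).

Definition joint_meas g := measurable_fun setT (fun p : T * R => g p.1 p.2).

Definition dbl a b g : \bar R :=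
  (\int[P]_w \int[mu]_(r in `[a, b]) (g w r)%:E)%E.

Lemma section_meas g w : joint_meas g -> measurable_fun setT (g w).
Proof. by move=> mg; exact: (measurableT_comp mg (measurable_pair1 w)). Qed.

Lemma section_meas_itv g w a b : joint_meas g ->
  measurable_fun `[a, b]%classic (fun r => (g w r)%:E).
Proof.
by move=> mg; apply: measurable_funTS; apply/measurable_EFinP; exact: section_meas.
Qed.

Lemma itv_integral_ge0 g a b w : (forall w r, 0 <= g w r) ->
  (0 <= \int[mu]_(r in `[a, b]) (g w r)%:E)%E.
Proof. by move=> gg; apply: integral_ge0 => r _; rewrite lee_fin. Qed.

Lemma dblD a b g h : joint_meas g -> joint_meas h ->
  (forall w r, 0 <= g w r) -> (forall w r, 0 <= h w r) ->
  dbl a b (fun w r => g w r + h w r) = (dbl a b g + dbl a b h)%E.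
Proof.
move=> mg mh g0 h0; rewrite /dbl -ge0_integralD//; last 4 first.
- by move=> w _; exact: itv_integral_ge0.
- exact: measurable_integral_itv.
- by move=> w _; exact: itv_integral_ge0.
- exact: measurable_integral_itv.
apply: eq_integral => w _; rewrite -ge0_integralD//.
- by move=> r _; rewrite lee_fin.
- exact: section_meas_itv.
- by move=> r _; rewrite lee_fin.
- exact: section_meas_itv.
Qed.

Lemma dblZ (c : R) a b g : 0 <= c -> joint_meas g -> (forall w r, 0 <= g w r) ->
  dbl a b (fun w r => c * g w r) = (c%:E * dbl a b g)%E.
Proof.
move=> c0 mg g0; rewrite /dbl -ge0_integralZl//; last 2 first.
- exact: measurable_integral_itv.
- by move=> w _; exact: itv_integral_ge0.
apply: eq_integral => w _; rewrite -ge0_integralZl//.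
- exact: section_meas_itv.
- by move=> r _; rewrite lee_fin.
Qed.

Lemma le_dbl a b g h : joint_meas g -> joint_meas h ->
  (forall w r, 0 <= g w r) ->
  (forall w r, a <= r <= b -> g w r <= h w r) -> (dbl a b g <= dbl a b h)%E.
Proof.
move=> mg mh g0 gh; have hh w r : a <= r <= b -> 0 <= h w r.
  by move=> rab; exact: le_trans (gh _ _ rab).
have mI k : joint_meas k -> (forall w r, a <= r <= b -> 0 <= k w r) ->
    measurable_fun setT (fun w => \int[mu]_(r in `[a, b]) (k w r)%:E)%E.
  (* [k] is known to be nonnegative on [a, b] only; its absolute value has the same integral over
     [a, b] and is nonnegative everywhere. *)
  move=> mk k0; have := @measurable_integral_itv _ _ _ (fun w r => `|k w r|) a b.
  rewrite (_ : (fun w => _) = (fun w => \int[mu]_(r in `[a, b]) (k w r)%:E)%E).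
    by apply=> //; exact: measurableT_comp.
  apply/funext => w; apply: eq_integral => r.
  by rewrite inE/= in_itv/= => rab; rewrite ger0_norm ?k0.
apply: ge0_le_integral => //.
- by move=> w _; exact: itv_integral_ge0.
- by apply: mI.
- exact: mI.
- move=> w _; apply: ge0_le_integral => //.
  + by move=> r _; rewrite lee_fin.
  + exact: section_meas_itv.
  + exact: section_meas_itv.
  + by move=> r; rewrite /= in_itv/= lee_fin; exact: gh.
Qed.

Lemma joint_meas_indic (A : set R) : measurable A -> joint_meas (fun=> \1_A).
Proof.
by move=> mA; exact: (measurableT_comp (measurable_indic mA) measurable_snd).
Qed.

Lemma dbl_indic a b a' b' g : a <= a' -> b' <= b ->
  dbl a b (fun w r => \1_(`[a', b']%classic) r * g w r) = dbl a' b' g.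
Proof.
move=> aa bb; apply: eq_integral => w _.
rewrite [LHS]integral_mkcond [RHS]integral_mkcond; apply: eq_integral => r _.
rewrite !patchE indicE !mem_setE !in_itv/=.
case: (leP a' r) => ar /=; last by rewrite mul0r if_same.
rewrite (le_trans aa ar)/=; case: (leP r b') => rb; last by rewrite mul0r if_same.
by rewrite (le_trans rb bb) mul1r.
Qed.

End DoubleIntegral.

Lemma le_cvg0_ereal {R : realType} (x y : \bar R) (u : nat -> \bar R) :
  u @ \oo --> 0%E -> (forall k, (x <= u k + y)%E) -> (x <= y)%E.
Proof.
move=> u0 xuy; apply/lee_addgt0Pr => e e0.
have : \forall k \near \oo, (u k < e%:E)%E.
  have h : nbhs (0%E : \bar R) [set z | (z < e%:E)%E].
    by apply: open_nbhs_nbhs; split; [exact: open_ereal_lt_ereal|rewrite /= lte_fin].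
  exact: u0 _ h.
move=> [N _ /(_ N (leqnn _))] h; apply: (le_trans (xuy N)).
by rewrite addeC leeD2l// ltW.
Qed.

Lemma ge0_muleD3 {R : realDomainType} (x a b c : \bar R) :
  (0 <= a)%E -> (0 <= b)%E -> (0 <= c)%E ->
  (x * (a + b + c) = x * a + x * b + x * c)%E.
Proof. by move=> a0 b0 c0; rewrite ge0_muleDr ?adde_ge0// ge0_muleDr. Qed.

Lemma sqr_Ex_le {d : measure_display} {T : measurableType d} {R : realType}
    (P : probability T R) (f : T -> R) :
  sq_intg P f -> (Ex P f) ^+ 2 <= Ex P (fun w => f w ^+ 2).
Proof.
move=> sf; have fi := sq_intg_intg sf; have [_ f2i] := sf.
pose m := Ex P f; have : 0 <= Ex P (fun w => (f w - m) ^+ 2).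
  by apply: Ex_ge0 => w; exact: sqr_ge0.
have E w : (f w - m) ^+ 2 = f w ^+ 2 - (2 * m) * f w + m ^+ 2 by ring.
rewrite (eq_Ex P E) ExD; [|by apply: intgB => //; exact: intgZ|exact: intg_cst].
by rewrite ExB//; [rewrite ExZ// Ex_cst -/m; lra|exact: intgZ].
Qed.

Section ItoIncrement.
Context {R : realType} {d : measure_display} {T : measurableType d}.
Variable P : probability T R.
Context {n : nat} (W : 'I_n -> R -> T -> R).
Hypothesis BW : standard_brownian_motion P W.
Local Notation F := (brownian_filtration P W).
Variables (s t : R).
Hypotheses (s0 : 0 <= s) (st : s <= t).
Local Notation term := (term P W t).

Let t0 : 0 <= t. Proof. exact: le_trans st. Qed.

Let F_measurableN u (X : T -> R) : F_measurable F u X -> F_measurable F u (fun w => - X w).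
Proof. by apply: (F_measurable_comp (f := -%R)). Qed.

Let opp_bounded (x : term) : exists M : R, forall w, `|- term_val x w| <= M.
Proof. by have [M hM] := term_bounded x; exists M => w; rewrite normrN. Qed.

Definition term_opp (x : term) : term :=
  Term (term_lo_ge0 x) (term_le x) (term_hi_le x)
    (F_measurableN (term_adapted x)) (opp_bounded x).

(** A term starting at s or later shrinks to the interval [s, s]. Its value need not be measurable
    for [F s] and is therefore replaced by 0. *)
Definition clip_val (x : term) (w : T) : R := if term_lo x < s then term_val x w else 0.

Let clip_lo_ge0 (x : term) : 0 <= Num.min (term_lo x) s.
Proof. by rewrite le_min term_lo_ge0. Qed.

Let clip_le (x : term) : Num.min (term_lo x) s <= Num.min (term_hi x) s.
Proof. by rewrite le_min !ge_min lexx term_le !orbT. Qed.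

Let clip_hi_le (x : term) : Num.min (term_hi x) s <= t.
Proof. by rewrite ge_min st orbT. Qed.

Let clip_adapted (x : term) : F_measurable F (Num.min (term_lo x) s) (clip_val x).
Proof.
rewrite /clip_val; have [h|h] := ltP (term_lo x) s; last exact: F_measurable_cst.
exact: term_adapted.
Qed.

Let clip_bounded (x : term) : exists M : R, forall w, `|clip_val x w| <= M.
Proof.
have [M hM] := term_bounded x; exists `|M| => w; rewrite /clip_val.
by case: ifP => _; rewrite ?normr0//; exact: le_trans (hM w) (ler_norm _).
Qed.

Definition term_clip (x : term) : term :=
  Term (clip_lo_ge0 x) (clip_le x) (clip_hi_le x) (@clip_adapted x) (clip_bounded x).

Lemma terms_int_cat j (L1 L2 : seq term) w :
  terms_int j (L1 ++ L2) w = terms_int j L1 w + terms_int j L2 w.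
Proof. by rewrite /terms_int big_cat. Qed.

Lemma terms_fun_cat (L1 L2 : seq term) r w :
  terms_fun (L1 ++ L2) r w = terms_fun L1 r w + terms_fun L2 r w.
Proof. by rewrite /terms_fun big_cat. Qed.

Lemma terms_int_opp j (L : seq term) w :
  terms_int j (map term_opp L) w = - terms_int j L w.
Proof.
rewrite /terms_int big_map -sumrN; apply: eq_bigr => x _.
by rewrite /term_int /= mulNr.
Qed.

Lemma terms_fun_opp (L : seq term) r w :
  terms_fun (map term_opp L) r w = - terms_fun L r w.
Proof.
rewrite /terms_fun big_map -sumrN; apply: eq_bigr => x _.
by rewrite /= mulNr.
Qed.

Lemma terms_fun_clip (L : seq term) r w :
  terms_fun (map term_clip L) r w = if r < s then terms_fun L r w else 0.
Proof.
rewrite /terms_fun big_map; case: ifPn => rs; last first.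
  apply: big1 => x _; rewrite indicE mem_setE in_itv/= lt_min (negbTE rs) andbF andbF.
  by rewrite mulr0.
apply: eq_bigr => x _; rewrite /= /clip_val !indicE !mem_setE !in_itv/= lt_min rs andbT ge_min.
have [h|h] := ltP (term_lo x) s; first by rewrite (leNgt s r) rs orbF.
by rewrite (leNgt (term_lo x)) (lt_le_trans rs h)/= mulr0 mul0r.
Qed.

(* Clipping all intervals at time [s] discards only increments after [s], which
   are orthogonal to [F s]. *)
Lemma Ex_terms_clip j (L : seq term) (zeta : T -> R) (M : R) :
  F_measurable F s zeta -> (forall w, `|zeta w| <= M) ->
  Ex P (fun w => zeta w * terms_int j L w) =
  Ex P (fun w => zeta w * terms_int j (map term_clip L) w).
Proof.
move=> Fz zM; have mz := F_measurable_meas BW Fz.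
have iz (x : term) : intg P (fun w => zeta w * term_int j x w).
  by apply: intgM_bounded zM _ => //; apply: sq_intg_intg; exact: term_int_sq.
rewrite (eq_Ex P (g := fun w => \sum_(x <- L) zeta w * term_int j x w)); last first.
  by move=> w; rewrite mulr_sumr.
rewrite [RHS](eq_Ex P (g := fun w => \sum_(x <- L) zeta w * term_int j (term_clip x) w)); last first.
  by move=> w; rewrite /terms_int big_map mulr_sumr.
rewrite !Ex_sum//; apply: eq_bigr => x _.
have [N hN] := term_bounded x.
have Fzx u : s <= u -> term_lo x <= u -> F_measurable F u (fun w => zeta w * term_val x w).
  move=> su xu; apply: F_measurableM; first exact: F_measurable_le Fz.
  exact: F_measurable_le (term_adapted x).
have zero u : s <= u -> term_lo x <= u -> u <= term_hi x ->
    Ex P (fun w => (zeta w * term_val x w) * (W j (term_hi x) w - W j u w)) = 0.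
  move=> su xu ux; apply: (F_bm_mean0 BW) => //; [exact: le_trans su|exact: Fzx|].
  apply: (@sq_intg_bounded _ _ _ _ _ (M * N)).
    by apply: (F_measurable_meas BW (t := u)); exact: Fzx.
  by move=> w; rewrite normrM ler_pM.
have [h|h] := ltP (term_lo x) s; last first.
  transitivity (0 : R).
    rewrite -[RHS](zero (term_lo x))//; last exact: term_le.
    by apply: eq_Ex => w; rewrite /term_int mulrA.
  rewrite -(Ex_cst P 0); apply: eq_Ex => w.
  by rewrite /term_int /= /clip_val ltNge h mul0r mulr0.
have [h2|h2] := leP (term_hi x) s.
  by apply: eq_Ex => w; rewrite /term_int/= /clip_val h (min_l h2) (min_l (ltW h)).
apply/eqP; rewrite -subr_eq0 -ExB//; apply/eqP.
rewrite -[RHS](zero s)//; [|exact: ltW|exact: ltW].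
apply: eq_Ex => w; rewrite /term_int/= /clip_val h (min_r (ltW h2)) (min_l (ltW h)).
by ring.
Qed.

Lemma step_time_bounds u phi : elementary F u phi ->
  forall k, (k <= step_size phi)%N -> 0 <= step_time phi k <= u.
Proof.
move=> [t00 tu tS _ _].
have h k l : (k + l <= step_size phi)%N -> step_time phi k <= step_time phi (k + l).
  elim: l => [_|l IH kl]; first by rewrite addn0.
  rewrite addnS; apply: le_trans (tS _ _); last by rewrite -addnS.
  by apply: IH; apply: leq_trans kl; rewrite leq_add2l.
move=> k ks; rewrite -{1}t00 -tu.
have /(_ ks) -> := h 0%N k.
by have := h k (step_size phi - k)%N; rewrite subnKC//; apply.
Qed.

(** The bound [u <= t] lets elementary processes with the two horizons s and t become lists of the
    same type, which can be subtracted. *)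
Lemma step_terms u phi : u <= t -> elementary F u phi ->
  exists L : seq term, forall w,
    (forall j, terms_int j L w = step_integral phi (W j) w) /\
    (forall r, terms_fun L r w = step_fun phi r w).
Proof.
move=> ut phiE; have bnd := step_time_bounds phiE.
case: phiE => t00 tu tS tF [M hM].
have b1 (k : 'I_(step_size phi)) : 0 <= step_time phi k.
  by have /andP[] := bnd k (ltnW (ltn_ord k)).
have b2 (k : 'I_(step_size phi)) : step_time phi k.+1 <= t.
  by have /andP[_ h] := bnd k.+1 (ltn_ord k); exact: le_trans ut.
pose mk (k : 'I_(step_size phi)) : term :=
  Term (b1 k) (tS k (ltn_ord k)) (b2 k) (tF k (ltn_ord k))
    (ex_intro _ M (fun w => hM k w (ltn_ord k))).
exists [seq mk k | k <- index_enum _] => w; split => [j|r].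
  by rewrite /terms_int big_map /step_integral; apply: eq_bigr.
by rewrite /terms_fun big_map /step_fun; apply: eq_bigr.
Qed.

Lemma step_fun_ge u phi r w : elementary F u phi -> u <= r -> step_fun phi r w = 0.
Proof.
move=> phiE ur; rewrite /step_fun; apply: big1 => k _.
have /andP[_ h] := step_time_bounds phiE (ltn_ord k).
by rewrite indicE mem_setE in_itv/= (ltNge r) (le_trans h ur) andbF mulr0.
Qed.

Variables (j : 'I_n) (H : R -> T -> R).
Hypothesis mH : measurable_fun setT (fun p : T * R => H p.2 p.1).

Let dist2 (phi : R -> T -> R) w r := (H r w - phi r w) ^+ 2.

Let dist2_ge0 phi w r : 0 <= dist2 phi w r. Proof. exact: sqr_ge0. Qed.

Let mdist2 phi : joint_meas (fun w r => phi r w) -> joint_meas (dist2 phi).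
Proof. by move=> mphi; apply: measurable_funX; apply: measurable_funB. Qed.

(** The isometry followed by a pointwise comparison. [K] is the part of the integrand that does not
    become small in the limit: (H - c)^2 for the second moment of the increment, and 0 for its
    mean. *)
Let terms_bound (L : seq term) (phi psi : R -> T -> R) (K : T -> R -> R) :
  joint_meas (fun w r => phi r w) -> joint_meas (fun w r => psi r w) ->
  joint_meas K -> (forall w r, 0 <= K w r) ->
  (forall w r, 0 <= r <= t -> terms_fun L r w ^+ 2 <=
    2 * (dist2 phi w r + \1_(`[0, s]%classic) r * dist2 psi w r
         + \1_(`[s, t]%classic) r * K w r)) ->
  ((Ex P (fun w => terms_int j L w ^+ 2))%:E <=
    2%:E * (dbl P 0 t (dist2 phi) + dbl P 0 s (dist2 psi) + dbl P s t K))%E.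
Proof.
move=> mphi mpsi mK K0 LE; rewrite -terms_isometry//.
pose g2 w r := \1_(`[0, s]%classic) r * dist2 psi w r.
pose g3 w r := \1_(`[s, t]%classic) r * K w r.
have g20 w r : 0 <= g2 w r by rewrite mulr_ge0.
have g30 w r : 0 <= g3 w r by rewrite mulr_ge0.
have mg2 : joint_meas g2.
  by apply: measurable_funM; [exact: joint_meas_indic|exact: mdist2].
have mg3 : joint_meas g3.
  by apply: measurable_funM => //; exact: joint_meas_indic.
have mg12 : joint_meas (fun w r => dist2 phi w r + g2 w r).
  by apply: measurable_funD => //; exact: mdist2.
have g120 w r : 0 <= dist2 phi w r + g2 w r by rewrite addr_ge0.
rewrite -(dbl_indic P (dist2 psi) (lexx 0) st) -(dbl_indic P K s0 (lexx t)).
rewrite -dblD//; last exact: mdist2.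
rewrite -dblD// -dblZ//; last 2 first.
- exact: measurable_funD mg12 mg3.
- by move=> w r; exact: (addr_ge0 (g120 w r) (g30 w r)).
apply: le_dbl => //.
- by apply: measurable_funX; exact: terms_fun_meas.
- by apply: measurable_funM => //; exact: measurable_funD mg12 mg3.
- by move=> w r; exact: sqr_ge0.
Qed.

Variables (It Is c : T -> R).
Hypotheses (ItP : is_ito_integral P F (W j) H t It)
  (IsP : is_ito_integral P F (W j) H s Is).
Hypotheses (Fc : F_measurable F s c) (c_bounded : exists M : R, forall w, `|c w| <= M).

(** The stochastic integral of [H - c] over [s, t], that is, the error made by freezing the
    integrand at [c]; [V] is the squared L^2 norm of [H - c]. *)
Let A w := It w - Is w - c w * (W j t w - W j s w).
Let V := dbl P s t (fun w r => (H r w - c w) ^+ 2).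

Let mA : measurable_fun setT A.
Proof.
have [mIt _] := ItP; have [mIs _] := IsP.
apply: measurable_funB; first exact: measurable_funB.
by apply: measurable_funM; [exact: (F_measurable_meas BW Fc)|exact: (bm_incr_meas BW j s0 st)].
Qed.

Let approx_seq : exists (phi psi : nat -> step_process) (L : nat -> seq term),
  [/\ (forall k, elementary F t (phi k)), (forall k, elementary F s (psi k)),
    (forall k w r, terms_fun (L k) r w =
      step_fun (phi k) r w - step_fun (psi k) r w - c w * \1_(`[s, t[%classic) r),
    (forall k w, terms_int j (L k) w = step_integral (phi k) (W j) w -
      step_integral (psi k) (W j) w - c w * (W j t w - W j s w)) &
    [/\ (fun k => dbl P 0 t (dist2 (step_fun (phi k)))) @ \oo --> 0%E,
        (fun k => dbl P 0 s (dist2 (step_fun (psi k)))) @ \oo --> 0%E,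
        (fun k => \int[P]_w ((It w - step_integral (phi k) (W j) w) ^+ 2)%:E)%E @ \oo --> 0%E &
        (fun k => \int[P]_w ((Is w - step_integral (psi k) (W j) w) ^+ 2)%:E)%E @ \oo --> 0%E]].
Proof.
have [_ [phi [phiE phiH phiI]]] := ItP; have [_ [psi [psiE psiH psiI]]] := IsP.
have [L1 L1E] := choice (fun k => step_terms (lexx t) (phiE k)).
have [L2 L2E] := choice (fun k => step_terms st (psiE k)).
pose cterm : term := Term s0 st (lexx t) Fc c_bounded.
exists phi, psi, (fun k => L1 k ++ map term_opp (cterm :: L2 k)).
split; [exact: phiE|exact: psiE| | |by split; [exact: phiH|exact: psiH|exact: phiI|exact: psiI]].
- move=> k w r; rewrite terms_fun_cat terms_fun_opp (L1E k w).2.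
  by rewrite /terms_fun big_cons -/(terms_fun (L2 k) r w) (L2E k w).2 /=; ring.
- move=> k w; rewrite terms_int_cat terms_int_opp (L1E k w).1.
  by rewrite /terms_int big_cons -/(terms_int j (L2 k) w) (L2E k w).1 /term_int/=; ring.
Qed.

Let step_meas u phi : u <= t -> elementary F u phi ->
  joint_meas (fun w r => step_fun phi r w) /\
  measurable_fun setT (step_integral phi (W j)).
Proof.
move=> ut phiE; have [L LE] := step_terms ut phiE; split.
  rewrite /joint_meas (_ : (fun p => _) = (fun p => terms_fun L p.2 p.1)).
    exact: terms_fun_meas.
  by apply/funext => p; rewrite (LE p.1).2.
rewrite (_ : step_integral _ _ = terms_int j L); first by have [] := terms_int_sq BW j L.
by apply/funext => w; rewrite (LE w).1.
Qed.

(** A single vanishing error that serves both the second moment and the mean of [A]. *)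
Let err (phi psi : nat -> step_process) k : \bar R :=
  (4%:E * \int[P]_w ((It w - step_integral (phi k) (W j) w) ^+ 2)%:E +
   4%:E * \int[P]_w ((Is w - step_integral (psi k) (W j) w) ^+ 2)%:E +
   (4%:E * dbl P 0 t (dist2 (step_fun (phi k))) +
    4%:E * dbl P 0 s (dist2 (step_fun (psi k)))))%E.

Let err_cvg phi psi :
  (fun k => dbl P 0 t (dist2 (step_fun (phi k)))) @ \oo --> 0%E ->
  (fun k => dbl P 0 s (dist2 (step_fun (psi k)))) @ \oo --> 0%E ->
  (fun k => \int[P]_w ((It w - step_integral (phi k) (W j) w) ^+ 2)%:E)%E @ \oo --> 0%E ->
  (fun k => \int[P]_w ((Is w - step_integral (psi k) (W j) w) ^+ 2)%:E)%E @ \oo --> 0%E ->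
  err phi psi @ \oo --> 0%E.
Proof.
move=> h1 h2 h3 h4.
have Z (u : nat -> \bar R) : u @ \oo --> 0%E -> (fun k => 4%:E * u k)%E @ \oo --> 0%E.
  by move=> /(cvgeZl (y := 4%:E) isT); rewrite mule0.
rewrite -[0%E]adde0; apply: cvgeD; first by [].
  by rewrite -[0%E]adde0; apply: cvgeD; [by []|exact: Z h3|exact: Z h4].
by rewrite -[0%E]adde0; apply: cvgeD; [by []|exact: Z h1|exact: Z h2].
Qed.

Let dbl_ge0 a b (g : T -> R -> R) : (forall w r, 0 <= g w r) -> (0 <= dbl P a b g)%E.
Proof. by move=> g0; apply: integral_ge0 => w _; exact: itv_integral_ge0. Qed.

Let le_int3 (f g1 g2 g3 : T -> R) : measurable_fun setT f ->
  measurable_fun setT g1 -> measurable_fun setT g2 -> measurable_fun setT g3 ->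
  (forall w, f w ^+ 2 <= 4 * g1 w ^+ 2 + 4 * g2 w ^+ 2 + 2 * g3 w ^+ 2) ->
  (\int[P]_w ((f w) ^+ 2)%:E <= 4%:E * \int[P]_w ((g1 w) ^+ 2)%:E +
   4%:E * \int[P]_w ((g2 w) ^+ 2)%:E + 2%:E * \int[P]_w ((g3 w) ^+ 2)%:E)%E.
Proof.
move=> mf m1 m2 m3 h.
have msq (g : T -> R) : measurable_fun setT g -> measurable_fun setT (fun w => ((g w) ^+ 2)%:E).
  by move=> mg; apply/measurable_EFinP; exact: measurable_funX.
have mZ (a : R) (g : T -> R) : measurable_fun setT g -> measurable_fun setT (fun w => (a%:E * ((g w) ^+ 2)%:E)%E).
  by move=> mg; apply: emeasurable_funM => //; exact: msq.
have Z (a : R) (g : T -> R) : 0 <= a -> measurable_fun setT g ->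
    (a%:E * \int[P]_w ((g w) ^+ 2)%:E = \int[P]_w (a%:E * ((g w) ^+ 2)%:E))%E.
  move=> a0 mg; rewrite ge0_integralZl//; first exact: msq.
  by move=> w _; rewrite lee_fin sqr_ge0.
have ge0 (a : R) (g : T -> R) w : 0 <= a -> (0 <= a%:E * ((g w) ^+ 2)%:E)%E.
  by move=> a0; rewrite mule_ge0// lee_fin sqr_ge0.
rewrite !Z// -ge0_integralD//; last 4 first.
- by move=> w _; exact: ge0.
- exact: mZ.
- by move=> w _; exact: ge0.
- exact: mZ.
rewrite -ge0_integralD//; last 4 first.
- by move=> w _; rewrite adde_ge0// ge0.
- by apply: emeasurable_funD; exact: mZ.
- by move=> w _; exact: ge0.
- exact: mZ.
apply: ge0_le_integral => //.
- by move=> w _; rewrite lee_fin sqr_ge0.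
- exact: msq.
- by apply: emeasurable_funD; [apply: emeasurable_funD|]; exact: mZ.
- by move=> w _; rewrite -!EFinM -!EFinD lee_fin.
Qed.

(** The sharp constant is 1. Applying (a + b)^2 <= 2 a^2 + 2 b^2 twice costs the factor 4, but
    leaves only approximation errors that vanish by the definition of the integral. *)
Lemma ito_increment_sq : (\int[P]_w ((A w) ^+ 2)%:E <= 4%:E * V)%E.
Proof.
have [phi [psi [L [phiE psiE LF LI [h1 h2 h3 h4]]]]] := approx_seq.
apply: le_cvg0_ereal (err_cvg h1 h2 h3 h4) _ => k.
have [mphi mSphi] := step_meas (lexx t) (phiE k).
have [mpsi mSpsi] := step_meas st (psiE k).
have [mIt _] := ItP; have [mIs _] := IsP.
have [M hM] := c_bounded.
have mK : joint_meas (fun w r => (H r w - c w) ^+ 2).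
  apply: measurable_funX; apply: measurable_funB => //.
  exact: (measurableT_comp (F_measurable_meas BW Fc)).
have := @terms_bound (L k) (step_fun (phi k)) (step_fun (psi k))
  (fun w r => (H r w - c w) ^+ 2) mphi mpsi mK (fun _ _ => sqr_ge0 _).
have H1 : forall w r, 0 <= r <= t -> terms_fun (L k) r w ^+ 2 <=
    2 * (dist2 (step_fun (phi k)) w r + \1_(`[0, s]%classic) r * dist2 (step_fun (psi k)) w r
      + \1_(`[s, t]%classic) r * (H r w - c w) ^+ 2).
  move=> w r /andP[r0 rt]; rewrite LF !indicE !mem_setE !in_itv/= r0 rt andbT /=.
  rewrite /dist2; move: (step_fun (phi k) r w) (@step_fun_ge t (phi k) r w (phiE k))
    (step_fun (psi k) r w) (@step_fun_ge s (psi k) r w (psiE k)) => p pt q qs.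
  move: (H r w) => h; have [rs|sr] := ltP r s.
    rewrite (ltW rs) /= mul0r mulr0 mul1r addr0 subr0.
    by have := sqr_ge0 (h - p + (h - q)); lra.
  rewrite (qs sr) subr0 /= mul1r.
  have x1 : 0 <= ((r <= s)%R%:R : R) * (h - 0) ^+ 2 by rewrite mulr_ge0// sqr_ge0.
  have x2 := sqr_ge0 (h - c w); have x3 := sqr_ge0 (h - p).
  have [rt'|tr] := ltP r t.
    rewrite mulr1; have x4 := sqr_ge0 (h - p + (h - c w)).
    by rewrite [leRHS]mulrDr [X in _ <= X + _]mulrDr; move: x1; set z := _ * _; lra.
  (* At r = t all half-open intervals have ended, so the left side is 0. *)
  rewrite mulr0 subr0 (pt tr) expr0n /=; rewrite (pt tr) in x3.
  by rewrite mulr_ge0// !addr_ge0.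
move=> /(_ H1) => H2.
have sqL := terms_int_sq BW j (L k).
have EL : (\int[P]_w ((terms_int j (L k) w) ^+ 2)%:E = (Ex P (fun w => terms_int j (L k) w ^+ 2))%:E)%E.
  by rewrite /Ex /Rintegral fineK//; apply: integrable_fin_num => //; case: sqL.
have mX : measurable_fun setT (fun w => It w - step_integral (phi k) (W j) w).
  exact: measurable_funB.
have mY : measurable_fun setT (fun w => Is w - step_integral (psi k) (W j) w).
  exact: measurable_funB.
apply: (@le_trans _ _ (4%:E * \int[P]_w ((It w - step_integral (phi k) (W j) w) ^+ 2)%:E +
   4%:E * \int[P]_w ((Is w - step_integral (psi k) (W j) w) ^+ 2)%:E +
   2%:E * \int[P]_w ((terms_int j (L k) w) ^+ 2)%:E)%E).
  apply: le_int3 => //; first by case: sqL.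
  move=> w; rewrite /A LI; set p := step_integral (phi k) _ w; set q := step_integral (psi k) _ w.
  set e := c w * _.
  have y1 := sqr_ge0 (It w - p + (Is w - q)).
  have y2 := sqr_ge0 ((It w - p) - (Is w - q) - (p - q - e)).
  by nra.
rewrite EL /err -[X in (_ <= X)%E]addeA leeD2l//.
apply: (@le_trans _ _ (2%:E * (2%:E *
  (dbl P 0 t (dist2 (step_fun (phi k))) + dbl P 0 s (dist2 (step_fun (psi k))) + V)))%E).
  by rewrite lee_wpmul2l// lee_fin.
rewrite muleA -EFinM (_ : 2 * 2 = 4 :> R); last by ring.
have V0 : (0 <= V)%E by apply: dbl_ge0 => w r; exact: sqr_ge0.
have d1 := dbl_ge0 0 t (dist2_ge0 (step_fun (phi k))).
have d2 := dbl_ge0 0 s (dist2_ge0 (step_fun (psi k))).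
by rewrite (ge0_muleD3 _ d1 d2 V0).
Qed.

Hypothesis V_fin : (V < +oo)%E.

Lemma ito_increment_sq_intg : sq_intg P A.
Proof.
split=> //; apply/integrableP; split; first exact/measurable_EFinP/measurable_funX.
under eq_integral => w _ do rewrite /= ger0_norm ?sqr_ge0//.
apply: (le_lt_trans ito_increment_sq); rewrite lte_mul_pinfty//.
Qed.

(** With L the approximating list of terms, E[zeta A] is the mean of zeta (A - L) plus that of zeta
    L, and in the latter L may be clipped at s. Clipped, it integrates phi - psi over [0, s), where
    both approximate H. So both parts are small in L^2. *)
Lemma ito_increment_mean0 (zeta : T -> R) : F_measurable F s zeta ->
  (exists M : R, forall w, `|zeta w| <= M) -> Ex P (fun w => zeta w * A w) = 0.
Proof.
move=> Fz [M zM]; have mz := F_measurable_meas BW Fz.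
have [phi [psi [L [phiE psiE LF LI [h1 h2 h3 h4]]]]] := approx_seq.
(* The square is compared with [err] because the L^2 bounds are stated for squares; 2 comes from
   splitting into two parts and [M ^+ 2] from the weight. *)
apply/eqP; rewrite -sqrf_eq0 eq_le sqr_ge0 andbT -lee_fin.
have {}h : (fun k => (2 * M ^+ 2)%:E * err phi psi k)%E @ \oo --> 0%E.
  by have := cvgeZl (y := (2 * M ^+ 2)%:E) isT (err_cvg h1 h2 h3 h4); rewrite mule0.
apply: le_cvg0_ereal h _ => k; rewrite adde0.
have [mphi mSphi] := step_meas (lexx t) (phiE k).
have [mpsi mSpsi] := step_meas st (psiE k).
have [mIt _] := ItP; have [mIs _] := IsP.
have sqA := ito_increment_sq_intg.
have sqL := terms_int_sq BW j (L k).
have sqC := terms_int_sq BW j (map term_clip (L k)).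
have sqD : sq_intg P (fun w => A w - terms_int j (L k) w) by exact: sq_intgB.
have zg g : sq_intg P g -> (Ex P (fun w => zeta w * g w)) ^+ 2 <= M ^+ 2 * Ex P (fun w => g w ^+ 2).
  move=> sg; have szg := sq_intgM_bounded mz zM sg.
  apply: (le_trans (sqr_Ex_le szg)); rewrite -ExZ; last by case: sg.
  apply: le_Ex; [by case: szg|by apply: intgZ; case: sg|move=> w].
  rewrite exprMn ler_wpM2r ?sqr_ge0// -real_normK ?num_real// lerXn2r ?nnegrE//.
  exact: le_trans (zM w).
have EI (g : T -> R) : sq_intg P g -> (\int[P]_w ((g w) ^+ 2)%:E = (Ex P (fun w => g w ^+ 2))%:E)%E.
  by move=> [_ ig]; rewrite /Ex /Rintegral fineK//; apply: integrable_fin_num.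
have b1 : ((Ex P (fun w => (A w - terms_int j (L k) w) ^+ 2))%:E <=
    4%:E * \int[P]_w ((It w - step_integral (phi k) (W j) w) ^+ 2)%:E +
    4%:E * \int[P]_w ((Is w - step_integral (psi k) (W j) w) ^+ 2)%:E)%E.
  rewrite -EI//.
  have := @le_int3 (fun w => A w - terms_int j (L k) w)
    (fun w => It w - step_integral (phi k) (W j) w)
    (fun w => Is w - step_integral (psi k) (W j) w) (fun=> 0).
  rewrite [X in (_ + 2%:E * X)%E]integral0_eq ?mule0 ?adde0; last first.
    by move=> w _; rewrite expr0n.
  apply; [by case: sqD|exact: measurable_funB|exact: measurable_funB|exact: measurable_cst|].
  move=> w; rewrite /A LI; set p := step_integral (phi k) _ w; set q := step_integral (psi k) _ w.
  set e := c w * _.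
  have y1 := sqr_ge0 (It w - p + (Is w - q)).
  have y2 := sqr_ge0 (It w - p); have y3 := sqr_ge0 (Is w - q).
  rewrite expr0n /= mulr0 addr0 (_ : _ - (p - q - e) = (It w - p) - (Is w - q)); last by ring.
  lra.
have b2 : ((Ex P (fun w => terms_int j (map term_clip (L k)) w ^+ 2))%:E <=
    2%:E * (dbl P 0 t (dist2 (step_fun (phi k))) + dbl P 0 s (dist2 (step_fun (psi k)))))%E.
  have := @terms_bound (map term_clip (L k)) (step_fun (phi k)) (step_fun (psi k))
    (fun _ _ => 0) mphi mpsi (measurable_cst _) (fun _ _ => lexx _).
  rewrite [X in (_ + X)%E](_ : _ = 0%E); last first.
    by apply: integral0_eq => w _; apply: integral0_eq.
  rewrite adde0; apply => w r /andP[r0 rt].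
  rewrite terms_fun_clip LF !indicE !mem_setE !in_itv/= r0 rt andbT /= mulr0 addr0.
  rewrite /dist2; have [rs|sr] := ltP r s; last first.
    rewrite expr0n mulr_ge0// addr_ge0 ?sqr_ge0//.
    by rewrite mulr_ge0// sqr_ge0.
  rewrite (ltW rs) /= mulr0 subr0 mul1r.
  by have := sqr_ge0 (H r w - step_fun (phi k) r w + (H r w - step_fun (psi k) r w)); lra.
have d1 := dbl_ge0 0 t (dist2_ge0 (step_fun (phi k))).
have d2 := dbl_ge0 0 s (dist2_ge0 (step_fun (psi k))).
apply: (@le_trans _ _ ((2 * M ^+ 2)%:E * ((Ex P (fun w => (A w - terms_int j (L k) w) ^+ 2))%:E
    + (Ex P (fun w => terms_int j (map term_clip (L k)) w ^+ 2))%:E))%E); last first.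
  apply: lee_wpmul2l; first by rewrite lee_fin mulr_ge0 ?sqr_ge0.
  apply: leeD; first exact: b1.
  apply: (le_trans b2); rewrite ge0_muleDr; [|exact: d1|exact: d2].
  by apply: leeD; apply: lee_wpmul2r; [exact: d1|rewrite lee_fin; lra|exact: d2|rewrite lee_fin; lra].
rewrite -EFinD -EFinM lee_fin.
have izD : intg P (fun w => zeta w * (A w - terms_int j (L k) w)).
  by apply: intgM_bounded zM _ => //; exact: sq_intg_intg.
have izL : intg P (fun w => zeta w * terms_int j (L k) w).
  by apply: intgM_bounded zM _ => //; exact: sq_intg_intg.
have -> : Ex P (fun w => zeta w * A w) =
    Ex P (fun w => zeta w * (A w - terms_int j (L k) w)) +
    Ex P (fun w => zeta w * terms_int j (map term_clip (L k)) w).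
  rewrite -(Ex_terms_clip j _ Fz zM) -ExD//; apply: eq_Ex => w; ring.
have := zg _ sqD; have := zg _ sqC.
set x := Ex P _; set y := Ex P (fun w => zeta w * (A w - _)).
have := sqr_ge0 (x - y); lra.
Qed.

End ItoIncrement.

(** * A regular version of the replicator process *)

Section PolynomialFunctions.
Context {R : realType} {n : nat}.

(** A syntactic class, so that bounds, Lipschitz estimates, measurability, continuity and
    adaptedness of the coefficients all follow by induction. *)
Inductive poly_fun : ('cV[R]_n -> R) -> Prop :=
| poly_cst c : poly_fun (fun=> c)
| poly_coord i : poly_fun (fun x => x i 0)
| poly_add f g : poly_fun f -> poly_fun g -> poly_fun (fun x => f x + g x)
| poly_mul f g : poly_fun f -> poly_fun g -> poly_fun (fun x => f x * g x).

Lemma poly_sum I (r : seq I) (f : I -> 'cV[R]_n -> R) :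
  (forall i, poly_fun (f i)) -> poly_fun (fun x => \sum_(i <- r) f i x).
Proof.
move=> h; elim: r => [|i r IH].
  by under eq_fun do rewrite big_nil; exact: poly_cst.
by under eq_fun do rewrite big_cons; exact: poly_add.
Qed.

Lemma poly_opp f : poly_fun f -> poly_fun (fun x => - f x).
Proof.
by move=> h; under eq_fun do rewrite -mulN1r; apply: poly_mul => //; exact: poly_cst.
Qed.

Lemma poly_sub f g : poly_fun f -> poly_fun g -> poly_fun (fun x => f x - g x).
Proof. by move=> h k; apply: poly_add => //; exact: poly_opp. Qed.

Lemma poly_lipschitz f : poly_fun f -> exists2 K, 0 <= K &
  forall x y, in_box x -> in_box y ->
    `|f x| <= K /\ `|f x - f y| <= K * \sum_i `|x i 0 - y i 0|.
Proof.
elim=> [c|i|{}f g _ [K K0 hK] _ [L L0 hL]|{}f g _ [K K0 hK] _ [L L0 hL]].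
- exists `|c| => // x y _ _; split => //.
  by rewrite subrr normr0 mulr_ge0// sumr_ge0.
- exists 1 => // x y bx _; split.
    by have /andP[x0 x1] := bx i; rewrite ger0_norm.
  by rewrite mul1r (bigD1 i)//= lerDl sumr_ge0.
- exists (K + L); first exact: addr_ge0.
  move=> x y bx byy; have [h1 h2] := hK x y bx byy; have [h3 h4] := hL x y bx byy.
  split; first by apply: (le_trans (ler_normD _ _)); exact: lerD.
  rewrite opprD addrACA mulrDl; apply: (le_trans (ler_normD _ _)).
  exact: lerD.
- exists (K * L + K * L); first by rewrite addr_ge0 ?mulr_ge0.
  move=> x y bx byy; have [h1 h2] := hK x y bx byy; have [h3 h4] := hL x y bx byy.
  have [h5 _] := hK y x byy bx.
  split; first by rewrite normrM ler_wpDr ?mulr_ge0// ler_pM.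
  have -> : f x * g x - f y * g y = (f x - f y) * g x + f y * (g x - g y) by ring.
  apply: (le_trans (ler_normD _ _)); rewrite !normrM mulrDl; apply: lerD.
    by rewrite mulrAC ler_pM.
  by rewrite -mulrA ler_pM.
Qed.

Lemma poly_meas d (T : measurableType d) (D : set T) (X : T -> 'cV[R]_n) f : poly_fun f ->
  (forall i, measurable_fun D (fun w => X w i 0)) ->
  measurable_fun D (fun w => f (X w)).
Proof.
move=> pf hX; elim: pf => [c|i|{}f g _ hf _ hg|{}f g _ hf _ hg] //.
  exact: measurable_funD.
exact: measurable_funM.
Qed.

(** Row vectors are used to match the compactness argument in [simplex_poly_neg]. *)
Lemma poly_continuous f : poly_fun f -> continuous (fun x : 'rV[R]_n => f x^T).
Proof.
elim=> [c|i|{}f g _ hf _ hg|{}f g _ hf _ hg].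
- exact: cst_continuous.
- have -> : (fun x : 'rV[R]_n => x^T i 0) = (fun x => x 0 i).
    by apply/funext => x; rewrite mxE.
  exact: coord_continuous.
- by move=> x; apply: (continuousD (hf x) (hg x)).
- by move=> x; apply: (continuousM (hf x) (hg x)).
Qed.

End PolynomialFunctions.

Section ReplicatorCoefficients.
Context {R : realType} {n : nat}.
Variables (A : 'M[R]_n) (sigma : 'I_n -> R).
Implicit Type x : 'cV[R]_n.

Definition fitness (i : 'I_n) x : R := \sum_l A i l * x l 0 - sigma i ^+ 2 * x i 0.

(** Both coefficients of the ith equation are divided by x_i, here and in [diffusion_rate]. These
    relative rates are still polynomial, hence bounded up to the boundary. *)
Definition drift_rate (i : 'I_n) x : R := fitness i x - \sum_k x k 0 * fitness k x.

Definition diffusion_rate (i j : 'I_n) x : R := ((i == j)%:R - x j 0) * sigma j.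

Lemma replicator_driftE x i :
  replicator_drift A sigma x i 0 = x i 0 * drift_rate i x.
Proof.
have E k : ((A - diag_mx (\row_i sigma i ^+ 2)) *m x) k 0 = fitness k x.
  rewrite mxE /fitness; under eq_bigr do rewrite !mxE mulrBl.
  rewrite sumrB; congr (_ - _).
  rewrite (bigD1 k)//= eqxx mulr1n big1 ?addr0// => l lk.
  by rewrite eq_sym (negbTE lk) mulr0n mul0r.
rewrite /replicator_drift -mulmxA mxE; under eq_bigr do rewrite E !mxE mulrBl.
rewrite sumrB /drift_rate mulrBr; congr (_ - _).
  rewrite (bigD1 i)//= eqxx mulr1n big1 ?addr0// => l li.
  by rewrite eq_sym (negbTE li) mulr0n mul0r.
rewrite mulr_sumr; apply: eq_bigr => k _.
by rewrite big_ord1 !mxE mulrA.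
Qed.

Lemma replicator_diffusionE x i j :
  replicator_diffusion sigma x i j = x i 0 * diffusion_rate i j x.
Proof.
rewrite /replicator_diffusion /diffusion_rate mul_mx_diag !mxE big_ord1 !mxE.
by rewrite (ord1 ord0) -[x i 0 *+ _]mulr_natr; ring.
Qed.

Lemma fitness_poly i : poly_fun (fitness i).
Proof.
apply: poly_sub.
  by apply: poly_sum => l; apply: poly_mul; [exact: poly_cst|exact: poly_coord].
by apply: poly_mul; [exact: poly_cst|exact: poly_coord].
Qed.

Lemma drift_rate_poly i : poly_fun (drift_rate i).
Proof.
apply: poly_sub; first exact: fitness_poly.
by apply: poly_sum => k; apply: poly_mul; [exact: poly_coord|exact: fitness_poly].
Qed.

Lemma diffusion_rate_poly i j : poly_fun (diffusion_rate i j).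
Proof.
apply: poly_mul; last exact: poly_cst.
by apply: poly_sub; [exact: poly_cst|exact: poly_coord].
Qed.

Lemma drift_poly i : poly_fun (fun x => replicator_drift A sigma x i 0).
Proof.
rewrite (funext (fun x => replicator_driftE x i)).
by apply: poly_mul; [exact: poly_coord|exact: drift_rate_poly].
Qed.

Lemma diffusion_poly i j : poly_fun (fun x => replicator_diffusion sigma x i j).
Proof.
rewrite (funext (fun x => replicator_diffusionE x i j)).
by apply: poly_mul; [exact: poly_coord|exact: diffusion_rate_poly].
Qed.

End ReplicatorCoefficients.

Section ContinuousProcesses.
Context {d : measure_display} {T : measurableType d} {R : realType}.

Lemma truncn_div_cvg (x : R) : 0 <= x ->
  (fun m : nat => (Num.truncn (x * m.+1%:R))%:R / m.+1%:R) @ \oo --> x.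
Proof.
move=> x0; apply/cvgrPdist_le => e e0.
near=> m.
have m0 : 0 < m.+1%:R :> R by [].
have /andP[h1 h2] : (Num.truncn (x * m.+1%:R))%:R <= x * m.+1%:R < (Num.truncn (x * m.+1%:R)).+1%:R.
  by rewrite truncn_itv// mulr_ge0.
have h3 : (Num.truncn (x * m.+1%:R))%:R / m.+1%:R <= x by rewrite ler_pdivrMr.
rewrite ger0_norm ?subr_ge0//.
have -> : x - (Num.truncn (x * m.+1%:R))%:R / m.+1%:R =
    (x * m.+1%:R - (Num.truncn (x * m.+1%:R))%:R) / m.+1%:R by field.
rewrite ler_pdivrMr//; apply: (@le_trans _ _ 1).
  by rewrite lerBlDl natr1 ltW.
rewrite mulrC -ler_pdivrMr//.
near: m; exists (Num.truncn (1 / e)).+1 => // m /= hm.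
have /ltW h : 1 / e < (Num.truncn (1 / e)).+1%:R by rewrite truncnS_gt.
by apply: (le_trans h); rewrite ler_nat (leq_trans hm).
Unshelve. all: by end_near.
Qed.

(** Rounding time down to multiples of 1 / (m + 1) gives processes with countably many time values,
    which are jointly measurable and converge by continuity. Freezing at negative times lets the
    rounding take natural number values. *)
Lemma continuous_joint_meas (Z : T -> R -> R) : (forall w, continuous (Z w)) ->
  (forall r, measurable_fun setT (Z^~ r)) -> (forall w r, Z w r = Z w (Num.max r 0)) ->
  joint_meas Z.
Proof.
move=> cZ mZ Zmax.
pose k (m : nat) (r : R) := Num.truncn (Num.max r 0 * m.+1%:R).
pose Zm m (p : T * R) := Z p.1 ((k m p.2)%:R / m.+1%:R).
apply: (@measurable_fun_cvg _ _ _ _ Zm) => //; last first.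
  move=> [w r] _; rewrite /Zm/= Zmax.
  apply: (cvg_comp (fun m : nat => (k m r)%:R / m.+1%:R) (Z w)); last exact: cZ.
  by apply: truncn_div_cvg; rewrite le_max lexx orbT.
move=> m; move=> _ B mB; rewrite setTI.
have mk i : measurable [set r | k m r = i].
  have mm : measurable_fun setT (fun r : R => Num.max r 0 * m.+1%:R).
    by apply: measurable_funM => //; exact: measurable_maxr.
  rewrite (_ : [set r | k m r = i] = setT `&`
      (fun r : R => Num.max r 0 * m.+1%:R) @^-1` `[i%:R, i.+1%:R[%classic).
    exact: mm.
  have r0 (r : R) : 0 <= Num.max r 0 * m.+1%:R.
    by apply: mulr_ge0 => //; rewrite le_max lexx orbT.
  rewrite setTI; apply/seteqP; split=> r /=; rewrite in_itv/= -truncn_eq//.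
    by move=> /eqP.
  by move=> /eqP.
rewrite (_ : Zm m @^-1` B = \bigcup_i ((Z^~ (i%:R / m.+1%:R) @^-1` B) `*` [set r | k m r = i])).
  apply: bigcup_measurable => i _; apply: measurableX => //.
  by rewrite -[X in measurable X]setTI; exact: mZ.
apply/seteqP; split=> [[w r] /= h|[w r] [i _ [/= h1 h2]]].
  by exists (k m r).
by rewrite /preimage/= /Zm/= h2.
Qed.

End ContinuousProcesses.

Section Regularization.
Context {R : realType} {d : measure_display} {T : measurableType d}.
Variable P : probability T R.

Lemma continuous_max0 (f : R -> R) : {within `[0, +oo[, continuous f} ->
  continuous (fun r : R => f (Num.max r 0)).
Proof.
move=> /subspace_continuousP cf r.
have h : (fun r => Num.max r 0) @ r --> Num.max r (0 : R).
  by apply: (@continuous_max _ _ id (cst 0)); [exact: cvg_id|exact: cvg_cst].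
have A r' : `[0, +oo[%classic (Num.max r' (0 : R)).
  by rewrite /= in_itv/= le_max lexx orbT.
move=> U /(cf _ (A r)); rewrite /within/= => /h hU.
exact: (@filterS _ (nbhs r) _ _ _ (fun r' H => H (A r')) hU).
Qed.

Context {n : nat} (A : 'M[R]_n) (sigma : 'I_n -> R) (x0 : 'cV[R]_n).
Variables (W : 'I_n -> R -> T -> R) (X : R -> T -> 'cV[R]_n).
Hypotheses (x0_int : int_simplex x0) (BW : standard_brownian_motion P W).
Hypothesis (SX : stochastic_replicator P A sigma x0 W X).
Local Notation F := (brownian_filtration P W).

(* A version of the solution on which the a.s. properties hold everywhere; it
   is frozen at its initial value for negative times. *)
Definition regular_solution (Y : R -> T -> 'cV[R]_n) :=
  [/\ forall r w, simplex (Y r w),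
      forall i w, continuous (fun r => Y r w i 0),
      forall t i, 0 <= t -> F_measurable F t (fun w => Y t w i 0),
      forall i, joint_meas (fun w r => Y r w i 0) &
      {ae P, forall w, Y 0 w = x0} /\
      forall t i, 0 <= t -> exists I : 'I_n -> T -> R,
        (forall j, is_ito_integral P F (W j)
           (fun s w => replicator_diffusion sigma (Y s w) i j) t (I j)) /\
        {ae P, forall w, Y t w i 0 = x0 i 0
             + \int[lebesgue_measure]_(s in `[0, t]) replicator_drift A sigma (Y s w) i 0
             + \sum_j I j w}].

(** On the null set [N] the path is replaced by the constant [x0]. Adaptedness survives because null
    events belong to every [F t], and the Ito integrals survive because their definition sees the
    integrand only under an expectation. *)
Lemma regularization : exists2 Y, regular_solution Y &
  {ae P, forall w, forall t, 0 <= t -> X t w = Y t w}.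
Proof.
have [X0 XD Xc XF XI] := SX.
have [N [mN N0 Nsub]] := XD.
pose Xm r w := X (Num.max r 0) w.
pose Y r w := if w \in N then x0 else Xm r w.
have max0 (r : R) : 0 <= Num.max r 0 by rewrite le_max lexx orbT.
have YX w t : w \notin N -> 0 <= t -> X t w = Y t w.
  by move=> wN t0; rewrite /Y (negbTE wN) /Xm max_l.
have aeN : {ae P, forall w, w \notin N}.
  by exists N; split=> // w /= /negP; rewrite negbK inE.
have mXm i r : measurable_fun setT (fun w => Xm r w i 0).
  by apply: (F_measurable_meas BW (XF _ i (max0 r))).
have jXm i : joint_meas (fun w r => Xm r w i 0).
  apply: continuous_joint_meas => [w|r|w r].
  - exact: (continuous_max0 (Xc i w)).
  - exact: mXm.
  - by rewrite /Xm (max_l (max0 r)).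
have jY i : joint_meas (fun w r => Y r w i 0).
  rewrite /joint_meas (_ : (fun p => _) = (fun p : T * R => \1_N p.1 * x0 i 0 + (1 - \1_N p.1) * Xm p.2 p.1 i 0)).
    have m1 : measurable_fun setT (fun p : T * R => (\1_N : T -> R) p.1).
      exact: (measurableT_comp (measurable_indic mN) measurable_fst).
    by apply: measurable_funD; apply: measurable_funM => //; [exact: measurable_funB|exact: jXm].
  by apply/funext => p; rewrite /Y indicE; case: (p.1 \in N); rewrite ?mul1r ?subrr ?mul0r ?addr0 ?add0r ?subr0 ?mul1r.
exists Y; last by apply: filterS aeN => w wN t t0; exact: YX.
split=> //.
- move=> r w; rewrite /Y; case: ifPn => wN; first by case: x0_int.
  have /contrapT : ~ ~ (forall t, 0 <= t -> simplex (X t w)).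
    by move=> h; move/negP: wN; apply; rewrite inE; apply: Nsub.
  by apply.
- move=> i w; rewrite /Y; case wN: (w \in N); first exact: cst_continuous.
  exact: (continuous_max0 (Xc i w)).
- move=> t i t0.
  rewrite (_ : (fun w => _) = (fun w => \1_N w * x0 i 0 + (1 + (-1) * \1_N w) * X t w i 0)).
    have FN : F_measurable F t \1_N by apply: F_measurable_indic; apply: F_null.
    apply: F_measurableD; apply: F_measurableM => //.
    + exact: F_measurable_cst.
    + apply: F_measurableD; first exact: F_measurable_cst.
      by apply: F_measurableM => //; exact: F_measurable_cst.
    + exact: XF.
  apply/funext => w; rewrite /Y /Xm max_l// !indicE.
  by case: (w \in N) => /=; ring.
- split.
    apply: filterS2 aeN X0 => w wN w0.
    by rewrite -YX.
  move=> t i t0; have [I [Iito IE]] := XI t i t0.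
  exists I; split.
    move=> j; have [mI [phi [phiE h1 h2]]] := Iito j; split; first exact: mI.
    exists phi; split; [exact: phiE| |exact: h2].
    set H := fun s w => replicator_diffusion sigma (X s w) i j in h1.
    (* [Hm] agrees with [H] on [0, t] for every sample point and with the integrand of [Y] off [N].
       It is built from the jointly measurable [Xm], which gives the measurability needed for the
       almost everywhere comparison. *)
    pose Hm s w := replicator_diffusion sigma (Xm s w) i j.
    rewrite (_ : (fun k => _) = (fun k => \int[P]_w \int[lebesgue_measure]_(s in `[0%R, t])
        ((H s w - step_fun (phi k) s w) ^+ 2)%:E)%E); first exact: h1.
    apply/funext => k.
    have [L LE] := step_terms (lexx t) (phiE k).
    have jphi : joint_meas (fun w r => step_fun (phi k) r w).
      rewrite /joint_meas (_ : (fun p => _) = (fun p => terms_fun L p.2 p.1)).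
        exact: terms_fun_meas.
      by apply/funext => p; rewrite (LE p.1).2.
    have jm (Z : R -> T -> 'cV[R]_n) : (forall i, joint_meas (fun w r => Z r w i 0)) ->
        measurable_fun setT (fun w => \int[lebesgue_measure]_(s in `[0%R, t])
          ((replicator_diffusion sigma (Z s w) i j - step_fun (phi k) s w) ^+ 2)%:E)%E.
      move=> jZ; apply: (measurable_integral_itv _ _ (g := fun w s =>
          (replicator_diffusion sigma (Z s w) i j - step_fun (phi k) s w) ^+ 2)).
        apply: measurable_funX; apply: measurable_funB => //.
        exact: (poly_meas (diffusion_poly sigma i j)).
      by move=> w r; exact: sqr_ge0.
    have E w : (\int[lebesgue_measure]_(s in `[0%R, t]) ((Hm s w - step_fun (phi k) s w) ^+ 2)%:E =
        \int[lebesgue_measure]_(s in `[0%R, t]) ((H s w - step_fun (phi k) s w) ^+ 2)%:E)%E.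
      apply: eq_integral => r; rewrite inE/= in_itv/= => /andP[r0 _].
      by rewrite /Hm /Xm max_l.
    under [RHS]eq_integral do rewrite -E.
    apply: ge0_ae_eq_integral => //.
    - exact: jm.
    - exact: jm.
    - by move=> w _; apply: integral_ge0 => r _; rewrite lee_fin sqr_ge0.
    - by move=> w _; apply: integral_ge0 => r _; rewrite lee_fin sqr_ge0.
    - apply: filterS aeN => w wN _; apply: eq_integral => r _.
      by rewrite /Hm /Y (negbTE wN).
  apply: filterS2 aeN IE => w wN; rewrite -YX// => ->; congr (_ + _ + _).
  apply: eq_Rintegral => s; rewrite inE/= in_itv/= => /andP[s0 _].
  by rewrite YX.
Qed.

End Regularization.

(** * Euler expansions over small time steps *)

Section FiniteSums.
Context {R : realType} {n : nat}.
Implicit Types a : 'I_n -> R.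

Lemma sqr_sum_le a : (\sum_i a i) ^+ 2 <= n%:R * \sum_i a i ^+ 2.
Proof.
have -> : n%:R * \sum_i a i ^+ 2 = \sum_i \sum_j (a i ^+ 2 + a j ^+ 2) / 2.
  set S := \sum_i a i ^+ 2.
  transitivity (\sum_i ((n%:R * a i ^+ 2 + S) / 2)).
    by rewrite -mulr_suml big_split/= -mulr_sumr sumr_const card_ord -(mulr_natl S n) -/S; field.
  by apply: eq_bigr => i _; rewrite -mulr_suml big_split/= sumr_const card_ord (mulr_natl (a i ^+ 2)).
rewrite expr2 mulr_suml ler_sum// => i _; rewrite mulr_sumr ler_sum// => j _.
have := sqr_ge0 (a i - a j); lra.
Qed.

(** Two of the three factors are treated by [sqr_sum_le]; then a_i^2 a_j <= a_i^3 + a_j^3 by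
    comparing a_i with a_j. *)
Lemma exp3_sum_le a : (forall i, 0 <= a i) ->
  (\sum_i a i) ^+ 3 <= 2 * n%:R ^+ 2 * \sum_i a i ^+ 3.
Proof.
move=> a0; have S0 : 0 <= \sum_i a i by exact: sumr_ge0.
rewrite exprSr; apply: (le_trans (ler_wpM2r S0 (sqr_sum_le a))).
have -> : 2 * n%:R ^+ 2 * \sum_i a i ^+ 3 = n%:R * \sum_i \sum_j (a i ^+ 3 + a j ^+ 3).
  set S := \sum_i a i ^+ 3.
  transitivity (n%:R * \sum_i (n%:R * a i ^+ 3 + S)).
    by rewrite big_split/= -mulr_sumr sumr_const card_ord -(mulr_natl S n) -/S; ring.
  congr (_ * _).
  by apply: eq_bigr => i _; rewrite big_split/= sumr_const card_ord (mulr_natl (a i ^+ 3)).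
rewrite -mulrA ler_wpM2l// mulr_suml ler_sum// => i _; rewrite mulr_sumr ler_sum// => j _.
have [ij|/ltW ji] := leP (a i) (a j).
  have h : a i ^+ 2 <= a j ^+ 2 by rewrite lerXn2r ?nnegrE.
  rewrite (exprSr (a j) 2); apply: (le_trans (ler_wpM2r (a0 j) h)).
  by rewrite lerDr exprn_ge0.
rewrite (exprSr (a i) 2).
by apply: ler_wpDr; [rewrite exprn_ge0|rewrite ler_wpM2l// exprn_ge0].
Qed.

End FiniteSums.

Lemma poly_lipschitz_fin {R : realType} {n : nat} (I : finType)
    (f : I -> 'cV[R]_n -> R) : (forall i, poly_fun (f i)) ->
  exists2 K, 0 <= K & forall i x y, in_box x -> in_box y ->
    `|f i x| <= K /\ `|f i x - f i y| <= K * \sum_k `|x k 0 - y k 0|.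
Proof.
move=> pf.
have /choice[K hK] : forall i, exists K, 0 <= K /\ forall x y, in_box x -> in_box y ->
    `|f i x| <= K /\ `|f i x - f i y| <= K * \sum_k `|x k 0 - y k 0|.
  by move=> i; have [K K0 h] := poly_lipschitz (pf i); exists K.
exists (\sum_i K i); first by apply: sumr_ge0 => i _; case: (hK i).
move=> i x y bx byy; have [K0 /(_ x y bx byy)[h1 h2]] := hK i.
have KS : K i <= \sum_i K i.
  by rewrite (bigD1 i)//= lerDl sumr_ge0// => j _; case: (hK j).
split; first exact: le_trans KS.
by apply: (le_trans h2); rewrite ler_wpM2r// sumr_ge0.
Qed.

Section DoubleIntegralBounds.
Context {d : measure_display} {T : measurableType d} {R : realType}.
Variable P : probability T R.
Implicit Types (g : T -> R -> R) (a b B : R).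

Lemma itv_integral_cst a b B : a <= b ->
  (\int[lebesgue_measure]_(r in `[a, b]) (B%:E) = (B * (b - a))%:E)%E.
Proof.
move=> ab; rewrite integral_cst//= lebesgue_measure_itv/= lte_fin.
case: ltP => h; first by rewrite -EFinB -EFinM.
by have -> : b = a; [exact/le_anti/andP|rewrite subrr mulr0 mule0].
Qed.

Lemma dbl_bounded a b B g : a <= b -> joint_meas g -> (forall w r, 0 <= g w r) ->
  (forall w r, a <= r <= b -> g w r <= B) -> (dbl P a b g <= (B * (b - a))%:E)%E.
Proof.
move=> ab mg g0 gB.
apply: (le_trans (le_dbl P (h := fun _ _ => B) mg _ g0 gB)); first exact: measurable_cst.
rewrite /dbl; under eq_integral do rewrite itv_integral_cst//.
by rewrite integral_cst//= probability_setT mule1.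
Qed.

Lemma dbl_Ex_bounded a b B g : a <= b -> joint_meas g -> (forall w r, 0 <= g w r) ->
  (forall r, a <= r <= b -> intg P (g^~ r) /\ Ex P (g^~ r) <= B) ->
  (dbl P a b g <= (B * (b - a))%:E)%E.
Proof.
move=> ab mg g0 gB; rewrite /dbl fubini_tonelli_itv//.
rewrite -itv_integral_cst//; apply: ge0_le_integral => //.
- by move=> r _; apply: integral_ge0 => w _; rewrite lee_fin.
- apply: measurable_funTS.
  pose f (p : T * measurableTypeR R) : \bar R := (g p.1 p.2)%:E.
  apply: (measurable_fun_fubini_tonelli_G (m1 := P) f) => [|p]; last by rewrite lee_fin.
  by apply/measurable_EFinP; exact: mg.
- move=> r; rewrite /= in_itv/= => /gB[ig EgB].
  apply: (@le_trans _ _ (Ex P (g^~ r))%:E); last by rewrite lee_fin.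
  by rewrite /Ex /Rintegral fineK//; exact: integrable_fin_num.
Qed.

End DoubleIntegralBounds.

Section TimeIntegrals.
Context {d : measure_display} {T : measurableType d} {R : realType}.
Variables (P : probability T R) (g : T -> R -> R) (K : R).
Hypotheses (mg : joint_meas g) (gK : forall w r, `|g w r| <= K).
Local Notation mu := (@lebesgue_measure R).
Let J a b w : R := \int[mu]_(r in `[a, b]) g w r.

Lemma time_integrable a b w : mu.-integrable `[a, b] (EFin \o g w).
Proof.
apply: measurable_bounded_integrable => //.
- exact: lebesgue_itv_lty.
- by apply: measurable_funTS; exact: section_meas.
- exists K; split; first exact: num_real.
  by move=> y Ky r _; exact: le_trans (gK w r) (ltW Ky).
Qed.

Lemma time_integral_le a b w : a <= b -> `|J a b w| <= K * (b - a).
Proof.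
move=> ab; have ig := time_integrable a b w.
rewrite /J; have mI : measurable (`[a, b] : set (measurableTypeR R)) by exact: measurable_itv.
apply: (le_trans (le_normr_Rintegral mI ig)).
rewrite -lee_fin -itv_integral_cst// /Rintegral fineK; last first.
  exact: (integrable_fin_num mI (integrable_norm ig)).
apply: ge0_le_integral => //.
- by apply/measurable_EFinP/measurableT_comp => //; apply: measurable_funTS; exact: section_meas.
- by move=> r _; rewrite lee_fin.
Qed.

Lemma time_integral_meas a b : a <= b -> measurable_fun setT (J a b).
Proof.
move=> ab.
(* Adding the bound [K] makes the integrand nonnegative. *)
have -> : J a b = (fun w => fine (\int[mu]_(r in `[a, b]) (g w r + K)%:E)%E - K * (b - a)).
  apply/funext => w; rewrite -[X in _ = X - _]/(\int[mu]_(r in `[a, b]) (g w r + K)) RintegralD//.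
  - rewrite [X in _ = _ + X - _](_ : _ = K * (b - a)) ?addrK//.
    by rewrite /Rintegral itv_integral_cst.
  - exact: time_integrable.
  - apply: measurable_bounded_integrable => //; first exact: lebesgue_itv_lty.
    by exists `|K|; split; [exact: num_real|move=> y Ky r _; exact: ltW].
apply: measurable_funB => //; apply: measurableT_comp => //.
apply: (measurable_integral_itv (g := fun w r => g w r + K)) => [|w r].
  exact: measurable_funD.
by have := gK w r; rewrite ler_norml -lerBlDr sub0r => /andP[].
Qed.

Lemma time_integralB s t w : 0 <= s -> s <= t -> J 0 t w - J 0 s w = J s t w.
Proof.
move=> s0 st; rewrite /J Rintegral_itvB//; last exact: time_integrable.
apply: Rintegral_itv_obnd_cbnd.
apply: (integrableS _ _ _ (time_integrable s t w)) => //.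
by apply: subset_itvr; rewrite bnd_simp.
Qed.

Lemma time_integral_dist s t B (c : T -> R) : s <= t ->
  measurable_fun setT c -> (forall w, `|c w| <= K) ->
  (forall r, s <= r <= t -> Ex P (fun w => `|g w r - c w|) <= B) ->
  Ex P (fun w => `|J s t w - (t - s) * c w|) <= B * (t - s).
Proof.
move=> st mc cK hB.
have mh : joint_meas (fun w r => `|g w r - c w|).
  apply: measurableT_comp => //; apply: measurable_funB => //.
  exact: (measurableT_comp mc measurable_fst).
have hK w r : `|g w r - c w| <= K + K by rewrite (le_trans (ler_normB _ _))// lerD.
have mJ : measurable_fun setT (fun w => `|J s t w - (t - s) * c w|).
  apply: measurableT_comp => //; apply: measurable_funB; first exact: time_integral_meas.
  exact: measurable_funM.
have JE w : J s t w - (t - s) * c w = \int[mu]_(r in `[s, t]) (g w r - c w).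
  have ic : mu.-integrable `[s, t] (EFin \o fun=> c w).
    apply: measurable_bounded_integrable => //; first exact: lebesgue_itv_lty.
    by exists `|c w|; split; [exact: num_real|move=> y Ky r _; exact: ltW].
  rewrite RintegralB//; last exact: time_integrable.
  by congr (_ - _); rewrite /Rintegral itv_integral_cst//= mulrC.
have igh w : mu.-integrable `[s, t] (EFin \o (fun r => g w r - c w)).
  apply: measurable_bounded_integrable => //; first exact: lebesgue_itv_lty.
    by apply: measurable_funTS; apply: measurable_funB => //; exact: section_meas.
  exists (K + K); split; first exact: num_real.
  by move=> y Ky r _; exact: le_trans (hK w r) (ltW Ky).
have iJ : intg P (fun w => `|J s t w - (t - s) * c w|).
  apply: (intg_bounded P (M := K * (t - s) + (t - s) * K)) => // w.
  rewrite normr_id (le_trans (ler_normB _ _))// lerD//; first exact: time_integral_le.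
  by rewrite normrM ger0_norm ?subr_ge0// ler_wpM2l ?subr_ge0.
rewrite -lee_fin; apply: (@le_trans _ _ (dbl P s t (fun w r => `|g w r - c w|))); last first.
  apply: dbl_Ex_bounded => // r rst; split; last exact: hB.
  apply: (intg_bounded P (M := K + K)) => [|w]; last by rewrite normr_id.
  exact: (measurableT_comp mh (measurable_pair2 r)).
rewrite /Ex /Rintegral fineK; last exact: (integrable_fin_num _ iJ).
apply: ge0_le_integral => //.
- exact/measurable_EFinP.
- exact: measurable_integral_itv.
move=> w _; rewrite JE.
have mI : measurable (`[s, t] : set (measurableTypeR R)) by exact: measurable_itv.
have := le_normr_Rintegral mI (igh w).
rewrite -lee_fin => /le_trans; apply.
by rewrite /Rintegral fineK//; exact: (integrable_fin_num mI (integrable_norm (igh w))).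
Qed.

End TimeIntegrals.

Section EulerScheme.
Context {d : measure_display} {T : measurableType d} {R : realType}.
Variables (P : probability T R) (n : nat) (W : 'I_n -> R -> T -> R).
Hypothesis BW : standard_brownian_motion P W.
Local Notation F := (brownian_filtration P W).
Variables (b : 'I_n -> 'cV[R]_n -> R) (C : 'I_n -> 'I_n -> 'cV[R]_n -> R).
Hypotheses (pb : forall i, poly_fun (b i)) (pC : forall i j, poly_fun (C i j)).
Variables (x0 : 'cV[R]_n) (X : R -> T -> 'cV[R]_n).
Hypotheses (X_box : forall r w, in_box (X r w))
  (FX : forall t i, 0 <= t -> F_measurable F t (fun w => X t w i 0))
  (jX : forall i, joint_meas (fun w r => X r w i 0)).
Hypothesis X_sol : forall t i, 0 <= t -> exists I : 'I_n -> T -> R,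
  (forall j, is_ito_integral P F (W j) (fun s w => C i j (X s w)) t (I j)) /\
  {ae P, forall w, X t w i 0 = x0 i 0
     + \int[lebesgue_measure]_(s in `[0, t]) b i (X s w) + \sum_j I j w}.

Definition drift_part i s t w : R :=
  \int[lebesgue_measure]_(r in `[s, t]) b i (X r w).

(** With [c] equal to 0 this is the full martingale part of the increment; with [c] the diffusion
    coefficient at time s it is what remains after freezing that coefficient. *)
Definition martingale_part i s t (c : 'I_n -> T -> R) w : R :=
  X t w i 0 - X s w i 0 - drift_part i s t w -
  \sum_j c j w * (W j t w - W j s w).

Let mX t i : measurable_fun setT (fun w => X t w i 0).
Proof. exact: (measurableT_comp (jX i) (measurable_pair2 t)). Qed.

Let mfX f t : poly_fun f -> measurable_fun setT (fun w => f (X t w)).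
Proof. by move=> pf; apply: poly_meas. Qed.

Let jfX f : poly_fun f -> joint_meas (fun w r => f (X r w)).
Proof. by move=> pf; apply: (poly_meas pf). Qed.

Lemma F_measurable_poly f t : poly_fun f -> 0 <= t ->
  F_measurable F t (fun w => f (X t w)).
Proof.
move=> pf t0; elim: pf => [c|i|{}f g _ hf _ hg|{}f g _ hf _ hg].
- exact: F_measurable_cst.
- exact: FX.
- exact: F_measurableD.
- exact: F_measurableM.
Qed.

Let mI j s t : 0 <= s -> s <= t -> measurable_fun setT (fun w => W j t w - W j s w).
Proof. by move=> s0 st; exact: (bm_incr_meas BW j s0 st). Qed.

Section Increment.
Variables (s t : R).
Hypotheses (s0 : 0 <= s) (st : s <= t).
Let t0 : 0 <= t := le_trans s0 st.

Lemma drift_part_meas i : measurable_fun setT (drift_part i s t).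
Proof.
have [K K0 h] := poly_lipschitz (pb i).
apply: (time_integral_meas (g := fun w r => b i (X r w)) (K := K)) => //.
  exact: jfX.
by move=> w r; case: (h _ _ (X_box r w) (X_box r w)).
Qed.

Variables (i : 'I_n) (c : 'I_n -> T -> R) (v : R).
Hypotheses (Fc : forall j, F_measurable F s (c j))
  (c_bounded : forall j, exists M : R, forall w, `|c j w| <= M).
Hypothesis V_le : forall j,
  (dbl P s t (fun w r => (C i j (X r w) - c j w) ^+ 2)%R <= v%:E)%E.

Lemma martingale_part_meas : measurable_fun setT (martingale_part i s t c).
Proof.
apply: measurable_funB; first apply: measurable_funB; first exact: measurable_funB.
  exact: drift_part_meas.
apply: measurable_sum => j; apply: measurable_funM; last exact: mI.
exact: (F_measurable_meas BW (Fc j)).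
Qed.

Let decomposition : exists A : 'I_n -> T -> R,
  [/\ forall j, sq_intg P (A j), forall j, Ex P (fun w => A j w ^+ 2) <= 4 * v,
      forall j zeta, F_measurable F s zeta -> (exists M : R, forall w, `|zeta w| <= M) ->
        Ex P (fun w => zeta w * A j w) = 0 &
      {ae P, forall w, martingale_part i s t c w = \sum_j A j w}].
Proof.
have [It [ItP ItE]] := X_sol i t0; have [Is [IsP IsE]] := X_sol i s0.
have jC j : joint_meas (fun w r => C i j (X r w)) by exact: jfX.
have Vfin j : (dbl P s t (fun w r => (C i j (X r w) - c j w) ^+ 2)%R < +oo)%E.
  by apply: (le_lt_trans (V_le j)); rewrite ltry.
have sqA j := ito_increment_sq_intg BW s0 st (jC j) (ItP j) (IsP j) (Fc j) (c_bounded j) (Vfin j).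
exists (fun j w => It j w - Is j w - c j w * (W j t w - W j s w)); split => //.
- move=> j; have := ito_increment_sq BW s0 st (jC j) (ItP j) (IsP j) (Fc j) (c_bounded j).
  rewrite -lee_fin /Ex /Rintegral fineK; last first.
    by have [_ h] := sqA j; exact: (integrable_fin_num _ h).
  by move=> /le_trans; apply; rewrite EFinM lee_pmul2l// lte_fin.
- move=> j zeta Fz zM.
  exact: (ito_increment_mean0 BW s0 st (jC j) (ItP j) (IsP j) (Fc j) (c_bounded j) (Vfin j)).
- apply: filterS2 ItE IsE => w Et Es.
  have [K K0 h] := poly_lipschitz (pb i).
  have jb : joint_meas (fun w r => b i (X r w)) by exact: jfX.
  have hK w' r : `|b i (X r w')| <= K by case: (h _ _ (X_box r w') (X_box r w')).
  have D := time_integralB jb hK w s0 st.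
  rewrite /martingale_part /drift_part -D Et Es !sumrB; ring.
Qed.

Lemma martingale_part_sq : sq_intg P (martingale_part i s t c) /\
  Ex P (fun w => martingale_part i s t c w ^+ 2) <= 4 * n%:R ^+ 2 * v.
Proof.
have [A [sA A2 _ AE]] := decomposition.
have sS : sq_intg P (fun w => \sum_j A j w) by exact: sq_intg_sum.
have mM := martingale_part_meas.
have m2 : measurable_fun setT (fun w => martingale_part i s t c w ^+ 2).
  exact: measurable_funX.
have iM : intg P (fun w => martingale_part i s t c w ^+ 2).
  have [_ h] := sS; apply: ae_eq_intg h => //.
  by apply: filterS AE => w ->.
split=> //.
rewrite (@ae_eq_Ex _ _ _ P _ (fun w => (\sum_j A j w) ^+ 2))//; last 2 first.
- by case: sS => mS _; exact: measurable_funX.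
- by apply: filterS AE => w ->.
have i2 : intg P (fun w => n%:R * \sum_j A j w ^+ 2).
  by apply: intgZ; apply: intg_sum => j _; case: (sA j).
apply: (@le_trans _ _ (Ex P (fun w => n%:R * \sum_j A j w ^+ 2))).
  apply: le_Ex => //; first by case: sS.
  by move=> w; exact: sqr_sum_le.
rewrite ExZ; last by apply: intg_sum => j _; case: (sA j).
rewrite Ex_sum; last by move=> j; case: (sA j).
have -> : 4 * n%:R ^+ 2 * v = n%:R * \sum_(j < n) (4 * v).
  by rewrite sumr_const card_ord -(mulr_natl (4 * v)); ring.
by rewrite ler_wpM2l// ler_sum.
Qed.

Lemma martingale_part_mean0 zeta : F_measurable F s zeta ->
  (exists M : R, forall w, `|zeta w| <= M) ->
  Ex P (fun w => zeta w * martingale_part i s t c w) = 0.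
Proof.
move=> Fz zM; have [A [sA _ A0 AE]] := decomposition.
have mz := F_measurable_meas BW Fz.
rewrite (@ae_eq_Ex _ _ _ P _ (fun w => \sum_j zeta w * A j w)); last 3 first.
- by apply: measurable_funM => //; exact: martingale_part_meas.
- by apply: measurable_sum => j; apply: measurable_funM => //; case: (sA j).
- by apply: filterS AE => w ->; rewrite mulr_sumr.
have [M hM] := zM.
rewrite Ex_sum; first by rewrite big1// => j _; exact: A0.
by move=> j; exact: intgM_bounded mz hM (sq_intg_intg (sA j)).
Qed.

End Increment.

Let mfD f s t : poly_fun f -> measurable_fun setT (fun w => f (X t w) - f (X s w)).
Proof. by move=> pf; apply: measurable_funB; exact: mfX. Qed.

Let norm_coord_le t w i : `|X t w i 0| <= 1.
Proof. by have /andP[h0 h1] := X_box t w i; rewrite ger0_norm. Qed.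

Let sqX i s t : sq_intg P (fun w => X t w i 0 - X s w i 0).
Proof.
apply: (@sq_intg_bounded _ _ _ _ _ (1 + 1)) => [|w]; first exact: measurable_funB.
by rewrite (le_trans (ler_normB _ _))// lerD.
Qed.

Let iX2 i s t : intg P (fun w => (X t w i 0 - X s w i 0) ^+ 2).
Proof. by case: (sqX i s t). Qed.

(** The drift contributes the order (t - s)^2 and the noise the order t - s, which dominates for
    steps of length at most 1. *)
Lemma increment_sq : exists2 K : R, 0 <= K & forall i (s t : R), 0 <= s -> s <= t -> t - s <= 1 ->
  Ex P (fun w => (X t w i 0 - X s w i 0) ^+ 2) <= K * (t - s).
Proof.
have [K K0 hb] := poly_lipschitz_fin pb.
have [L L0 hC] := poly_lipschitz_fin (fun ij : 'I_n * 'I_n => pC ij.1 ij.2).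
exists (2 * K ^+ 2 + 8 * n%:R ^+ 2 * L ^+ 2).
  by rewrite addr_ge0// !mulr_ge0 ?sqr_ge0.
move=> i s t s0 st h1; have h0 : 0 <= t - s by rewrite subr_ge0.
pose c (j : 'I_n) (w : T) : R := 0.
have Fc j : F_measurable F s (c j) by exact: F_measurable_cst.
have cM j : exists M : R, forall w, `|c j w| <= M by exists 0 => w; rewrite normr0.
have V j : (dbl P s t (fun w r => (C i j (X r w) - c j w) ^+ 2)%R <= (L ^+ 2 * (t - s))%:E)%E.
  apply: dbl_bounded => //.
  - apply: measurable_funX; apply: measurable_funB; first exact: jfX.
    exact: measurable_cst.
  - by move=> w r; exact: sqr_ge0.
  move=> w r _; rewrite subr0 -real_normK ?num_real// lerXn2r ?nnegrE//.
  by have [] := hC (i, j) _ _ (X_box r w) (X_box r w).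
have [[_ iM] EM] := martingale_part_sq s0 st Fc cM V.
set M := martingale_part i s t c in iM EM.
have DK w : `|drift_part i s t w| <= K * (t - s).
  apply: (time_integral_le (g := fun w r => b i (X r w))) => //; first exact: jfX.
  by move=> w' r; have [] := hb i _ _ (X_box r w') (X_box r w').
have E w : X t w i 0 - X s w i 0 = drift_part i s t w + M w.
  by rewrite /M /martingale_part big1 => [|j _]; rewrite ?mul0r//; ring.
apply: (@le_trans _ _ (Ex P (fun w => 2 * K ^+ 2 * (t - s) + 2 * M w ^+ 2))).
  apply: le_Ex => //; first by apply: intgD; [exact: intg_cst|exact: intgZ].
  move=> w; rewrite E.
  have D2 : drift_part i s t w ^+ 2 <= K ^+ 2 * (t - s).
    rewrite -real_normK ?num_real//; apply: (@le_trans _ _ ((K * (t - s)) ^+ 2)).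
      by rewrite lerXn2r ?nnegrE// mulr_ge0.
    by rewrite exprMn ler_wpM2l ?sqr_ge0// expr2 ler_piMl.
  by have := sqr_ge0 (drift_part i s t w - M w); nra.
rewrite ExD; [|exact: intg_cst|exact: intgZ].
rewrite Ex_cst ExZ//.
by move: EM; nra.
Qed.

Lemma coef_increment_sq (I : finType) (f : I -> 'cV[R]_n -> R) :
  (forall k, poly_fun (f k)) -> exists2 K : R, 0 <= K &
  forall k (s t : R), 0 <= s -> s <= t -> t - s <= 1 ->
    Ex P (fun w => (f k (X t w) - f k (X s w)) ^+ 2) <= K * (t - s).
Proof.
move=> pf; have [K K0 hK] := increment_sq; have [L L0 hf] := poly_lipschitz_fin pf.
exists (L ^+ 2 * n%:R ^+ 2 * K); first by rewrite !mulr_ge0 ?sqr_ge0.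
move=> k s t s0 st h1.
have iS : intg P (fun w => \sum_i (X t w i 0 - X s w i 0) ^+ 2) by exact: intg_sum.
apply: (@le_trans _ _ (Ex P (fun w => L ^+ 2 * n%:R * \sum_i (X t w i 0 - X s w i 0) ^+ 2))).
  apply: le_Ex => [| |w]; [|exact: intgZ|].
    apply: (intg_bounded P (M := (2 * L) ^+ 2)); first exact/measurable_funX/mfD.
    move=> w; rewrite ger0_norm ?sqr_ge0// -real_normK ?num_real// lerXn2r ?nnegrE ?mulr_ge0//.
    have [h2 _] := hf k _ _ (X_box t w) (X_box t w).
    have [h3 _] := hf k _ _ (X_box s w) (X_box s w).
    by rewrite (le_trans (ler_normB _ _))// (mulr_natl L) mulr2n lerD.
  have [_ h2] := hf k _ _ (X_box t w) (X_box s w).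
  rewrite -real_normK ?num_real//.
  apply: (@le_trans _ _ ((L * \sum_i `|X t w i 0 - X s w i 0|) ^+ 2)).
    by rewrite lerXn2r ?nnegrE// mulr_ge0// sumr_ge0.
  rewrite exprMn -mulrA ler_wpM2l ?sqr_ge0//; apply: (le_trans (sqr_sum_le _)).
  by rewrite ler_wpM2l// ler_sum// => i _; rewrite real_normK ?num_real.
rewrite ExZ// Ex_sum//.
apply: (@le_trans _ _ (L ^+ 2 * n%:R * \sum_(i < n) (K * (t - s)))).
  by rewrite ler_wpM2l ?mulr_ge0 ?sqr_ge0// ler_sum// => i _; exact: hK.
rewrite sumr_const card_ord -(mulr_natl (K * _)).
by have -> : L ^+ 2 * n%:R * (n%:R * (K * (t - s))) = L ^+ 2 * n%:R ^+ 2 * K * (t - s) by ring.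
Qed.

(** By Cauchy-Schwarz the drift coefficient moves by the order sqrt (t - s) in mean, and this is
    integrated over a length t - s. *)
Lemma drift_remainder : exists2 K : R, 0 <= K & forall i (s t : R), 0 <= s -> s <= t -> t - s <= 1 ->
  Ex P (fun w => `|drift_part i s t w - (t - s) * b i (X s w)|) <=
  K * (Num.sqrt (t - s) * (t - s)).
Proof.
have [K K0 hK] := coef_increment_sq pb; have [L L0 hb] := poly_lipschitz_fin pb.
exists (Num.sqrt K) => // i s t s0 st h1.
have h0 : 0 <= t - s by rewrite subr_ge0.
rewrite mulrA; apply: (time_integral_dist (g := fun w r => b i (X r w)) (K := L)) => //.
- exact: jfX.
- by move=> w r; have [] := hb i _ _ (X_box r w) (X_box r w).
- exact: mfX.
- by move=> w; have [] := hb i _ _ (X_box s w) (X_box s w).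
move=> r /andP[sr rt].
have sq : sq_intg P (fun w => `|b i (X r w) - b i (X s w)|).
  apply: (@sq_intg_bounded _ _ _ _ _ (L + L)) => [|w].
    by apply: measurableT_comp => //; exact: mfD.
  rewrite normr_id (le_trans (ler_normB _ _))// lerD//.
  + by have [] := hb i _ _ (X_box r w) (X_box r w).
  + by have [] := hb i _ _ (X_box s w) (X_box s w).
have rs : r - s <= t - s by rewrite lerD2r.
have E0 : 0 <= Ex P (fun w => `|b i (X r w) - b i (X s w)|) by exact: Ex_ge0.
rewrite -[leLHS]ger0_norm// -sqrtr_sqr -sqrtrM// ler_wsqrtr//.
apply: (le_trans (sqr_Ex_le sq)).
rewrite (eq_Ex _ (g := fun w => (b i (X r w) - b i (X s w)) ^+ 2)); last first.
  by move=> w; rewrite real_normK ?num_real.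
by apply: (le_trans (hK i s r s0 sr (le_trans rs h1))); rewrite ler_wpM2l.
Qed.

Definition noise_part i s t w : R := \sum_j C i j (X s w) * (W j t w - W j s w).

Lemma noise_moments : exists2 K : R, 0 <= K & forall i (s t : R), 0 <= s -> s <= t ->
  [/\ sq_intg P (noise_part i s t), sq_intg P (fun w => noise_part i s t w ^+ 2),
      Ex P (fun w => noise_part i s t w ^+ 2) <= K * (t - s) &
      Ex P (fun w => (noise_part i s t w ^+ 2) ^+ 2) <= K * (t - s) ^+ 2].
Proof.
have [L L0 hC] := poly_lipschitz_fin (fun ij : 'I_n * 'I_n => pC ij.1 ij.2).
pose N : R := n%:R; have N0 : 0 <= N by [].
have [c c0 hc] : exists2 c : R, 0 <= c & forall j (s t : R), 0 <= s -> s <= t ->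
    Ex P (fun w => (W j t w - W j s w) ^+ 4) <= c * (t - s) ^+ 2.
  exists 1024; first exact: ler0n.
  by move=> j s t s0 st; have [] := bm_incr_moments BW j s0 st.
have [K1 K10 K1E] : exists2 K1 : R, 0 <= K1 & K1 = N * L ^+ 2.
  by exists (N * L ^+ 2) => //; rewrite mulr_ge0 ?sqr_ge0.
have K2 : 0 <= K1 ^+ 2 * N by rewrite mulr_ge0 ?sqr_ge0.
exists (K1 * N + K1 ^+ 2 * N * (N * c)).
  by rewrite addr_ge0 ?mulr_ge0.
move=> i s t s0 st; have h0 : 0 <= t - s by rewrite subr_ge0.
have CL j w : `|C i j (X s w)| <= L by have [] := hC (i, j) _ _ (X_box s w) (X_box s w).
have mom j := bm_incr_moments BW j s0 st.
have sG : sq_intg P (noise_part i s t).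
  apply: sq_intg_sum => j; have [_ _ sW _ _] := mom j.
  exact: sq_intgM_bounded (mfX s (pC i j)) (CL j) sW.
have G2 w : noise_part i s t w ^+ 2 <= K1 * \sum_j (W j t w - W j s w) ^+ 2.
  apply: (le_trans (sqr_sum_le _)); rewrite K1E -mulrA ler_wpM2l// mulr_sumr ler_sum// => j _.
  rewrite exprMn ler_wpM2r ?sqr_ge0// -real_normK ?num_real// lerXn2r ?nnegrE//.
have iW2 j : intg P (fun w => (W j t w - W j s w) ^+ 2) by have [_ _ [_ h] _ _] := mom j.
have iW4 j : intg P (fun w => ((W j t w - W j s w) ^+ 2) ^+ 2) by have [_ _ _ [_ h] _] := mom j.
have G4 w : (noise_part i s t w ^+ 2) ^+ 2 <=
    K1 ^+ 2 * N * \sum_j ((W j t w - W j s w) ^+ 2) ^+ 2.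
  apply: (@le_trans _ _ ((K1 * \sum_j (W j t w - W j s w) ^+ 2) ^+ 2)).
    rewrite lerXn2r// ?nnegrE ?sqr_ge0// mulr_ge0// sumr_ge0// => j _; exact: sqr_ge0.
  by rewrite exprMn -mulrA ler_wpM2l ?sqr_ge0//; exact: sqr_sum_le.
have mG : measurable_fun setT (noise_part i s t) by case: sG.
have mG2 : measurable_fun setT (fun w => noise_part i s t w ^+ 2) by exact: measurable_funX.
have iS4 : intg P (fun w => K1 ^+ 2 * N * \sum_j ((W j t w - W j s w) ^+ 2) ^+ 2).
  by apply: intgZ; exact: intg_sum.
have iG4 : intg P (fun w => (noise_part i s t w ^+ 2) ^+ 2).
  apply: le_intg iS4; first exact: measurable_funX.
  move=> w; rewrite ger0_norm ?sqr_ge0//.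
  by apply: (le_trans (G4 w)); exact: ler_norm.
split=> //.
- apply: (@le_trans _ _ (Ex P (fun w => K1 * \sum_j (W j t w - W j s w) ^+ 2))).
    by apply: le_Ex => //; [case: sG|apply: intgZ; exact: intg_sum].
  rewrite ExZ ?Ex_sum//; last exact: intg_sum.
  rewrite (eq_bigr (fun=> t - s)); last by move=> j _; have [_ -> _ _ _] := mom j.
  rewrite sumr_const card_ord -(mulr_natl (t - s)) mulrA ler_wpM2r// lerDl.
  by rewrite !mulr_ge0.
- apply: (@le_trans _ _ (Ex P (fun w => K1 ^+ 2 * N * \sum_j ((W j t w - W j s w) ^+ 2) ^+ 2))).
    exact: le_Ex.
  rewrite ExZ ?Ex_sum//; last exact: intg_sum.
  apply: (@le_trans _ _ (K1 ^+ 2 * N * \sum_(j < n) (c * (t - s) ^+ 2))).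
    rewrite ler_wpM2l// ler_sum// => j _.
    apply: le_trans (hc j _ _ s0 st); rewrite (eq_Ex _ (g := fun w => (W j t w - W j s w) ^+ 4))// => w.
    by rewrite -exprM.
  rewrite sumr_const card_ord -(mulr_natl (c * _)) -/N (mulrA N) mulrA.
  by rewrite ler_wpM2r ?sqr_ge0// lerDr mulr_ge0.
Qed.

(** Freezing the diffusion coefficient leaves an integrand whose square has mean of order t - s,
    integrated over a length t - s; the drift part is itself of order t - s. *)
Lemma euler_error_sq : exists2 K : R, 0 <= K & forall i (s t : R),
  0 <= s -> s <= t -> t - s <= 1 ->
  sq_intg P (fun w => X t w i 0 - X s w i 0 - noise_part i s t w) /\
  Ex P (fun w => (X t w i 0 - X s w i 0 - noise_part i s t w) ^+ 2) <= K * (t - s) ^+ 2.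
Proof.
have pC2 (ij : 'I_n * 'I_n) : poly_fun (C ij.1 ij.2) by [].
have [K K0 hb] := poly_lipschitz_fin pb; have [L L0 hC] := poly_lipschitz_fin pC2.
have [K2 K20 hK2] := coef_increment_sq pC2.
exists (2 * K ^+ 2 + 8 * n%:R ^+ 2 * K2).
  by rewrite addr_ge0// !mulr_ge0 ?sqr_ge0.
move=> i s t s0 st h1; have h0 : 0 <= t - s by rewrite subr_ge0.
pose c j w := C i j (X s w).
have Fc j : F_measurable F s (c j) by exact: F_measurable_poly.
have cL j w : `|c j w| <= L by have [] := hC (i, j) _ _ (X_box s w) (X_box s w).
have mc j : measurable_fun setT (c j) by exact: mfX.
have V j : (dbl P s t (fun w r => (C i j (X r w) - c j w) ^+ 2)%R <= (K2 * (t - s) * (t - s))%:E)%E.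
  apply: dbl_Ex_bounded => //.
  - apply: measurable_funX; apply: measurable_funB; first exact: jfX.
    exact: (measurableT_comp (mc j) measurable_fst).
  - by move=> w r; exact: sqr_ge0.
  move=> r /andP[sr rt]; have rs : r - s <= t - s by rewrite lerD2r.
  split; last first.
    by apply: (le_trans (hK2 (i, j) s r s0 sr (le_trans rs h1))); rewrite ler_wpM2l.
  apply: (intg_bounded P (M := (L + L) ^+ 2)) => [|w]; first exact/measurable_funX/mfD.
  rewrite ger0_norm ?sqr_ge0// -real_normK ?num_real// lerXn2r ?nnegrE ?addr_ge0//.
  rewrite (le_trans (ler_normB _ _))// lerD//.
  by have [] := hC (i, j) _ _ (X_box r w) (X_box r w).
have [sM EM] := martingale_part_sq s0 st Fc (fun j => ex_intro _ L (cL j)) V.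
set M := martingale_part i s t c in sM EM.
have DK w : `|drift_part i s t w| <= K * (t - s).
  apply: (time_integral_le (g := fun w r => b i (X r w))) => //; first exact: jfX.
  by move=> w' r; have [] := hb i _ _ (X_box r w') (X_box r w').
have E w : X t w i 0 - X s w i 0 - noise_part i s t w = drift_part i s t w + M w.
  by rewrite /M /martingale_part /c -/(noise_part i s t w); ring.
rewrite (funext E).
have sE : sq_intg P (fun w => drift_part i s t w + M w).
  apply: sq_intgD => //; apply: (sq_intg_bounded P (M := K * (t - s))) => //.
  exact: drift_part_meas.
split=> //; rewrite (eq_Ex _ (g := fun w => (drift_part i s t w + M w) ^+ 2)); last by move=> w; rewrite E.
have iM : intg P (fun w => M w ^+ 2) by case: sM.
apply: (@le_trans _ _ (Ex P (fun w => 2 * K ^+ 2 * (t - s) ^+ 2 + 2 * M w ^+ 2))).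
  apply: le_Ex; first by case: sE.
    by apply: intgD; [exact: intg_cst|exact: intgZ].
  move=> w.
  have D2 : drift_part i s t w ^+ 2 <= (K * (t - s)) ^+ 2.
    by rewrite -real_normK ?num_real// lerXn2r ?nnegrE// mulr_ge0.
  by rewrite exprMn in D2; have := sqr_ge0 (drift_part i s t w - M w); nra.
rewrite ExD; [|exact: intg_cst|exact: intgZ].
rewrite Ex_cst ExZ//.
by move: EM; nra.
Qed.

(** Nothing is frozen here: the whole martingale part is orthogonal to [zeta], and only the
    remainder of the drift is left. *)
Lemma euler_mean : exists2 K : R, 0 <= K & forall i (s t M : R) zeta,
  0 <= s -> s <= t -> t - s <= 1 -> F_measurable F s zeta -> (forall w, `|zeta w| <= M) ->
  `|Ex P (fun w => zeta w * (X t w i 0 - X s w i 0)) -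
    (t - s) * Ex P (fun w => zeta w * b i (X s w))| <= M * (K * (Num.sqrt (t - s) * (t - s))).
Proof.
have [K K0 hK] := drift_remainder; have [L L0 hb] := poly_lipschitz_fin pb.
have [L' L'0 hC] := poly_lipschitz_fin (fun ij : 'I_n * 'I_n => pC ij.1 ij.2).
exists K => // i s t M zeta s0 st h1 Fz zM; have h0 : 0 <= t - s by rewrite subr_ge0.
have mz := F_measurable_meas BW Fz.
have iz f : intg P f -> intg P (fun w => zeta w * f w) by exact: intgM_bounded.
pose c (j : 'I_n) (w : T) : R := 0.
have Fc j : F_measurable F s (c j) by exact: F_measurable_cst.
have cM j : exists M : R, forall w, `|c j w| <= M by exists 0 => w; rewrite normr0.
have V j : (dbl P s t (fun w r => (C i j (X r w) - c j w) ^+ 2)%R <= (L' ^+ 2 * (t - s))%:E)%E.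
  apply: dbl_bounded => //.
  - apply: measurable_funX; apply: measurable_funB; first exact: jfX.
    exact: measurable_cst.
  - by move=> w r; exact: sqr_ge0.
  move=> w r _; rewrite subr0 -real_normK ?num_real// lerXn2r ?nnegrE//.
  by have [] := hC (i, j) _ _ (X_box r w) (X_box r w).
have [sM _] := martingale_part_sq s0 st Fc cM V.
have M0 := martingale_part_mean0 s0 st Fc cM V Fz (ex_intro _ M zM).
set Mp := martingale_part i s t c in sM M0.
have mD := drift_part_meas st i.
have DK w : `|drift_part i s t w| <= L * (t - s).
  apply: (time_integral_le (g := fun w r => b i (X r w))) => //; first exact: jfX.
  by move=> w' r; have [] := hb i _ _ (X_box r w') (X_box r w').
have iD : intg P (drift_part i s t) by exact: intg_bounded mD DK.
have ib : intg P (fun w => b i (X s w)).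
  apply: (intg_bounded P (M := L)); first exact: mfX.
  by move=> w; have [] := hb i _ _ (X_box s w) (X_box s w).
have iR : intg P (fun w => drift_part i s t w - (t - s) * b i (X s w)).
  by apply: intgB => //; exact: intgZ.
have -> : Ex P (fun w => zeta w * (X t w i 0 - X s w i 0)) =
    Ex P (fun w => zeta w * drift_part i s t w) + Ex P (fun w => zeta w * Mp w).
  rewrite -ExD; [|exact: iz|by apply: iz; exact: sq_intg_intg].
  apply: eq_Ex => w; rewrite -mulrDr; congr (_ * _).
  by rewrite /Mp /martingale_part big1 => [|j _]; rewrite ?mul0r//; ring.
rewrite M0 addr0 -ExZ; last exact: iz.
rewrite -ExB; [|exact: iz|by apply: intgZ; exact: iz].
rewrite (eq_Ex _ (g := fun w => zeta w * (drift_part i s t w - (t - s) * b i (X s w)))); last first.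
  by move=> w; ring.
apply: (@le_trans _ _ (Ex P (fun w => M * `|drift_part i s t w - (t - s) * b i (X s w)|))).
  apply: ler_norm_Ex_le; [exact: iz|exact/intgZ/intg_norm|].
  by move=> w; rewrite normrM ler_wpM2r.
rewrite ExZ; last exact: intg_norm.
have [w _] := probability_inhabited P.
by rewrite ler_wpM2l ?hK// (le_trans _ (zM w)).
Qed.

Lemma noise_covariance i j (s t M : R) zeta : 0 <= s -> s <= t ->
  F_measurable F s zeta -> (forall w, `|zeta w| <= M) ->
  Ex P (fun w => zeta w * (noise_part i s t w * noise_part j s t w)) =
  (t - s) * Ex P (fun w => zeta w * \sum_k C i k (X s w) * C j k (X s w)).
Proof.
move=> s0 st Fz zM.
have [L L0 hC] := poly_lipschitz_fin (fun ij : 'I_n * 'I_n => pC ij.1 ij.2).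
have CL k l w : `|C k l (X s w)| <= L by have [] := hC (k, l) _ _ (X_box s w) (X_box s w).
pose q k l w : R := zeta w * (C i k (X s w) * C j l (X s w)).
have Fq k l : F_measurable F s (q k l).
  by apply: F_measurableM => //; apply: F_measurableM; exact: F_measurable_poly.
have M0 (w : T) : 0 <= M := le_trans (normr_ge0 _) (zM w).
have qM k l w : `|q k l w| <= M * (L * L).
  by rewrite !normrM ler_pM// ler_pM.
have mq k l := F_measurable_meas BW (Fq k l).
have sW k : sq_intg P (fun w => W k t w - W k s w) by have [_ _ h _ _] := bm_incr_moments BW k s0 st.
have iW k l : intg P (fun w => (W k t w - W k s w) * (W l t w - W l s w)) by exact: sq_intgM.
have iq k l : intg P (q k l) by exact: intg_bounded (mq k l) (qM k l).
have iqW k l : intg P (fun w => q k l w * ((W k t w - W k s w) * (W l t w - W l s w))).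
  exact: intgM_bounded (mq k l) (qM k l) (iW k l).
have Q1 w : zeta w * (noise_part i s t w * noise_part j s t w) =
    \sum_k \sum_l q k l w * ((W k t w - W k s w) * (W l t w - W l s w)).
  rewrite /noise_part mulr_suml mulr_sumr; apply: eq_bigr => k _.
  by rewrite mulr_sumr mulr_sumr; apply: eq_bigr => l _; rewrite /q; ring.
have Q2 w : zeta w * (\sum_k C i k (X s w) * C j k (X s w)) = \sum_k q k k w.
  by rewrite mulr_sumr.
rewrite (eq_Ex _ Q1) (eq_Ex _ Q2) !Ex_sum//; last by move=> k; exact: intg_sum.
rewrite mulr_sumr; apply: eq_bigr => k _.
rewrite Ex_sum// (bigD1 k)//= big1 ?addr0 => [|l lk].
  rewrite -(F_bm_var BW k s0 st (Fq k k) (qM k k)).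
  by apply: eq_Ex => w; rewrite expr2.
by apply: (F_bm_cross BW s0 st _ (Fq k l) (qM k l)); rewrite eq_sym.
Qed.

(** The increment is noise plus error, of L^2 orders e = sqrt (t - s) and e^2. The product of two
    noise parts is computed exactly by [noise_covariance]; all other products are of order e^3 or
    smaller. *)
Lemma euler_cov : exists2 K : R, 0 <= K & forall i j (s t M : R) zeta,
  0 <= s -> s < t -> t - s <= 1 -> F_measurable F s zeta -> (forall w, `|zeta w| <= M) ->
  `|Ex P (fun w => zeta w * ((X t w i 0 - X s w i 0) * (X t w j 0 - X s w j 0))) -
    (t - s) * Ex P (fun w => zeta w * \sum_k C i k (X s w) * C j k (X s w))| <=
  M * (K * (Num.sqrt (t - s) * (t - s))).
Proof.
have [K K0 hK] := noise_moments; have [K' K'0 hK'] := euler_error_sq.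
exists (2 * K + 4 * K'); first by rewrite addr_ge0// mulr_ge0.
move=> i j s t M zeta s0 st h1 Fz zM.
have st' := ltW st; have mz := F_measurable_meas BW Fz.
have iz f : intg P f -> intg P (fun w => zeta w * f w) by exact: intgM_bounded.
have h0 : 0 < t - s by rewrite subr_gt0.
pose e := Num.sqrt (t - s).
have e0 : 0 < e by rewrite sqrtr_gt0.
have ee : t - s = e * e by rewrite -expr2 sqr_sqrtr// ltW.
pose G k := noise_part k s t.
pose D k w := X t w k 0 - X s w k 0 - G k w.
have sG k : sq_intg P (G k) by have [] := hK k s t s0 st'.
have sD k : sq_intg P (D k) by have [] := hK' k s t s0 st' h1.
have G2 k : Ex P (fun w => G k w ^+ 2) <= K * (t - s) by have [] := hK k s t s0 st'.
have D2 k : Ex P (fun w => D k w ^+ 2) <= K' * (t - s) ^+ 2 by have [] := hK' k s t s0 st' h1.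
have iG2 k : intg P (fun w => G k w ^+ 2) by case: (sG k).
have iD2 k : intg P (fun w => D k w ^+ 2) by case: (sD k).
rewrite -(noise_covariance i j s0 st' Fz zM) -ExB; last 2 first.
- by apply: iz; exact: (sq_intgM (sqX i s t) (sqX j s t)).
- by apply: iz; exact: (sq_intgM (sG i) (sG j)).
pose U w := G i w * D j w + D i w * G j w + D i w * D j w.
have iU : intg P U.
  by apply: intgD; [apply: intgD|]; exact: sq_intgM.
rewrite (eq_Ex _ (g := fun w => zeta w * U w)); last first.
  by move=> w; rewrite /U /D /G; ring.
pose V w := e * (G i w ^+ 2 + G j w ^+ 2) + (e^-1 + 1) * (D i w ^+ 2 + D j w ^+ 2).
have iV : intg P V by apply: intgD; apply: intgZ; exact: intgD.
(* The weight e balances a squared noise of order e^2 against a squared error of order e^4: both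
   summands become of order e^3. *)
have AG (x y : R) : `|x * y| <= e * x ^+ 2 + e^-1 * y ^+ 2.
  have E : e * x ^+ 2 + e^-1 * y ^+ 2 = e^-1 * ((e * x) ^+ 2 + y ^+ 2).
    by field; rewrite gt_eqF.
  rewrite E ler_pdivlMl// normrM.
  have -> : e * (`|x| * `|y|) = `|e * x| * `|y| by rewrite normrM (gtr0_norm e0) mulrA.
  rewrite -(real_normK (num_real (e * x))) -(real_normK (num_real y)).
  have := sqr_ge0 (`|e * x| - `|y|); have := sqr_ge0 (`|e * x| + `|y|).
  by nra.
have UV w : `|U w| <= V w.
  apply: (le_trans (ler_normD _ _)); apply: (le_trans (lerD (ler_normD _ _) (lexx _))).
  have := AG (G i w) (D j w); rewrite (mulrC (D i w) (G j w)); have := AG (G j w) (D i w).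
  have h : `|D i w * D j w| <= D i w ^+ 2 + D j w ^+ 2.
    rewrite normrM -(real_normK (num_real (D i w))) -(real_normK (num_real (D j w))).
    have := sqr_ge0 (`|D i w| - `|D j w|); have := sqr_ge0 (`|D i w| + `|D j w|).
    by nra.
  by move: h; rewrite /V; lra.
apply: (@le_trans _ _ (Ex P (fun w => M * V w))).
  apply: ler_norm_Ex_le; [exact: iz|exact: intgZ|move=> w].
  by rewrite normrM ler_pM.
rewrite ExZ//.
have EV : Ex P V <= (2 * K + 4 * K') * (e * (t - s)).
  rewrite /V ExD; [|by apply: intgZ; exact: intgD|by apply: intgZ; exact: intgD].
  rewrite !ExZ; [|exact: intgD|exact: intgD].
  rewrite !ExD//.
  apply: (@le_trans _ _ (e * (2 * K * (e * e)) + (e^-1 + 1) * (2 * K' * (e * e) ^+ 2))).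
    apply: lerD.
      apply: ler_wpM2l; [exact: ltW|]; apply: (le_trans (lerD (G2 i) (G2 j))); rewrite ee; lra.
    apply: ler_wpM2l; [by rewrite addr_ge0// invr_ge0 ltW|].
    apply: (le_trans (lerD (D2 i) (D2 j))); rewrite ee; lra.
  have e1 : e <= 1 by rewrite -(sqrtr1 R) ler_wsqrtr.
  have -> : e * (2 * K * (e * e)) + (e^-1 + 1) * (2 * K' * (e * e) ^+ 2) =
      (2 * K + 2 * K' * (1 + e)) * (e * (e * e)).
    by field; rewrite gt_eqF.
  rewrite ee; apply: ler_wpM2r; [by rewrite mulr_ge0 ?mulr_ge0// ltW|].
  by nra.
have [w _] := probability_inhabited P.
by rewrite ler_wpM2l// (le_trans _ (zM w)).
Qed.

(** The noise has second and fourth moments of sizes e^2 and e^4, and its third absolute moment is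
    interpolated between them. The error has a second moment of size e^4 only, which is enough
    because the increment of a coordinate is at most 1. *)
Lemma euler_cube : exists2 K : R, 0 <= K & forall (s t : R),
  0 <= s -> s < t -> t - s <= 1 ->
  Ex P (fun w => (\sum_i `|X t w i 0 - X s w i 0|) ^+ 3) <=
  K * (Num.sqrt (t - s) * (t - s)).
Proof.
have [K K0 hK] := noise_moments; have [K' K'0 hK'] := euler_error_sq.
exists (2 * n%:R ^+ 2 * (n%:R * (3 * K + 3 * K'))).
  by rewrite mulr_ge0 ?mulr_ge0 ?addr_ge0 ?mulr_ge0 ?sqr_ge0.
move=> s t s0 st h1; have st' := ltW st.
have h0 : 0 < t - s by rewrite subr_gt0.
pose e := Num.sqrt (t - s).
have e0 : 0 < e by rewrite sqrtr_gt0.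
have ee : t - s = e * e by rewrite -expr2 sqr_sqrtr// ltW.
have e1 : e <= 1 by rewrite -(sqrtr1 R) ler_wsqrtr.
pose Y i w := `|X t w i 0 - X s w i 0|.
have Y0 i w : 0 <= Y i w by exact: normr_ge0.
have Y1 i w : Y i w <= 1.
  have /andP[a0 a1] := X_box t w i; have /andP[b0 b1] := X_box s w i.
  by rewrite ler_norml; apply/andP; split; lra.
have mY i : measurable_fun setT (Y i) by apply: measurableT_comp => //; exact: measurable_funB.
have iY3 i : intg P (fun w => Y i w ^+ 3).
  apply: (intg_bounded P (M := 1)) => [|w]; first exact: measurable_funX.
  by rewrite ger0_norm ?exprn_ge0// exprn_ile1.
have key i : Ex P (fun w => Y i w ^+ 3) <= (3 * K + 3 * K') * (e * (t - s)).
  have [[_ iG2] [_ iG4] G2 G4] := hK i s t s0 st'.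
  have [[_ iD2] D2] := hK' i s t s0 st' h1.
  set G := noise_part i s t in iG2 iG4 G2 G4 iD2 D2.
  pose D w := X t w i 0 - X s w i 0 - G w.
  pose V w := e * G w ^+ 2 + ((e^-1 + 1) * (G w ^+ 2) ^+ 2 + 3 * D w ^+ 2).
  have iV : intg P V by apply: intgD; [exact: intgZ|apply: intgD; exact: intgZ].
  apply: (@le_trans _ _ (Ex P V)).
    apply: le_Ex => // w; rewrite /V.
    have YD : Y i w <= `|G w| + `|D w|.
      by rewrite (_ : Y i w = `|G w + D w|) ?ler_normD// /D addrC subrK.
    have := Y0 i w; have := Y1 i w; move: YD.
    rewrite -(real_normK (num_real (G w))) -(real_normK (num_real (D w))).
    have := normr_ge0 (G w); have := normr_ge0 (D w).
    move: (Y i w) `|G w| `|D w| => y g f f0 g0 yg y1 y0.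
    have A1 : 2 * g ^+ 3 <= e * g ^+ 2 + e^-1 * (g ^+ 2) ^+ 2.
      have -> : e * g ^+ 2 + e^-1 * (g ^+ 2) ^+ 2 = e^-1 * (g ^+ 2 * (e ^+ 2 + g ^+ 2)).
        by field; rewrite gt_eqF.
      rewrite ler_pdivlMl//.
      have -> : e * (2 * g ^+ 3) = g ^+ 2 * (2 * (e * g)) by ring.
      rewrite ler_wpM2l ?sqr_ge0//.
      by have := sqr_ge0 (e - g); nra.
    have A2 : 2 * (g ^+ 2 * f) <= (g ^+ 2) ^+ 2 + f ^+ 2.
      by have := sqr_ge0 (g ^+ 2 - f); nra.
    have A3 : y ^+ 2 <= 2 * g ^+ 2 + 2 * f ^+ 2.
      apply: (@le_trans _ _ ((g + f) ^+ 2)); first by rewrite lerXn2r ?nnegrE ?addr_ge0.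
      by have := sqr_ge0 (g - f); nra.
    have A4 : y ^+ 3 <= 2 * g ^+ 2 * (g + f) + 2 * f ^+ 2.
      rewrite exprSr; apply: (le_trans (ler_wpM2r y0 A3)); rewrite mulrDl lerD//.
        by rewrite ler_wpM2l ?mulr_ge0 ?sqr_ge0.
      by rewrite ler_piMr ?mulr_ge0 ?sqr_ge0.
    apply: (le_trans A4).
    have -> : 2 * g ^+ 2 * (g + f) = 2 * g ^+ 3 + 2 * (g ^+ 2 * f) by ring.
    lra.
  rewrite ExD; [|exact: intgZ|by apply: intgD; exact: intgZ].
  rewrite ExD; [|exact: intgZ|exact: intgZ].
  rewrite !ExZ//.
  apply: (@le_trans _ _ (e * (K * (e * e)) + ((e^-1 + 1) * (K * (e * e) ^+ 2) + 3 * (K' * (e * e) ^+ 2)))).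
    rewrite -ee; apply: lerD; first by apply: ler_wpM2l => //; exact: ltW.
    apply: lerD; last by rewrite ler_wpM2l.
    by apply: ler_wpM2l => //; rewrite addr_ge0// invr_ge0 ltW.
  have -> : e * (K * (e * e)) + ((e^-1 + 1) * (K * (e * e) ^+ 2) + 3 * (K' * (e * e) ^+ 2)) =
      (2 * K + K * e + 3 * K' * e) * (e * (e * e)).
    by field; rewrite gt_eqF.
  rewrite ee; apply: ler_wpM2r; [by rewrite mulr_ge0 ?mulr_ge0// ltW|].
  by nra.
have iS3 : intg P (fun w => (\sum_i Y i w) ^+ 3).
  apply: (@le_intg _ _ _ P _ (fun w => 2 * n%:R ^+ 2 * \sum_i Y i w ^+ 3)).
  - by apply: measurable_funX; exact: measurable_sum.
  - move=> w; rewrite ger0_norm ?exprn_ge0 ?sumr_ge0//.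
    by apply: (le_trans (exp3_sum_le _)) => //; exact: ler_norm.
  - by apply: intgZ; exact: intg_sum.
apply: (@le_trans _ _ (Ex P (fun w => 2 * n%:R ^+ 2 * \sum_i Y i w ^+ 3))).
  apply: le_Ex => [//||w]; first by apply: intgZ; exact: intg_sum.
  exact: exp3_sum_le.
rewrite ExZ; last exact: intg_sum.
rewrite Ex_sum// -mulrA ler_wpM2l ?mulr_ge0 ?sqr_ge0//.
apply: (@le_trans _ _ (\sum_(i < n) ((3 * K + 3 * K') * (e * (t - s))))).
  by apply: ler_sum => i _; exact: key.
by rewrite sumr_const card_ord -(mulr_natl (_ * (e * _))) mulrA.
Qed.

Definition cov_rate i j x : R := \sum_k C i k x * C j k x.

(* The generator of the diffusion applied to [pot q eta], divided by [pot q eta]. *)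
Definition log_gen (q : 'I_n -> R) eta x : R :=
  \sum_i q i * (b i x / (x i 0 + eta))
  + 2^-1 * (\sum_i \sum_j q i * q j * (cov_rate i j x / (x i 0 + eta) / (x j 0 + eta)))
  - 2^-1 * (\sum_i q i * (cov_rate i i x / (x i 0 + eta) ^+ 2)).

Lemma F_measurable_pot q eta t : 0 <= t -> F_measurable F t (fun w => pot q eta (X t w)).
Proof.
move=> t0; apply: (F_measurable_comp (f := expR)); first exact: measurable_expR.
apply: F_measurable_sum => i; apply: F_measurableM; first exact: F_measurable_cst.
apply: (F_measurable_comp (f := @ln R)); first exact: measurable_ln.
by apply: F_measurableD; [exact: FX|exact: F_measurable_cst].
Qed.

(* The weak form of Ito's formula for one small time step.  Summed over [1 / h]
   steps the error is of order [sqrt h]. *)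
Lemma generator_estimate q eta : 0 < eta -> eta <= 1 -> exists2 K : R, 0 <= K &
  forall (s t : R) zeta, 0 <= s -> s < t -> t - s <= 1 ->
  F_measurable F s zeta -> (forall w, `|zeta w| <= 1) ->
  `|Ex P (fun w => zeta w * pot q eta (X t w)) - Ex P (fun w => zeta w * pot q eta (X s w))
    - (t - s) * Ex P (fun w => zeta w * (pot q eta (X s w) * log_gen q eta (X s w)))|
  <= K * (Num.sqrt (t - s) * (t - s)).
Proof.
move=> eta0 eta1.
have [Ka Ka0 hKa] := euler_mean; have [Kb Kb0 hKb] := euler_cov.
have [Kc Kc0 hKc] := euler_cube; have [Kp Kp0 hKp] := pot_taylor q eta0 eta1.
have [Kf Kf0 hKf] := pot_ub q eta0 eta1.
have [B B0 BE] : exists2 B : R, 0 <= B & B = Kf / eta.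
  by exists (Kf / eta) => //; rewrite divr_ge0 ?ltW.
have [B2 B20 B2E] : exists2 B : R, 0 <= B & B = Kf / eta ^+ 2.
  by exists (Kf / eta ^+ 2) => //; rewrite divr_ge0 ?exprn_ge0 ?ltW.
exists (\sum_i `|q i| * (B * Ka) + 2^-1 * (\sum_i \sum_j `|q i * q j| * (B2 * Kb))
    + 2^-1 * (\sum_i `|q i| * (B2 * Kb)) + Kp * Kc).
  rewrite !addr_ge0 ?mulr_ge0 ?sumr_ge0// => [i _|i _|i _|]; last exact: ltW.
  - by rewrite !mulr_ge0.
  - by rewrite sumr_ge0// => j _; rewrite !mulr_ge0.
  - by rewrite !mulr_ge0.
move=> s t zeta s0 st h1 Fz z1; have st' := ltW st.
set h := t - s; set H := Num.sqrt h * h.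
have mz := F_measurable_meas BW Fz.
pose f w := pot q eta (X s w).
(* The reciprocal of x_i + eta, written so that adaptedness follows by composition with [expR] and
   [ln]. *)
pose v i w := expR (- ln (X s w i 0 + eta)).
have vE i w : v i w = (X s w i 0 + eta)^-1.
  by rewrite /v expRN lnK// posrE (in_box_addr_gt0 _ eta0 (X_box s w)).
have v0 i w : 0 <= v i w by exact: expR_ge0.
have vle i w : v i w <= eta^-1.
  have /andP[x0' _] := X_box s w i.
  by rewrite vE lef_pV2 ?posrE ?lerDr// (in_box_addr_gt0 _ eta0 (X_box s w)).
have Fv i : F_measurable F s (v i).
  apply: (F_measurable_comp (f := expR)); first exact: measurable_expR.
  apply: (F_measurable_comp (f := -%R)) => //.
  apply: (F_measurable_comp (f := @ln R)); first exact: measurable_ln.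
  by apply: F_measurableD; [exact: FX|exact: F_measurable_cst].
have Ff : F_measurable F s f by exact: F_measurable_pot.
have f_ge0 w : 0 <= f w by exact/ltW/pot_gt0.
have fK w : f w <= Kf by exact: hKf.
(* [zeta] times the factors in the Taylor coefficients of [pot] at time s. Being bounded and
   measurable for [F s], these are admissible weights in [euler_mean] and [euler_cov]. *)
pose W1 i w := zeta w * f w * v i w.
pose W2 i j w := W1 i w * v j w.
have FW1 i : F_measurable F s (W1 i) by apply: F_measurableM => //; exact: F_measurableM.
have FW2 i j : F_measurable F s (W2 i j) by exact: F_measurableM.
have zf w : `|zeta w * f w| <= Kf.
  by rewrite normrM (ger0_norm (f_ge0 w)) -[leRHS]mul1r ler_pM.
have W1B i w : `|W1 i w| <= B.
  by rewrite /W1 normrM (ger0_norm (v0 i w)) BE ler_pM.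
have W2B i j w : `|W2 i j w| <= B2.
  rewrite /W2 normrM (ger0_norm (v0 j w)) B2E expr2 invfM mulrA ler_pM// -BE; exact: W1B.
have mW1 i := F_measurable_meas BW (FW1 i); have mW2 i j := F_measurable_meas BW (FW2 i j).
pose D i w := X t w i 0 - X s w i 0.
have D1 i w : `|D i w| <= 1.
  have /andP[a0 a1] := X_box t w i; have /andP[b0 b1] := X_box s w i.
  by rewrite ler_norml /D; apply/andP; split; lra.
have mD i : measurable_fun setT (D i) by exact: measurable_funB.
have iW1D i : intg P (fun w => W1 i w * D i w).
  by apply: intgM_bounded (mW1 i) (W1B i) (intg_bounded P (mD i) (D1 i)).
have DD1 i j w : `|D i w * D j w| <= 1 by rewrite normrM mulr_ile1.
have iW2D i j : intg P (fun w => W2 i j w * (D i w * D j w)).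
  by apply: intgM_bounded (mW2 i j) (W2B i j) (intg_bounded P (measurable_funM (mD i) (mD j)) (DD1 i j)).
have [Lb Lb0 hLb] := poly_lipschitz_fin pb.
have [La La0 hLa] : exists2 L : R, 0 <= L & forall ij x, in_box x -> `|cov_rate ij.1 ij.2 x| <= L.
  have pa (ij : 'I_n * 'I_n) : poly_fun (cov_rate ij.1 ij.2).
    by apply: poly_sum => k; exact: poly_mul.
  have [L L0 hL] := poly_lipschitz_fin pa; exists L => // ij x bx.
  by have [] := hL ij x x bx bx.
have ma i j : measurable_fun setT (fun w => cov_rate i j (X s w)).
  by apply: mfX; apply: poly_sum => k; exact: poly_mul.
have iW1b i : intg P (fun w => W1 i w * b i (X s w)).
  apply: intgM_bounded (mW1 i) (W1B i) (intg_bounded P (mfX s (pb i)) (M := Lb) _) => w.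
  by have [] := hLb i _ _ (X_box s w) (X_box s w).
have iW2a i j : intg P (fun w => W2 i j w * cov_rate i j (X s w)).
  by apply: intgM_bounded (mW2 i j) (W2B i j) (intg_bounded P (ma i j) (fun w => hLa (i, j) _ (X_box s w))).
have iT1 : intg P (fun w => \sum_i q i * (W1 i w * D i w)).
  by apply: intg_sum => i _; exact: intgZ.
have iT2 : intg P (fun w => \sum_i \sum_j q i * q j * (W2 i j w * (D i w * D j w))).
  by apply: intg_sum => i _; apply: intg_sum => j _; exact: intgZ.
have iT3 : intg P (fun w => \sum_i q i * (W2 i i w * (D i w * D i w))).
  by apply: intg_sum => i _; exact: intgZ.
have iS1 : intg P (fun w => \sum_i q i * (W1 i w * b i (X s w))).
  by apply: intg_sum => i _; exact: intgZ.
have iS2 : intg P (fun w => \sum_i \sum_j q i * q j * (W2 i j w * cov_rate i j (X s w))).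
  by apply: intg_sum => i _; apply: intg_sum => j _; exact: intgZ.
have iS3 : intg P (fun w => \sum_i q i * (W2 i i w * cov_rate i i (X s w))).
  by apply: intg_sum => i _; exact: intgZ.
have mf := F_measurable_meas BW Ff.
have mft : measurable_fun setT (fun w => pot q eta (X t w)).
  by apply: (F_measurable_meas BW (t := t)); apply: F_measurable_pot; exact: le_trans st'.
have if_ : intg P f.
  by apply: (intg_bounded P mf (M := Kf)) => w; rewrite ger0_norm.
have ift : intg P (fun w => pot q eta (X t w)).
  by apply: (intg_bounded P mft (M := Kf)) => w; rewrite ger0_norm ?hKf// ltW ?pot_gt0.
have izf : intg P (fun w => zeta w * f w) by exact: intgM_bounded mz z1 if_.
have izft : intg P (fun w => zeta w * pot q eta (X t w)) by exact: intgM_bounded mz z1 ift.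
pose T1 w := \sum_i q i * (W1 i w * D i w).
pose T2 w := \sum_i \sum_j q i * q j * (W2 i j w * (D i w * D j w)).
pose T3 w := \sum_i q i * (W2 i i w * (D i w * D i w)).
pose S1 w := \sum_i q i * (W1 i w * b i (X s w)).
pose S2 w := \sum_i \sum_j q i * q j * (W2 i j w * cov_rate i j (X s w)).
pose S3 w := \sum_i q i * (W2 i i w * cov_rate i i (X s w)).
(* The Taylor remainder, whose mean is estimated by [euler_cube]. *)
pose rho w := zeta w * pot q eta (X t w) - (zeta w * f w + (T1 w + (2^-1 * T2 w - 2^-1 * T3 w))).
have iTT : intg P (fun w => 2^-1 * T2 w - 2^-1 * T3 w) by apply: intgB; exact: intgZ.
have iT : intg P (fun w => T1 w + (2^-1 * T2 w - 2^-1 * T3 w)) by exact: intgD.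
have irho : intg P rho by apply: intgB => //; exact: intgD.
have iSS : intg P (fun w => 2^-1 * S2 w - 2^-1 * S3 w) by apply: intgB; exact: intgZ.
have rho_le w : `|rho w| <= Kp * (\sum_i `|X t w i 0 - X s w i 0|) ^+ 3.
  have := hKp (X s w) (X t w) (fun i => D i w * v i w) (X_box s w) (X_box t w).
  move=> /(_ (fun i => congr1 (fun y => D i w * y) (vE i w))) R1.
  apply: le_trans R1; rewrite -[leRHS]mul1r.
  apply: (@le_trans _ _ (`|zeta w| * `|pot q eta (X t w) - f w * (1 + \sum_i q i * (D i w * v i w)
      + (\sum_i q i * (D i w * v i w)) ^+ 2 / 2 - (\sum_i q i * (D i w * v i w) ^+ 2) / 2)|)).
    rewrite -normrM le_eqVlt; apply/orP; left; apply/eqP; congr `|_|.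
    have E1 : T1 w = zeta w * f w * \sum_i q i * (D i w * v i w).
      by rewrite /T1 mulr_sumr; apply: eq_bigr => i _; rewrite /W1; ring.
    have E2 : T2 w = zeta w * f w * (\sum_i q i * (D i w * v i w)) ^+ 2.
      rewrite /T2 expr2 mulr_suml mulr_sumr; apply: eq_bigr => i _.
      rewrite mulr_sumr mulr_sumr; apply: eq_bigr => j _.
      by rewrite /W2 /W1; ring.
    have E3 : T3 w = zeta w * f w * \sum_i q i * (D i w * v i w) ^+ 2.
      by rewrite /T3 mulr_sumr; apply: eq_bigr => i _; rewrite /W2 /W1; ring.
    rewrite /rho E1 E2 E3.
    move: (\sum_i q i * (D i w * v i w)) (\sum_i q i * (D i w * v i w) ^+ 2) => y1 y2.
    by field.
  by rewrite ler_wpM2r.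
have -> : Ex P (fun w => zeta w * pot q eta (X t w)) - Ex P (fun w => zeta w * pot q eta (X s w)) =
    Ex P T1 + (2^-1 * Ex P T2 - 2^-1 * Ex P T3) + Ex P rho.
  rewrite -ExB// -(ExZ _ iT2) -(ExZ _ iT3) -ExB; [|exact: intgZ|exact: intgZ].
  rewrite -ExD// -ExD//.
  by apply: eq_Ex => w; rewrite /rho -/(f w) /T2 /T3; ring.
have -> : Ex P (fun w => zeta w * (pot q eta (X s w) * log_gen q eta (X s w))) =
    Ex P S1 + (2^-1 * Ex P S2 - 2^-1 * Ex P S3).
  rewrite -(ExZ _ iS2) -(ExZ _ iS3) -ExB; [|exact: intgZ|exact: intgZ].
  rewrite -ExD//.
  apply: eq_Ex => w; rewrite /log_gen -/(f w).
  have E1 : S1 w = zeta w * f w * \sum_i q i * (b i (X s w) / (X s w i 0 + eta)).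
    by rewrite /S1 mulr_sumr; apply: eq_bigr => i _; rewrite -vE /W1; ring.
  have E2 : S2 w = zeta w * f w *
      \sum_i \sum_j q i * q j * (cov_rate i j (X s w) / (X s w i 0 + eta) / (X s w j 0 + eta)).
    rewrite /S2 mulr_sumr; apply: eq_bigr => i _; rewrite mulr_sumr; apply: eq_bigr => j _.
    by rewrite -!vE /W2 /W1; ring.
  have E3 : S3 w = zeta w * f w * \sum_i q i * (cov_rate i i (X s w) / (X s w i 0 + eta) ^+ 2).
    rewrite /S3 mulr_sumr; apply: eq_bigr => i _.
    by rewrite -exprVn -!vE /W2 /W1; ring.
  by rewrite -/(S1 w) -/(S2 w) -/(S3 w) E1 E2 E3; ring.
have N1 : `|Ex P T1 - h * Ex P S1| <= (\sum_i `|q i| * (B * Ka)) * H.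
  rewrite /T1 /S1 !Ex_sum; [|by move=> i; exact: intgZ|by move=> i; exact: intgZ].
  rewrite mulr_sumr -sumrB ?mulr_suml; apply: (le_trans (ler_norm_sum _ _ _)); apply: ler_sum => i _.
  rewrite !ExZ// mulrCA -mulrBr normrM -mulrA ler_wpM2l// -mulrA.
  exact: (hKa i s t B (W1 i) s0 st' h1 (FW1 i) (W1B i)).
have N2 : `|Ex P T2 - h * Ex P S2| <= (\sum_i \sum_j `|q i * q j| * (B2 * Kb)) * H.
  rewrite /T2 /S2 !Ex_sum; last 2 first.
  - by move=> i; apply: intg_sum => j _; exact: intgZ.
  - by move=> i; apply: intg_sum => j _; exact: intgZ.
  rewrite mulr_sumr -sumrB ?mulr_suml; apply: (le_trans (ler_norm_sum _ _ _)); apply: ler_sum => i _.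
  rewrite !Ex_sum; [|by move=> j; exact: intgZ|by move=> j; exact: intgZ].
  rewrite mulr_sumr -sumrB ?mulr_suml; apply: (le_trans (ler_norm_sum _ _ _)); apply: ler_sum => j _.
  rewrite !ExZ// mulrCA -mulrBr normrM -mulrA ler_wpM2l// -mulrA.
  exact: (hKb i j s t B2 (W2 i j) s0 st h1 (FW2 i j) (W2B i j)).
have N3 : `|Ex P T3 - h * Ex P S3| <= (\sum_i `|q i| * (B2 * Kb)) * H.
  rewrite /T3 /S3 !Ex_sum; [|by move=> i; exact: intgZ|by move=> i; exact: intgZ].
  rewrite mulr_sumr -sumrB ?mulr_suml; apply: (le_trans (ler_norm_sum _ _ _)); apply: ler_sum => i _.
  rewrite !ExZ// mulrCA -mulrBr normrM -mulrA ler_wpM2l// -mulrA.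
  exact: (hKb i i s t B2 (W2 i i) s0 st h1 (FW2 i i) (W2B i i)).
have iD3 : intg P (fun w => (\sum_i `|X t w i 0 - X s w i 0|) ^+ 3).
  apply: (intg_bounded P (M := (\sum_(i < n) 1) ^+ 3)).
    apply: measurable_funX; apply: measurable_sum => i.
    by apply: measurableT_comp => //; exact: mD.
  have S0 w : 0 <= \sum_i `|X t w i 0 - X s w i 0| by exact: sumr_ge0.
  move=> w; rewrite ger0_norm ?exprn_ge0// lerXn2r ?nnegrE// ?sumr_ge0//.
  by apply: ler_sum => i _; exact: D1.
have N4 : `|Ex P rho| <= Kp * (Kc * H).
  apply: (@le_trans _ _ (Ex P (fun w => Kp * (\sum_i `|X t w i 0 - X s w i 0|) ^+ 3))).
    by apply: ler_norm_Ex_le => //; exact: intgZ.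
  by rewrite ExZ//; apply: ler_wpM2l; [exact: ltW|exact: hKc].
move: N1 N2 N3 N4; rewrite !ler_norml.
move: (Ex P T1) (Ex P T2) (Ex P T3) (Ex P S1) (Ex P S2) (Ex P S3) (Ex P rho) => t1 t2 t3 u1 u2 u3 r.
move: (\sum_i `|q i| * (B * Ka)) (\sum_i \sum_j `|q i * q j| * (B2 * Kb)) => c1 c2.
move: (\sum_i `|q i| * (B2 * Kb)) => c3 /andP[? ?] /andP[? ?] /andP[? ?] /andP[? ?].
by apply/andP; split; lra.
Qed.

End EulerScheme.

(** * Exponential decay of power products *)

Section LogGenerator.
Context {R : realType} {n : nat}.
Variables (b beta : 'I_n -> 'cV[R]_n -> R) (C gamma : 'I_n -> 'I_n -> 'cV[R]_n -> R).
Hypotheses (bE : forall i x, b i x = x i 0 * beta i x)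
  (CE : forall i j x, C i j x = x i 0 * gamma i j x).
Hypotheses (pbeta : forall i, poly_fun (beta i))
  (pgamma : forall i j, poly_fun (gamma i j)).
Implicit Types (q : 'I_n -> R) (eta : R) (x : 'cV[R]_n).

(** What the shift leaves of the cancellation of x_i: a number in [0, 1] whose distance to 1 is eta
    / (x_i + eta). *)
Let ratio eta x i : R := x i 0 / (x i 0 + eta).
Let alpha i j x : R := \sum_k gamma i k x * gamma j k x.

Let ratio_itv eta x i : 0 < eta -> in_box x -> 0 <= ratio eta x i <= 1.
Proof.
move=> eta0 bx; have x_gt0 := in_box_addr_gt0 i eta0 bx; have /andP[x0 _] := bx i.
by rewrite divr_ge0 ?(ltW x_gt0)//= ler_pdivrMr// mul1r lerDl ltW.
Qed.

Let log_genE q eta x : 0 < eta -> in_box x -> log_gen b C q eta x =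
  \sum_i q i * (ratio eta x i * beta i x)
  + 2^-1 * (\sum_i \sum_j q i * q j * (ratio eta x i * ratio eta x j * alpha i j x))
  - 2^-1 * (\sum_i q i * (ratio eta x i ^+ 2 * alpha i i x)).
Proof.
move=> eta0 bx.
have aE i j : cov_rate C i j x = x i 0 * x j 0 * alpha i j x.
  rewrite /cov_rate mulr_sumr; apply: eq_bigr => k _; rewrite !CE; ring.
rewrite /log_gen; congr (_ + _ * _ - _ * _).
- by apply: eq_bigr => i _; rewrite bE /ratio; ring.
- by apply: eq_bigr => i _; apply: eq_bigr => j _; rewrite aE /ratio; ring.
- by apply: eq_bigr => i _; rewrite aE /ratio exprMn exprVn; ring.
Qed.

Let rates_bounded : exists B : R, [/\ 0 <= B, forall i x, in_box x -> `|beta i x| <= B &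
  forall i j x, in_box x -> `|alpha i j x| <= B].
Proof.
have pa (ij : 'I_n * 'I_n) : poly_fun (alpha ij.1 ij.2).
  by apply: poly_sum => k; exact: poly_mul.
have [K K0 hK] := poly_lipschitz_fin pbeta; have [L L0 hL] := poly_lipschitz_fin pa.
exists (K + L); split; first exact: addr_ge0.
- move=> i x bx; have [h _] := hK i x x bx bx.
  by rewrite (le_trans h)// lerDl.
- move=> i j x bx; have [h _] := hL (i, j) x x bx bx.
  by rewrite (le_trans h)// lerDr.
Qed.

(** The factors x_i of the coefficients cancel the denominators up to [ratio], so the bound is
    uniform in [eta] and holds for exponents of any sign. *)
Lemma log_gen_bounded q : exists2 K : R, 0 <= K & forall eta x, 0 < eta -> in_box x ->
  `|log_gen b C q eta x| <= K.
Proof.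
have [B [B0 hb ha]] := rates_bounded.
exists (\sum_i `|q i| * B + 2^-1 * (\sum_i \sum_j `|q i * q j| * B) + 2^-1 * (\sum_i `|q i| * B)).
  rewrite !addr_ge0 ?mulr_ge0 ?sumr_ge0// => i _; rewrite ?mulr_ge0//.
  by rewrite sumr_ge0// => j _; rewrite mulr_ge0.
move=> eta x eta0 bx; have r01 i := ratio_itv i eta0 bx.
rewrite (log_genE _ eta0 bx).
have rle (r y : R) : 0 <= r <= 1 -> `|y| <= B -> `|r * y| <= B.
  by move=> /andP[r0 r1] yB; rewrite normrM (ger0_norm r0) -[leRHS]mul1r ler_pM.
have rr i j : 0 <= ratio eta x i * ratio eta x j <= 1.
  have /andP[? ?] := r01 i; have /andP[? ?] := r01 j.
  by rewrite mulr_ge0//= mulr_ile1.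
apply: (le_trans (ler_normB _ _)); apply: lerD; first (apply: (le_trans (ler_normD _ _)); apply: lerD).
- apply: (le_trans (ler_norm_sum _ _ _)); apply: ler_sum => i _.
  by rewrite normrM ler_wpM2l// rle// hb.
- rewrite normrM ger0_norm// ler_wpM2l//.
  apply: (le_trans (ler_norm_sum _ _ _)); apply: ler_sum => i _.
  apply: (le_trans (ler_norm_sum _ _ _)); apply: ler_sum => j _.
  by rewrite normrM ler_wpM2l// rle// ha.
- rewrite normrM ger0_norm// ler_wpM2l//.
  apply: (le_trans (ler_norm_sum _ _ _)); apply: ler_sum => i _.
  by rewrite normrM ler_wpM2l// rle ?expr2// ha.
Qed.

(** With these exponents (x_j + eta)^-2 is itself a power product, so the generator estimate applies
    to it. *)
Definition inv_sq (j i : 'I_n) : R := - 2 * (i == j)%:R.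

Lemma pot_inv_sq j eta x : 0 < eta -> in_box x ->
  pot (inv_sq j) eta x = (x j 0 + eta) ^- 2.
Proof.
move=> eta0 bx; have x_gt0 := in_box_addr_gt0 j eta0 bx.
rewrite /pot (bigD1 j)//= big1 => [|i ij]; last by rewrite /inv_sq (negbTE ij) mulr0 mul0r.
rewrite /inv_sq eqxx addr0 mulr1 mulNr expRN mulr_natl -lnXn// lnK// posrE exprn_gt0//.
Qed.

(* Two conditions on the exponents [eps * p]: the quadratic term of the generator
   is dominated by the linear one, and [pot] grows at most like [1 / (x_j + eta)]. *)
Lemma log_gen_drift (p : 'I_n -> R) (delta : R) : 0 < delta ->
  (forall x, simplex x -> \sum_i p i * (beta i x - alpha i i x / 2) <= - delta) ->
  exists eps c K : R, [/\ 0 < eps, 0 < c, 0 <= K &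
    forall eta x, 0 < eta -> eta <= 1 -> simplex x ->
    pot (fun i => eps * p i) eta x * log_gen b C (fun i => eps * p i) eta x <=
    - c * pot (fun i => eps * p i) eta x + K * eta * (1 + \sum_j pot (inv_sq j) eta x)].
Proof.
move=> delta0 drift; have [B [B0 hb ha]] := rates_bounded.
have [Sp Sp0 SpE] : exists2 Sp : R, 0 <= Sp & Sp = \sum_i `|p i|.
  by exists (\sum_i `|p i|) => //; exact: sumr_ge0.
have Q1 : 0 <= Sp ^+ 2 * B / delta.
  by apply: divr_ge0; [rewrite mulr_ge0// sqr_ge0|exact: ltW].
have D0 : 0 < Sp + 1 + Sp ^+ 2 * B / delta.
  by rewrite ltr_wpDr// ltr_wpDl.
(* The reciprocal of the sum meets both constraints at once, eps Sp <= 1 and eps Sp^2 B <= delta. *)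
pose eps := (Sp + 1 + Sp ^+ 2 * B / delta)^-1.
have eps0 : 0 < eps by rewrite invr_gt0.
have eps1 : eps * Sp <= 1.
  by rewrite mulrC ler_pdivrMr// mul1r -addrA lerDl addr_ge0.
have eps2 : eps * (Sp ^+ 2 * B) <= delta.
  rewrite mulrC ler_pdivrMr//.
  rewrite [leLHS](_ : _ = delta * (Sp ^+ 2 * B / delta)); last by field; rewrite gt_eqF.
  by rewrite ler_wpM2l ?(ltW delta0)// lerDr addr_ge0.
(* The linear part contributes - eps delta and the quadratic part at most half of that with the
   opposite sign. The factor 2 in the error counts the replacement of [ratio] by 1 in the drift and
   in the diagonal term, and 2 n + 1 comes from [fSS]. *)
exists eps, (eps * delta / 2), (eps * (Sp * B) * 2 * (2 * n%:R + 1)); split => //.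
- by rewrite divr_gt0 ?mulr_gt0.
- by rewrite !mulr_ge0 ?addr_ge0 ?mulr_ge0 ?(ltW eps0).
move=> eta x eta0 eta1 sx; have bx : in_box x by case: sx.
have x_gt0 i := in_box_addr_gt0 i eta0 bx.
set f := pot _ eta x; have f0 : 0 <= f by exact/ltW/pot_gt0.
pose v i := (x i 0 + eta)^-1.
have v0 i : 0 <= v i by rewrite invr_ge0 ltW.
have [S S0 SE] : exists2 S : R, 0 <= S & S = \sum_i v i.
  by exists (\sum_i v i) => //; exact: sumr_ge0.
have rE i : 1 - ratio eta x i = eta * v i.
  by rewrite /ratio /v; field; rewrite gt_eqF.
have p_le i : `|p i| <= Sp.
  by rewrite SpE (bigD1 i)//= lerDl sumr_ge0.
have pB i y : `|y| <= B -> `|p i * y| <= Sp * B by move=> yB; rewrite normrM ler_pM.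
have A1 : \sum_i eps * p i * (ratio eta x i * beta i x) <=
    eps * (\sum_i p i * beta i x + Sp * B * (eta * S)).
  rewrite SE !mulr_sumr -big_split/= mulr_sumr; apply: ler_sum => i _.
  rewrite -mulrA ler_wpM2l ?(ltW eps0)//.
  have /andP[r0 r1] := ratio_itv i eta0 bx.
  have := pB i _ (hb i x bx); rewrite ler_norml => /andP[h1 h2].
  rewrite -rE; nra.
have A2 : 2^-1 * (\sum_i \sum_j eps * p i * (eps * p j) * (ratio eta x i * ratio eta x j * alpha i j x))
    <= 2^-1 * (eps * (eps * (Sp ^+ 2 * B))).
  rewrite ler_wpM2l//.
  apply: (@le_trans _ _ (\sum_i \sum_j eps * (eps * B) * (`|p i| * `|p j|))).
    apply: ler_sum => i _; apply: ler_sum => j _; apply: (le_trans (ler_norm _)).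
    have := ratio_itv j eta0 bx; have := ratio_itv i eta0 bx; have := ha i j x bx.
    move: (alpha i j x) (ratio eta x i) (ratio eta x j) => al ri rj alB /andP[ri0 ri1] /andP[rj0 rj1].
    rewrite !normrM (gtr0_norm eps0) (ger0_norm ri0) (ger0_norm rj0).
    have -> : eps * (eps * B) * (`|p i| * `|p j|) = eps * `|p i| * (eps * `|p j|) * (1 * B) by ring.
    rewrite ler_wpM2l ?mulr_ge0 ?(ltW eps0)//.
    by apply: ler_pM => //; [exact: mulr_ge0|exact: mulr_ile1].
  have -> : eps * (eps * (Sp ^+ 2 * B)) = eps * (eps * B) * (Sp * Sp) by ring.
  rewrite SpE mulr_suml mulr_sumr.
  by apply: ler_sum => i _; rewrite mulr_sumr mulr_sumr.
have A3 : - (2^-1 * (\sum_i eps * p i * (ratio eta x i ^+ 2 * alpha i i x))) <=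
    eps * (- (2^-1 * \sum_i p i * alpha i i x) + Sp * B * (eta * S)).
  rewrite SE -!mulrN -!sumrN !mulr_sumr -big_split/= mulr_sumr; apply: ler_sum => i _.
  rewrite -(mulrA eps) -mulrN mulrCA ler_wpM2l ?(ltW eps0)//.
  have /andP[r0 r1] := ratio_itv i eta0 bx.
  have := pB i _ (ha i i x bx); rewrite ler_norml => /andP[h1 h2].
  rewrite -rE; move: (ratio eta x i) r0 r1 (p i) (alpha i i x) h1 h2 => r r0 r1 pp aa h1 h2.
  have h3 : pp * aa * (1 - r ^+ 2) <= Sp * B * (1 - r ^+ 2).
    by rewrite ler_wpM2r// subr_ge0 exprn_ile1.
  have h4 : Sp * B * (1 - r ^+ 2) <= Sp * B * (2 * (1 - r)).
    by rewrite ler_wpM2l ?mulr_ge0//; nra.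
  lra.
have dr : \sum_i p i * beta i x - 2^-1 * \sum_i p i * alpha i i x <= - delta.
  apply: le_trans (drift x sx); rewrite mulr_sumr -sumrB le_eqVlt; apply/orP; left; apply/eqP.
  by apply: eq_bigr => i _; field.
have Lle : log_gen b C (fun i => eps * p i) eta x <=
    - (eps * delta / 2) + eps * (Sp * B) * 2 * (eta * S).
  rewrite (log_genE _ eta0 bx).
  apply: (le_trans (lerD (lerD A1 A2) A3)).
  move: dr eps2.
  move: (\sum_i p i * beta i x) (\sum_i p i * alpha i i x) (Sp * B) (Sp ^+ 2 * B) => a1 a3 SB SB2.
  move=> h1 h2.
  have h3 : eps * (a1 - 2^-1 * a3) <= eps * - delta by rewrite ler_wpM2l ?(ltW eps0).
  have h4 : eps * (eps * SB2) <= eps * delta by rewrite ler_wpM2l ?(ltW eps0).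
  lra.
have S2 : 1 <= 2 + S by lra.
have lS : 0 <= ln (2 + S) by exact: ln_ge0.
(* Every x_i + eta lies between 1 / (2 + S) and 2 + S, and the absolute values of the exponents add
   up to at most 1. *)
have fS : f <= 2 + S.
  rewrite /f /pot -[leRHS]lnK ?posrE; last by lra.
  rewrite ler_expR; apply: (@le_trans _ _ (\sum_i eps * ln (2 + S) * `|p i|)); last first.
    by rewrite -mulr_sumr -SpE mulrAC -[leRHS]mul1r ler_wpM2r.
  apply: ler_sum => i _; apply: (le_trans (ler_norm _)).
  rewrite !normrM (gtr0_norm eps0) -mulrA mulrAC -mulrA ler_wpM2l ?(ltW eps0)//.
  rewrite ler_wpM2l// ler_norml.
  have vS : v i <= S by rewrite SE (bigD1 i)//= lerDl sumr_ge0.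
  have /andP[_ x1] := bx i.
  rewrite lerNl -lnV ?posrE// !ler_ln ?posrE ?invr_gt0//; [|by lra|by lra].
  apply/andP; split; last by lra.
  by apply: (le_trans vS); lra.
have PsiE : \sum_j pot (inv_sq j) eta x = \sum_j v j ^+ 2.
  by apply: eq_bigr => j _; rewrite pot_inv_sq// exprVn.
rewrite PsiE.
have SS : S ^+ 2 <= n%:R * \sum_j v j ^+ 2 by rewrite SE; exact: sqr_sum_le.
have Psi0 : 0 <= \sum_j v j ^+ 2 by apply: sumr_ge0 => j _; exact: sqr_ge0.
have n0 : 0 <= n%:R :> R by [].
apply: (le_trans (ler_wpM2l f0 Lle)).
rewrite mulrDr [f * - _]mulrC lerD2l.
have fSS : f * S <= (2 * n%:R + 1) * (1 + \sum_j v j ^+ 2).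
  apply: (le_trans (ler_wpM2r S0 fS)).
  move: (\sum_j v j ^+ 2) SS Psi0 => Y SS Y0.
  have := sqr_ge0 (S - 1); nra.
have -> : f * (eps * (Sp * B) * 2 * (eta * S)) = eps * (Sp * B) * 2 * eta * (f * S) by ring.
have -> : eps * (Sp * B) * 2 * (2 * n%:R + 1) * eta * (1 + \sum_j v j ^+ 2) =
  eps * (Sp * B) * 2 * eta * ((2 * n%:R + 1) * (1 + \sum_j v j ^+ 2)) by ring.
by apply: ler_wpM2l fSS; rewrite !mulr_ge0 ?(ltW eps0) ?(ltW eta0).
Qed.

End LogGenerator.

(** Over N equal steps of length h the errors K h^(3/2) add up to the order sqrt h, which falls
    below any [e]. The rate [kappa] may be negative, where it yields decay; the additive terms are
    then estimated with |kappa|. *)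
Lemma gronwall_increments {R : realType} (y : R -> R) (s t kappa m K : R) :
  s <= t -> 0 <= m -> 0 <= K -> (forall u, s <= u <= t -> 0 <= y u) ->
  (forall u v, s <= u -> u < v -> v <= t -> v - u <= 1 ->
    y v <= y u + (v - u) * (kappa * y u + m) + K * (Num.sqrt (v - u) * (v - u))) ->
  y t <= expR (kappa * (t - s)) * y s + (t - s) * expR (`|kappa| * (t - s)) * m.
Proof.
rewrite le_eqVlt => /predU1P[<- _ _ _ _|st m0 K0 y0 hy].
  by rewrite subrr !mulr0 expR0 !mul0r mul1r addr0.
have tau0 : 0 < t - s by rewrite subr_gt0.
set tau := t - s in tau0 *; set E := expR (`|kappa| * tau).
have E0 : 0 < E by exact: expR_gt0.
apply/ler_addgt0Pr => e e0.
have D0 : 0 < tau * E * K + 1 by rewrite ltr_wpDl// !mulr_ge0// ltW.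
pose del := e / (tau * E * K + 1).
have del0 : 0 < del by exact: divr_gt0.
(* The first summand ensures h <= 1 and the second sqrt h <= del. *)
pose N := (Num.truncn (tau + tau / del ^+ 2)).+1.
have d20 : 0 < tau / del ^+ 2 by rewrite divr_gt0// exprn_gt0.
have NE : tau + tau / del ^+ 2 < N%:R by rewrite truncnS_gt.
have N0 : 0 < N%:R :> R by rewrite ltr0n.
pose h := tau / N%:R.
have h0 : 0 < h by exact: divr_gt0.
have Nh : N%:R * h = tau by rewrite mulrC divfK// gt_eqF.
have h1 : h <= 1 by rewrite ler_pdivrMr// mul1r; lra.
have hd : Num.sqrt h <= del.
  rewrite -[leRHS](ger0_norm (ltW del0)) -sqrtr_sqr ler_wsqrtr// ler_pdivrMr//.
  rewrite -ler_pdivrMl ?exprn_gt0// mulrC; lra.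
pose a := h * m + K * (Num.sqrt h * h).
have a0 : 0 <= a by rewrite addr_ge0// !mulr_ge0// ltW.
have ind k : (k <= N)%N -> y (s + k%:R * h) <=
    expR (kappa * (k%:R * h)) * y s + k%:R * expR (`|kappa| * (k%:R * h)) * a.
  elim: k => [_|k IH kN]; first by rewrite mulr0n !mul0r !mulr0 expR0 mul1r !addr0.
  have {}IH := IH (ltnW kN).
  have k0 : 0 <= k%:R :> R by [].
  have kE : k.+1%:R = k%:R + 1 :> R by rewrite -natr1.
  have kN' : k%:R + 1 <= N%:R :> R by rewrite -kE ler_nat.
  have kh : (k%:R + 1) * h <= tau by rewrite -Nh ler_wpM2r// ltW.
  have su : s <= s + k%:R * h by rewrite lerDl mulr_ge0// ltW.
  have vE : (s + k.+1%:R * h) - (s + k%:R * h) = h by rewrite kE; ring.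
  have tE : t = s + tau by rewrite /tau; ring.
  have := hy (s + k%:R * h) (s + k.+1%:R * h) su; rewrite vE => /(_ _ _ h1).
  move=> /(_ ltac:(by rewrite -subr_gt0 vE) ltac:(by rewrite tE kE lerD2l)) step.
  have yk0 : 0 <= y (s + k%:R * h).
    apply: y0; rewrite su/= tE lerD2l; apply: le_trans kh.
    by rewrite ler_wpM2r ?lerDl// ltW.
  apply: (le_trans step).
  have e1 : 1 + kappa * h <= expR (kappa * h) by exact: expR_ge1Dx.
  have e2 : expR (kappa * h) <= expR (`|kappa| * h).
    by rewrite ler_expR ler_wpM2r ?ler_norm// ltW.
  have e3 : 1 <= expR (`|kappa| * (k.+1%:R * h)).
    by rewrite -expR0 ler_expR !mulr_ge0// ltW.
  have e4 : expR (kappa * (k.+1%:R * h)) = expR (kappa * h) * expR (kappa * (k%:R * h)).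
    by rewrite -expRD kE; congr expR; ring.
  have e5 : expR (`|kappa| * (k.+1%:R * h)) = expR (`|kappa| * h) * expR (`|kappa| * (k%:R * h)).
    by rewrite -expRD kE; congr expR; ring.
  have -> : y (s + k%:R * h) + h * (kappa * y (s + k%:R * h) + m) + K * (Num.sqrt h * h) =
      (1 + kappa * h) * y (s + k%:R * h) + a by rewrite /a; ring.
  apply: (@le_trans _ _ (expR (kappa * h) * y (s + k%:R * h) + a)).
    by rewrite lerD2r ler_wpM2r.
  apply: (@le_trans _ _ (expR (kappa * h) * (expR (kappa * (k%:R * h)) * y s +
      k%:R * expR (`|kappa| * (k%:R * h)) * a) + a)).
    by rewrite lerD2r ler_wpM2l ?expR_ge0.
  rewrite mulrDr mulrA -e4 -addrA lerD2l kE [in leRHS]mulrDl mul1r [in leRHS]mulrDl.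
  apply: lerD; last by rewrite -[leLHS]mul1r ler_wpM2r// -kE.
  rewrite -!mulrA [leLHS]mulrCA ler_wpM2l// mulrA ler_wpM2r// -kE e5.
  by rewrite ler_wpM2r ?expR_ge0.
have := ind N (leqnn N); rewrite Nh -/E.
have -> : s + tau = t by rewrite /tau; ring.
move=> /le_trans; apply; rewrite -addrA lerD2l.
have -> : N%:R * E * a = E * ((N%:R * h) * m + K * (Num.sqrt h * (N%:R * h))) by rewrite /a; ring.
rewrite Nh.
have h3 : tau * E * K * Num.sqrt h <= tau * E * K * del.
  by rewrite ler_wpM2l// !mulr_ge0// ltW.
have h4 : tau * E * K * del <= e.
  rewrite /del mulrCA -[leRHS]mulr1 ler_wpM2l ?(ltW e0)// ler_pdivrMr// mul1r; lra.
by move: h3 h4; move: (Num.sqrt h) => q; nra.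
Qed.

Section Moments.
Context {d : measure_display} {T : measurableType d} {R : realType}.
Variables (P : probability T R) (n : nat) (W : 'I_n -> R -> T -> R).
Hypothesis BW : standard_brownian_motion P W.
Local Notation F := (brownian_filtration P W).
Variables (b beta : 'I_n -> 'cV[R]_n -> R) (C gamma : 'I_n -> 'I_n -> 'cV[R]_n -> R).
Hypotheses (bE : forall i x, b i x = x i 0 * beta i x)
  (CE : forall i j x, C i j x = x i 0 * gamma i j x).
Hypotheses (pbeta : forall i, poly_fun (beta i))
  (pgamma : forall i j, poly_fun (gamma i j)).
Variables (x0 : 'cV[R]_n) (X : R -> T -> 'cV[R]_n).
Hypotheses (x0_int : int_simplex x0) (X_simplex : forall r w, simplex (X r w))
  (FX : forall (t : R) i, 0 <= t -> F_measurable F t (fun w => X t w i 0))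
  (X_0 : {ae P, forall w, X 0 w = x0}).
Hypothesis generator : forall q (eta : R), 0 < eta -> eta <= 1 -> exists2 K : R, 0 <= K &
  forall (s t : R) zeta, 0 <= s -> s < t -> t - s <= 1 ->
  F_measurable F s zeta -> (forall w, `|zeta w| <= 1) ->
  `|Ex P (fun w => zeta w * pot q eta (X t w)) - Ex P (fun w => zeta w * pot q eta (X s w))
    - (t - s) * Ex P (fun w => zeta w * (pot q eta (X s w) * log_gen b C q eta (X s w)))|
  <= K * (Num.sqrt (t - s) * (t - s)).

Let X_box r w : in_box (X r w). Proof. by case: (X_simplex r w). Qed.

Let mX (t : R) i : 0 <= t -> measurable_fun setT (fun w => X t w i 0).
Proof. by move=> t0; exact: (F_measurable_meas BW (FX i t0)). Qed.

Lemma intg_pot q eta (t : R) : 0 < eta -> eta <= 1 -> 0 <= t ->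
  intg P (fun w => pot q eta (X t w)).
Proof.
move=> eta0 eta1 t0; have [K K0 hK] := pot_ub q eta0 eta1.
apply: (intg_bounded P (M := K)) => [|w].
  exact: (F_measurable_meas BW (F_measurable_pot FX q eta t0)).
by rewrite ger0_norm ?hK// ltW ?pot_gt0.
Qed.

Let mlog_gen q eta (t : R) : 0 < eta -> 0 <= t ->
  measurable_fun setT (fun w => log_gen b C q eta (X t w)).
Proof.
move=> eta0 t0.
have mv i : measurable_fun setT (fun w => (X t w i 0 + eta)^-1).
  rewrite (_ : (fun w => _) = (fun w => expR (- ln (X t w i 0 + eta)))); last first.
    by apply/funext => w; rewrite expRN lnK// posrE in_box_addr_gt0.
  apply: (F_measurable_meas BW (t := t)).
  apply: (F_measurable_comp (f := fun y => expR (- ln y))); last first.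
    by apply: F_measurableD; [exact: FX|exact: F_measurable_cst].
  by apply: measurableT_comp => //; apply: measurableT_comp => //; exact: measurable_ln.
have mp f : poly_fun f -> measurable_fun setT (fun w => f (X t w)).
  by move=> pf; apply: poly_meas => // i; exact: mX.
have pc i j : poly_fun (cov_rate C i j).
  apply: poly_sum => k; apply: poly_mul; rewrite (funext (CE _ _)).
    by apply: poly_mul; [exact: poly_coord|].
  by apply: poly_mul; [exact: poly_coord|].
have pb i : poly_fun (b i).
  by rewrite (funext (bE i)); apply: poly_mul; [exact: poly_coord|].
apply: measurable_funB; first apply: measurable_funD.
- apply: measurable_sum => i; apply: measurable_funM => //; apply: measurable_funM => //.
  exact: mp.
- apply: measurable_funM => //; apply: measurable_sum => i; apply: measurable_sum => j.
  apply: measurable_funM => //; apply: measurable_funM => //; apply: measurable_funM => //.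
  exact: mp.
- apply: measurable_funM => //; apply: measurable_sum => i.
  apply: measurable_funM => //; apply: measurable_funM => //; first exact: mp.
  by under eq_fun do rewrite -exprVn; exact: measurable_funX.
Qed.

Let intg_gen q eta (t : R) (zeta : T -> R) : 0 < eta -> eta <= 1 -> 0 <= t ->
  measurable_fun setT zeta -> (forall w, `|zeta w| <= 1) ->
  intg P (fun w => zeta w * (pot q eta (X t w) * log_gen b C q eta (X t w))).
Proof.
move=> eta0 eta1 t0 mz z1; apply: (intgM_bounded mz z1).
have [K K0 hK] := log_gen_bounded bE CE pbeta pgamma q.
under eq_fun do rewrite mulrC.
apply: (@intgM_bounded _ _ _ _ _ _ K) => [|w|]; first exact: mlog_gen.
  exact: hK.
exact: intg_pot.
Qed.

(** Gronwall, with a bound of [log_gen] as rate. Since x0 is interior, the initial value (x0_j +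
    eta)^-2 is at most x0_j^-2, which makes the result uniform in [eta]. *)
Lemma inv_sq_moment (t1 : R) : exists2 M : R, 0 <= M & forall eta t : R,
  0 < eta -> eta <= 1 -> 0 <= t -> t <= t1 ->
  Ex P (fun w => \sum_j pot (inv_sq j) eta (X t w)) <= M.
Proof.
have /choice[K hK] : forall j : 'I_n, exists K : R, 0 <= K /\
    forall eta x, 0 < eta -> in_box x -> `|log_gen b C (inv_sq j) eta x| <= K.
  by move=> j; have [K K0 h] := log_gen_bounded bE CE pbeta pgamma (inv_sq j); exists K.
have x0_gt0 j : 0 < x0 j 0 by case: x0_int.
have x0_box : in_box x0 by case: x0_int => -[].
exists (\sum_j expR (K j * t1) * (x0 j 0) ^- 2).
  by apply: sumr_ge0 => j _; rewrite mulr_ge0 ?expR_ge0// invr_ge0 exprn_ge0// ltW.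
move=> eta t eta0 eta1 t0 tt1; rewrite Ex_sum; last by move=> j; exact: intg_pot.
apply: ler_sum => j _; have [K0 hKj] := hK j.
have [L L0 hL] := generator (inv_sq j) eta0 eta1.
pose y u := Ex P (fun w => pot (inv_sq j) eta (X u w)).
have pge0 x : 0 <= pot (inv_sq j) eta x by exact/ltW/pot_gt0.
have yge0 u : 0 <= y u by exact: Ex_ge0.
apply: (le_trans (@gronwall_increments R y 0 t (K j) 0 L t0 (lexx 0) L0 (fun u _ => yge0 u) _)); last first.
  rewrite [X in _ + X <= _]mulr0 addr0 subr0.
  apply: ler_pM; rewrite ?expR_ge0 ?ler_expR ?ler_wpM2l//.
  rewrite /y (@ae_eq_Ex _ _ _ P _ (fun=> pot (inv_sq j) eta x0))//; last 2 first.
  - exact: (intg_meas (intg_pot (inv_sq j) eta0 eta1 (lexx 0))).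
  - by apply: filterS X_0 => w ->.
  rewrite Ex_cst pot_inv_sq// lef_pV2 ?posrE ?exprn_gt0 ?addr_gt0//.
  by rewrite lerXn2r ?nnegrE ?addr_ge0 ?ltW// ltrDl.
move=> u v u0 uv vt vu1.
have v0 : 0 <= v by rewrite (le_trans u0)// ltW.
have n1 (w : T) : `|1 : R| <= 1 by rewrite normr1.
have Fc : F_measurable F u (fun=> 1 : R) by exact: F_measurable_cst.
have := hL u v (fun=> 1) u0 uv vu1 Fc n1.
rewrite (eq_Ex _ (g := fun w => pot (inv_sq j) eta (X v w))); last by move=> w; rewrite mul1r.
rewrite (eq_Ex (f := fun w => 1 * pot _ _ _) _ (g := fun w => pot (inv_sq j) eta (X u w))); last by move=> w; rewrite mul1r.
rewrite -/(y u) -/(y v) ler_norml => /andP[_].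
rewrite lerBlDr lerBlDr => /le_trans; apply.
have swap (a1 a2 a3 : R) : a1 + a2 + a3 = a3 + a2 + a1 by ring.
rewrite [leLHS]swap lerD2r lerD2l addr0 ler_wpM2l ?subr_ge0 ?(ltW uv)//.
rewrite -ExZ; last exact: intg_pot.
apply: le_Ex => [||w].
- exact: intg_gen.
- by apply: intgZ; exact: intg_pot.
rewrite mul1r mulrC ler_wpM2r//; apply: le_trans (hKj eta (X u w) eta0 (X_box u w)).
exact: ler_norm.
Qed.

(** The rate c is fixed before the horizon t1. Only the error constant depends on t1, and its factor
    [eta] can tend to 0 on each fixed grid. *)
Lemma pot_decay (p : 'I_n -> R) (delta : R) : 0 < delta ->
  (forall x, simplex x ->
     \sum_i p i * (beta i x - (\sum_k gamma i k x * gamma i k x) / 2) <= - delta) ->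
  exists eps c : R, [/\ 0 < eps, 0 < c &
    forall t1 : R, 0 <= t1 -> exists2 K : R, 0 <= K &
    forall (eta s t : R) zeta, 0 < eta -> eta <= 1 -> 0 <= s -> s <= t -> t <= t1 ->
    F_measurable F s zeta -> (forall w, 0 <= zeta w <= 1) ->
    Ex P (fun w => zeta w * pot (fun i => eps * p i) eta (X t w)) <=
    expR (- c * (t - s)) * Ex P (fun w => zeta w * pot (fun i => eps * p i) eta (X s w))
    + K * eta].
Proof.
move=> delta0 drift.
have [eps [c [K [eps0 c0 K0 hK]]]] := log_gen_drift bE CE pbeta pgamma delta0 drift.
exists eps, c; split=> // t1 t10; have [M M0 hM] := inv_sq_moment t1.
exists (t1 * expR (`|- c| * t1) * (K * (1 + M))).
  by rewrite !mulr_ge0 ?expR_ge0 ?addr_ge0.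
move=> eta s t zeta eta0 eta1 s0 st tt1 Fz z01.
have mz := F_measurable_meas BW Fz.
have zn w : `|zeta w| <= 1 by have /andP[z0 z1] := z01 w; rewrite ger0_norm.
set q := fun i => eps * p i in hK *.
have [L L0 hL] := generator q eta0 eta1.
pose y u := Ex P (fun w => zeta w * pot q eta (X u w)).
have pge0 q' x : 0 <= pot q' eta x by exact/ltW/pot_gt0.
have yge0 u : 0 <= y u.
  by apply: Ex_ge0 => w; rewrite mulr_ge0//; case/andP: (z01 w).
have m0 : 0 <= K * eta * (1 + M) by rewrite !mulr_ge0 ?(ltW eta0) ?addr_ge0.
have := @gronwall_increments R y s t (- c) (K * eta * (1 + M)) L st m0 L0 (fun u _ => yge0 u).
move=> /(_ _)/le_trans; apply; last first.
  rewrite lerD2l.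
  have -> : t1 * expR (`|- c| * t1) * (K * (1 + M)) * eta =
    t1 * expR (`|- c| * t1) * (K * eta * (1 + M)) by ring.
  rewrite ler_wpM2r//; have tst : t - s <= t1 by lra.
  by rewrite ler_pM ?expR_ge0 ?subr_ge0// ler_expR ler_wpM2l.
move=> u v su uv vt vu1.
have u0 : 0 <= u by exact: le_trans su.
have ut1 : u <= t1 by rewrite (le_trans (ltW uv))// (le_trans vt).
have iz f : intg P f -> intg P (fun w => zeta w * f w) by exact: intgM_bounded.
have := hL u v zeta u0 uv vu1 (F_measurable_le su Fz) zn.
rewrite -/(y u) -/(y v) ler_norml => /andP[_].
rewrite lerBlDr lerBlDr => /le_trans; apply.
have swap (a1 a2 a3 : R) : a1 + a2 + a3 = a3 + a2 + a1 by ring.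
rewrite [leLHS]swap lerD2r lerD2l ler_wpM2l ?subr_ge0 ?(ltW uv)//.
have iS : intg P (fun w => \sum_j pot (inv_sq j) eta (X u w)).
  by apply: intg_sum => j _; exact: intg_pot.
have i1S : intg P (fun w => 1 + \sum_j pot (inv_sq j) eta (X u w)).
  by apply: intgD => //; exact: intg_cst.
have izf : intg P (fun w => zeta w * pot q eta (X u w)) by apply: iz; exact: intg_pot.
apply: (@le_trans _ _ (Ex P (fun w => - c * (zeta w * pot q eta (X u w)) +
    K * eta * (1 + \sum_j pot (inv_sq j) eta (X u w))))).
  apply: le_Ex => [||w]; [exact: intg_gen|by apply: intgD; exact: intgZ|].
  have /andP[z0 z1] := z01 w.
  apply: (le_trans (ler_wpM2l z0 (hK eta (X u w) eta0 eta1 (X_simplex u w)))).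
  rewrite mulrDr mulrCA lerD2l -[leRHS]mul1r ler_wpM2r//.
  by rewrite !mulr_ge0 ?(ltW eta0)// addr_ge0// sumr_ge0.
rewrite ExD; [|exact: intgZ|exact: intgZ].
rewrite !ExZ// lerD2l ler_wpM2l ?mulr_ge0 ?(ltW eta0)//.
rewrite ExD//; last exact: intg_cst.
by rewrite Ex_cst lerD2l; exact: hM.
Qed.

End Moments.

(** * Almost sure convergence *)

Section Hitting.
Context {d : measure_display} {T : measurableType d} {R : realType}.
Variables (P : probability T R) (n : nat) (W : 'I_n -> R -> T -> R).
Hypothesis BW : standard_brownian_motion P W.
Local Notation F := (brownian_filtration P W).
Variables (x0 : 'cV[R]_n) (X : R -> T -> 'cV[R]_n).
Hypotheses (x0_int : int_simplex x0) (X_simplex : forall r w, simplex (X r w))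
  (X_cont : forall i w, continuous (fun r => X r w i 0))
  (FX : forall (t : R) i, 0 <= t -> F_measurable F t (fun w => X t w i 0))
  (X_0 : {ae P, forall w, X 0 w = x0}).
Variables (q : 'I_n -> R) (c : R).
Hypothesis c0 : 0 < c.
Hypothesis decay : forall t1 : R, 0 <= t1 -> exists2 K : R, 0 <= K &
  forall (eta s t : R) zeta, 0 < eta -> eta <= 1 -> 0 <= s -> s <= t -> t <= t1 ->
  F_measurable F s zeta -> (forall w, 0 <= zeta w <= 1) ->
  Ex P (fun w => zeta w * pot q eta (X t w)) <=
  expR (- c * (t - s)) * Ex P (fun w => zeta w * pot q eta (X s w)) + K * eta.

Let X_box r w : in_box (X r w). Proof. by case: (X_simplex r w). Qed.

Section Level.
Variable mu : R.
Hypothesis mu0 : 0 < mu.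

Definition above (x : 'cV[R]_n) : bool := [forall i, (0 < q i) ==> (mu < x i 0)].

(** A lower bound of [pot] on [above], uniform in [eta <= 1]: bases with positive exponent exceed
    mu, and those with nonpositive exponent are at most 2. *)
Definition above_pot : R := expR (\sum_i q i * (if 0 < q i then ln mu else ln 2)).

Lemma above_pot_le eta x : 0 < eta -> eta <= 1 -> in_box x -> above x ->
  above_pot <= pot q eta x.
Proof.
move=> eta0 eta1 bx /forallP ax; rewrite ler_expR; apply: ler_sum => i _.
have x_gt0 := in_box_addr_gt0 i eta0 bx.
case: ifPn => [qi|]; [|rewrite -leNgt => qi].
  rewrite ler_wpM2l ?(ltW qi)// ler_ln ?posrE//.
  by have := ax i; rewrite qi/= => /ltW h; rewrite (le_trans h)// lerDl ltW.
rewrite ler_wnM2l// ler_ln ?posrE//.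
by have /andP[_ h] := bx i; lra.
Qed.

Let F_measurable_prod t I (r : seq I) (Q : pred I) (f : I -> T -> R) :
  (forall i, Q i -> F_measurable F t (f i)) ->
  F_measurable F t (fun w => \prod_(i <- r | Q i) f i w).
Proof.
move=> h; elim: r => [|i r IH].
  by under eq_fun do rewrite big_nil; exact: F_measurable_cst.
under eq_fun do rewrite big_cons.
case Qi: (Q i) => //.
by apply: F_measurableM => //; exact: h.
Qed.

Lemma F_measurable_above t : 0 <= t -> F_measurable F t (fun w => (above (X t w))%:R : R).
Proof.
move=> t0.
rewrite (_ : (fun w => _) = (fun w => \prod_(i | 0 < q i) \1_(`]mu, +oo[%classic) (X t w i 0))).
  apply: F_measurable_prod => i _; apply: (F_measurable_comp (f := \1_(`]mu, +oo[%classic))).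
    exact: measurable_indic.
  exact: FX.
apply/funext => w; rewrite /above.
have E i : \1_(`]mu, +oo[%classic) (X t w i 0) = (mu < X t w i 0)%R%:R :> R.
  by rewrite indicE mem_setE in_itv/= andbT.
case: forallP => h.
  by rewrite big1// => i qi; rewrite E; have := h i; rewrite qi/= => ->.
move: h => /forallP; rewrite negb_forall => /existsP[i]; rewrite negb_imply => /andP[qi xi].
by rewrite (bigD1 i)//= E (negbTE xi) mul0r.
Qed.

(** The indicator that [above] fails at all grid points with index below k. As a product of adapted
    factors in [0, 1] it is admissible as [zeta]. *)
Let survival (t : nat -> R) k w : R := \prod_(j < k) (1 - (above (X (t j) w))%:R).

Let survival_itv t k w : 0 <= survival t k w <= 1.
Proof.
have h (b : bool) : 0 <= (1 - b%:R : R) <= 1.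
  by case: b; rewrite ?subrr ?subr0 ?lexx ?ler01.
rewrite prodr_ge0 => [|j _]; last by case/andP: (h (above (X (t j) w))).
by rewrite prodr_ile1// => j _.
Qed.

Let survivalS t k w :
  survival t k.+1 w = survival t k w * (1 - (above (X (t k) w))%:R).
Proof. by rewrite /survival big_ord_recr. Qed.

Let F_survival t k s : 0 <= t 0 -> {homo t : j l / (j <= l)%N >-> j <= l} ->
  (forall j, (j < k)%N -> t j <= s) -> F_measurable F s (survival t k).
Proof.
move=> t0 th ts; apply: F_measurable_prod => j _.
apply: (F_measurable_comp (f := fun x => 1 - x)); first exact: measurable_funB.
have tj : 0 <= t j by rewrite (le_trans t0)// th.
by apply: (F_measurable_le (ts j (ltn_ord j))); exact: F_measurable_above.
Qed.

(* The bound on the initial value does not depend on the regularisation [eta],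
   since [x0] is an interior point. *)
Definition pot0_bound : R := expR (\sum_i `|q i| * (ln 2 + `|ln (x0 i 0)|)).

Let pot0_le eta : 0 < eta -> eta <= 1 -> Ex P (fun w => pot q eta (X 0 w)) <= pot0_bound.
Proof.
move=> eta0 eta1; have x0_box : in_box x0 by case: x0_int => -[].
rewrite (@ae_eq_Ex _ _ _ P _ (fun=> pot q eta x0))//; last 2 first.
- exact: (intg_meas (intg_pot BW X_simplex FX q eta0 eta1 (lexx 0))).
- by apply: filterS X_0 => w ->.
rewrite Ex_cst ler_expR; apply: ler_sum => i _; apply: (le_trans (ler_norm _)).
rewrite normrM ler_wpM2l// ler_norml.
have xi0 : 0 < x0 i 0 by case: x0_int.
have /andP[_ xi1] := x0_box i.
have l2 : 0 <= ln 2 :> R by rewrite ln_ge0// ler1n.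
have h1 : ln (x0 i 0) <= ln (x0 i 0 + eta) by rewrite ler_ln ?posrE ?addr_gt0// lerDl ltW.
have h2 : ln (x0 i 0 + eta) <= ln 2 by rewrite ler_ln ?posrE ?addr_gt0//; lra.
have := ler_norm (ln (x0 i 0)); have := ler_norm (- ln (x0 i 0)); rewrite normrN => h3 h4.
by apply/andP; split; lra.
Qed.

(* Doob's maximal inequality on a finite time grid: [pot] is a supermartingale up
   to errors proportional to [eta], and it is at least [above_pot] where [above]
   holds. *)
Lemma survival_bound (t : nat -> R) m : 0 <= t 0 ->
  {homo t : j l / (j <= l)%N >-> j <= l} ->
  above_pot * (1 - Ex P (survival t m)) <= expR (- c * t 0) * pot0_bound.
Proof.
move=> t0 th.
have tge0 k : 0 <= t k by rewrite (le_trans t0)// th.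
have [K K0 hK] := decay (tge0 m).
have lam0 : 0 < above_pot by exact: expR_gt0.
have mS k : measurable_fun setT (survival t k).
  apply: (F_measurable_meas BW (t := t k)); apply: F_survival => // j /ltnW jk; exact: th.
have Sn k w : `|survival t k w| <= 1.
  by have /andP[h0 h1] := survival_itv t k w; rewrite ger0_norm.
have iS k : intg P (survival t k) by exact: intg_bounded (mS k) (Sn k).
(* There are m steps of the grid and one from time 0 to [t 0], each with error K * eta. *)
have key eta : 0 < eta -> eta <= 1 ->
    above_pot * (1 - Ex P (survival t m)) <= expR (- c * t 0) * pot0_bound + (m.+1)%:R * K * eta.
  move=> eta0 eta1.
  pose f k w := pot q eta (X (t k) w).
  have iF k : intg P (f k) by exact: (intg_pot BW X_simplex FX).
  have iSf j k : intg P (fun w => survival t j w * f k w) by exact: intgM_bounded (mS j) (Sn j) (iF k).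
  have f0 k w : 0 <= f k w by exact/ltW/pot_gt0.
  (* The mass stopped so far is valued at [above_pot], the surviving mass at [pot]. Stopping at a
     grid time replaces [pot] by the smaller [above_pot] ([h1]); between grid times the surviving
     part grows by at most K * eta ([h2]). *)
  have ind k : (k <= m)%N -> above_pot * (1 - Ex P (survival t k)) +
      Ex P (fun w => survival t k w * f k w) <= Ex P (f 0%N) + k%:R * K * eta.
    elim: k => [_|k IH km].
      rewrite (eq_Ex _ (f := survival t 0) (g := fun=> 1)); last by move=> w; rewrite /survival big_ord0.
      rewrite Ex_cst subrr mulr0 add0r mulr0n !mul0r addr0.
      rewrite (eq_Ex _ (g := f 0%N)) => [|w]; first exact: lexx.
      by rewrite /survival big_ord0 mul1r.
    have {}IH := IH (ltnW km).
    have h1 : above_pot * (Ex P (survival t k) - Ex P (survival t k.+1)) +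
        Ex P (fun w => survival t k.+1 w * f k w) <= Ex P (fun w => survival t k w * f k w).
      rewrite -ExB// -ExZ; last exact: intgB.
      rewrite -ExD//; last by apply: intgZ; exact: intgB.
      apply: le_Ex => // [|w]; first by apply: intgD => //; apply: intgZ; exact: intgB.
      rewrite survivalS; have /andP[s0 s1] := survival_itv t k w.
      case ab: (above (X (t k) w)); last by rewrite subr0 mulr1 subrr mulr0 add0r.
      rewrite /= subrr mulr0 subr0 mul0r addr0 mulrC ler_wpM2l//.
      exact: above_pot_le.
    have h2 : Ex P (fun w => survival t k.+1 w * f k.+1 w) <=
        Ex P (fun w => survival t k.+1 w * f k w) + K * eta.
      have tk : t k <= t k.+1 by exact: th.
      have Fk : F_measurable F (t k) (survival t k.+1).
        by apply: F_survival => // j; rewrite ltnS => jk; exact: th.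
      apply: (le_trans (hK eta (t k) (t k.+1) _ eta0 eta1 (tge0 k) tk (th _ _ km) Fk (survival_itv t k.+1))).
      rewrite lerD2r -[leRHS]mul1r ler_wpM2r//.
        by apply: Ex_ge0 => w; apply: mulr_ge0; [case/andP: (survival_itv t k.+1 w)|exact: f0].
      by rewrite -expR0 ler_expR mulNr oppr_le0 mulr_ge0 ?subr_ge0// ltW.
    rewrite -natr1; move: IH h1 h2.
    move: (Ex P (survival t k)) (Ex P (survival t k.+1)) (Ex P (f 0%N)) => e1 e2 e3.
    move: (Ex P (fun w => survival t k w * f k w)) => a1.
    move: (Ex P (fun w => survival t k.+1 w * f k w)) => a2.
    move: (Ex P (fun w => survival t k.+1 w * f k.+1 w)) => a3.
    move: above_pot => lam IH h1 h2; lra.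
  have h0 : Ex P (f 0%N) <= expR (- c * t 0) * pot0_bound + K * eta.
    have F1 : F_measurable F 0 (fun=> 1 : R) by exact: F_measurable_cst.
    have z1 (w : T) : 0 <= (1 : R) <= 1 by rewrite ler01 lexx.
    have := hK eta 0 (t 0%N) (fun=> 1) eta0 eta1 (lexx 0) t0 (th _ _ (leq0n m)) F1 z1.
    rewrite (eq_Ex _ (g := f 0%N)) => [|w]; last by rewrite mul1r.
    rewrite (eq_Ex _ (f := fun w => 1 * _) (g := fun w => pot q eta (X 0 w))) => [|w]; last by rewrite mul1r.
    rewrite subr0 => /le_trans; apply; rewrite lerD2r ler_wpM2l ?expR_ge0//.
    exact: pot0_le.
  have := ind m (leqnn m).
  have : 0 <= Ex P (fun w => survival t m w * f m w).
    by apply: Ex_ge0 => w; rewrite mulr_ge0//; case/andP: (survival_itv t m w).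
  rewrite -natr1; move: h0.
  move: (Ex P (survival t m)) (Ex P (f 0%N)) (expR _ * _) => e1 e2 e3.
  move: (Ex P (fun w => survival t m w * f m w)) => a1.
  move: above_pot => lam h1 h2 h3; lra.
(* Here [eta] tends to 0 while the grid, and with it m and K, stays fixed. *)
apply/ler_addgt0Pr => e e0.
pose eta := Num.min 1 (e / (m.+1%:R * K + 1)).
have D0 : 0 < m.+1%:R * K + 1 by rewrite ltr_wpDl// mulr_ge0.
have eta0 : 0 < eta by rewrite lt_min ltr01 divr_gt0.
have eta1 : eta <= 1 by rewrite ge_min lexx.
apply: (le_trans (key eta eta0 eta1)); rewrite lerD2l.
apply: (@le_trans _ _ (m.+1%:R * K * (e / (m.+1%:R * K + 1)))).
  by rewrite ler_wpM2l ?mulr_ge0// ge_min lexx orbT.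
rewrite mulrCA -[leRHS]mulr1 ler_wpM2l ?(ltW e0)// ler_pdivrMr// mul1r lerDl//.
Qed.

Let above_event t : set T := [set w | above (X t w)].

Let above_event_meas t : 0 <= t -> measurable (above_event t).
Proof.
move=> t0; have m : measurable_fun setT (fun w => (above (X t w))%:R : R).
  exact: (F_measurable_meas BW (F_measurable_above t0)).
rewrite (_ : above_event t = (fun w => (above (X t w))%:R : R) @^-1` [set 1]).
  by rewrite -[X in measurable X]setTI; exact: m.
apply/seteqP; split=> w /=; rewrite /above_event/=; first by move=> ->.
by case: (above _) => //= /eqP; rewrite eq_sym oner_eq0.
Qed.

Let grid_event (t : nat -> R) m : set T := \bigcup_(k in [set k | (k < m)%N]) above_event (t k).

Let grid_event_meas t m : 0 <= t 0%N -> {homo t : j l / (j <= l)%N >-> j <= l} ->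
  measurable (grid_event t m).
Proof.
move=> t0 th; apply: bigcup_measurable => k _; apply: above_event_meas.
by rewrite (le_trans t0)// th.
Qed.

Let grid_event_le (t : nat -> R) m : 0 <= t 0%N -> {homo t : j l / (j <= l)%N >-> j <= l} ->
  (P (grid_event t m) <= (expR (- c * t 0%N) * pot0_bound / above_pot)%:E)%E.
Proof.
move=> t0 th; have mE := grid_event_meas m t0 th.
rewrite -(Ex_indic P mE) lee_fin ler_pdivlMr ?expR_gt0// mulrC.
apply: le_trans (survival_bound m t0 th); rewrite ler_wpM2l ?expR_ge0//.
have mS : measurable_fun setT (survival t m).
  apply: (F_measurable_meas BW (t := t m)); apply: F_survival => // j /ltnW jk; exact: th.
have iS : intg P (survival t m).
  apply: (intg_bounded P mS (M := 1)) => w.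
  by have /andP[h0 h1] := survival_itv t m w; rewrite ger0_norm.
rewrite -[X in X - _](Ex_cst P 1) -ExB//; last exact: intg_cst.
apply: le_Ex => [||w]; [exact: intg_indic|by apply: intgB => //; exact: intg_cst|].
have /andP[s0 s1] := survival_itv t m w.
rewrite indicE; case: (boolP (w \in grid_event t m)) => [|_]; last by rewrite subr_ge0.
rewrite inE => -[k /= km ak].
by rewrite /survival (bigD1 (Ordinal km))//= ak subrr mul0r subr0.
Qed.

(** With the (N + 1)^2 + 1 points used below, the mesh tends to 0 while the range [T0, T0 + N + 1]
    exhausts the half-line. *)
Let grid (T0 : R) (N k : nat) : R := T0 + k%:R / N.+1%:R.

Let grid_homo T0 N : {homo grid T0 N : j l / (j <= l)%N >-> j <= l}.
Proof. by move=> j l jl; rewrite lerD2l ler_wpM2r ?invr_ge0// ler_nat. Qed.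

(* The grids are not nested, hence the limit inferior over the mesh. *)
Let dense_event T0 : set T :=
  \bigcup_m \bigcap_(N in [set N | (m <= N)%N]) grid_event (grid T0 N) (N.+1 ^ 2).+1.

Let dense_inner_meas T0 m : 0 <= T0 ->
  measurable (\bigcap_(N in [set N | (m <= N)%N]) grid_event (grid T0 N) (N.+1 ^ 2).+1).
Proof.
move=> T00; apply: bigcap_measurableType => N _; apply: grid_event_meas; last exact: grid_homo.
by rewrite /grid mul0r addr0.
Qed.

Let dense_event_meas T0 : 0 <= T0 -> measurable (dense_event T0).
Proof. by move=> T00; apply: bigcup_measurable => m _; exact: dense_inner_meas. Qed.

(** The bound for one grid depends neither on its mesh nor on its length, so it passes to the
    increasing union by continuity from below. *)
Let dense_event_le T0 : 0 <= T0 ->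
  (P (dense_event T0) <= (expR (- c * T0) * pot0_bound / above_pot)%:E)%E.
Proof.
move=> T00.
have := @nondecreasing_cvg_mu _ _ _ P
  (fun m => \bigcap_(N in [set N | (m <= N)%N]) grid_event (grid T0 N) (N.+1 ^ 2).+1)
  (fun m => dense_inner_meas m T00) (dense_event_meas T00).
move=> /(_ _)/cvge_to_le; apply.
  move=> a1 a2 a12; apply/subsetPset => w h N /= aN; apply: h => /=.
  exact: leq_trans aN.
near=> m.
have g0 : grid T0 m 0 = T0 by rewrite /grid mul0r addr0.
have gle := @grid_event_le (grid T0 m) (m.+1 ^ 2).+1.
rewrite g0 in gle; apply: le_trans (gle T00 (grid_homo T0 m)).
apply: le_measure; rewrite ?inE; first exact: dense_inner_meas.
  by apply: grid_event_meas; [rewrite g0|exact: grid_homo].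
by move=> w; apply => /=.
Unshelve. all: end_near.
Qed.

(** [above] is an open condition on finitely many coordinates: if it holds at t, then also at the
    grid points just below t for all large N. These have an admissible index once N >= t - T0. *)
Let hitting_dense T0 w t : 0 <= T0 -> T0 <= t -> above (X t w) -> dense_event T0 w.
Proof.
move=> T00 T0t /forallP ax; have tT : 0 <= t - T0 by rewrite subr_ge0.
pose k N := Num.truncn ((t - T0) * N.+1%:R).
have cg : grid T0 N (k N) @[N --> \oo] --> t.
  have -> : t = T0 + (t - T0) by ring.
  by apply: cvgD; [exact: cvg_cst|exact: truncn_div_cvg].
have near_above : \forall N \near \oo, forall i, 0 < q i -> mu < X (grid T0 N (k N)) w i 0.
  apply: filter_forall => i; have := ax i; case: (0 < q i) => /= xi; last by near=> N.
  have ci : X (grid T0 N (k N)) w i 0 @[N --> \oo] --> X t w i 0.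
    exact: (cvg_comp _ _ cg (@X_cont i w t)).
  by near=> N => _; near: N; exact: (cvgr_gt _ ci _ xi).
have [m _ hm] : \forall N \near \oo, above (X (grid T0 N (k N)) w) /\ (k N < (N.+1 ^ 2).+1)%N.
  near=> N; split.
    apply/forallP => i; apply/implyP; move: i; near: N; exact: near_above.
  rewrite ltnS -(ler_nat R) natrX; have x0' : 0 <= (t - T0) * N.+1%:R by exact: mulr_ge0.
  have /andP[h _] := truncn_itv x0'; apply: (le_trans h); rewrite expr2 ler_wpM2r//.
  apply: (@le_trans _ _ N%:R); last by rewrite ler_nat.
  by near: N; exact: nbhs_infty_ger.
by exists m => // N /= mN; have [h1 h2] := hm N mN; exists (k N).
Unshelve. all: end_near.
Qed.

(** A path that is [above] at arbitrarily late times lies in every [dense_event k%:R], and these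
    events have probability of order exp (- c k). Their intersection is the measurable null set that
    contains the exceptional paths. *)
Lemma eventually_not_above :
  {ae P, forall w, exists2 T0 : R, 0 <= T0 & forall t, T0 <= t -> ~~ above (X t w)}.
Proof.
exists (\bigcap_(k in [set: nat]) dense_event k%:R); split.
- by apply: bigcap_measurableType => k _; exact: dense_event_meas.
- apply/eqP; rewrite eq_le measure_ge0 andbT; apply/lee_addgt0Pr => e e0; rewrite add0e.
  pose B := pot0_bound / above_pot.
  have B0 : 0 < B by rewrite divr_gt0 ?expR_gt0.
  (* Large enough for B exp (- c k) <= e, by way of exp y >= y. *)
  pose k := (Num.truncn (B / (e * c))).+1.
  have kB : B / (e * c) < k%:R by rewrite truncnS_gt.
  apply: (@le_trans _ _ (P (dense_event k%:R))).
    apply: le_measure; rewrite ?inE; last by move=> w; apply.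
      by apply: bigcap_measurableType => j _; exact: dense_event_meas.
    exact: dense_event_meas.
  apply: (le_trans (dense_event_le _)) => //; rewrite lee_fin -mulrA -/B.
  rewrite mulNr expRN mulrC ler_pdivrMr ?expR_gt0//.
  apply: (@le_trans _ _ (e * (c * k%:R))).
    by rewrite mulrA -ler_pdivrMl ?mulr_gt0// mulrC ltW.
  rewrite ler_wpM2l ?(ltW e0)//; apply: le_trans (expR_ge1Dx _).
  by rewrite lerDr.
- move=> w /= nh k _; apply: contrapT => nd; apply: nh; exists k%:R => // t kt.
  by apply/negP => ab; apply: nd; exact: hitting_dense ab.
Qed.

End Level.

(** The levels are 1 / (k + 1). Where [above] fails, some coordinate with positive exponent, and
    hence the minimum, is at most the level. *)
Lemma min_coord_cvg0 :
  {ae P, forall w, min_coord [pred i | 0 < q i] (X t w) @[t --> +oo] --> (0 : R)}.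
Proof.
have mu0 k : 0 < k.+1%:R^-1 :> R by rewrite invr_gt0.
have := ae_foralln (fun k => eventually_not_above (mu0 k)); apply: filterS => w h.
apply/cvgr0Pnorm_le => e e0.
have [k ke] : exists k : nat, k.+1%:R^-1 <= e.
  exists (Num.truncn e^-1); rewrite -[leRHS]invrK lef_pV2 ?posrE ?invr_gt0//.
  by rewrite ltW// truncnS_gt.
have [T0 _ hT0] := h k; near=> t.
have : ~~ above k.+1%:R^-1 (X t w) by apply: hT0; near: t; apply: nbhs_pinfty_ge; exact: num_real.
rewrite negb_forall => /existsP[i]; rewrite negb_imply -leNgt => /andP[qi xi].
rewrite ger0_norm; last first.
  by rewrite /min_coord; elim/big_ind: _ => // [a1 a2 h1 h2|j _]; [rewrite le_min h1|case/andP: (X_box t w j)].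
apply: le_trans ke; apply: le_trans xi.
by rewrite /min_coord; apply: bigmin_le_cond.
Unshelve. all: end_near.
Qed.

End Hitting.

(** * Distance to the boundary and compactness of the simplex *)

Section Geometry.
Context {R : realType} {n : nat}.
Implicit Types (x y : 'cV[R]_n) (i : 'I_n).

Let bd_dist_bounded x : has_lbound [set eucl_dist x y | y in (@bd_simplex R n)].
Proof. by exists 0 => _ [y _ <-]; exact: sqrtr_ge0. Qed.

(* Moving the mass [x i 0] to any other coordinate leads to the boundary. *)
Let bd_dist_le x i : (2 <= n)%N -> simplex x ->
  exists2 y, bd_simplex y & eucl_dist x y <= Num.sqrt 2 * x i 0.
Proof.
move=> n2 [x01 x1].
have [j ji] : exists j, j != i.
  have : (0 < #|predC1 i|)%N by rewrite cardC1 card_ord; case: n n2 i => [|[|]].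
  by move=> /card_gt0P[j jP]; exists j.
have /andP[xi0 xi1] := x01 i.
pose y : 'cV[R]_n := \col_k (x k 0 + x i 0 * ((k == j)%:R - (k == i)%:R)).
have ji' : (j == i) = false by exact: negbTE.
have yE k : y k 0 = x k 0 + x i 0 * ((k == j)%:R - (k == i)%:R) by rewrite mxE.
have sum_delta (m : 'I_n) : \sum_k (k == m)%:R = 1 :> R.
  by rewrite (bigD1 m)//= eqxx big1 ?addr0// => k /negbTE ->.
have yi : y i 0 = 0 by rewrite yE eqxx eq_sym ji' sub0r mulrN1 subrr.
have y0 k : 0 <= y k 0.
  have /andP[xk0 _] := x01 k.
  case: (eqVneq k i) => [->|ki]; first by rewrite yi.
  by rewrite yE (negbTE ki) subr0 addr_ge0// mulr_ge0.
have y1 : \sum_k y k 0 = 1.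
  under eq_bigr do rewrite yE; rewrite big_split/= x1 -mulr_sumr sumrB !sum_delta.
  by rewrite subrr mulr0 addr0.
exists y.
  split; last by move=> [_ /(_ i)]; rewrite yi ltxx.
  by split=> // k; rewrite y0/= -y1 (bigD1 k)//= lerDl sumr_ge0.
have E : \sum_k (x k 0 - y k 0) ^+ 2 = 2 * x i 0 ^+ 2.
  rewrite (bigD1 j)//= (bigD1 i)//=; last by rewrite eq_sym.
  rewrite big1 => [|m /andP[kj ki]]; last first.
    by rewrite yE (negbTE kj) (negbTE ki) subr0 mulr0 addr0 subrr expr0n.
  by rewrite yi yE eqxx ji' /=; ring.
by rewrite /eucl_dist E sqrtrM// sqrtr_sqr ger0_norm.
Qed.

Lemma dist_to_bd_ge0 x : (2 <= n)%N -> simplex x -> 0 <= dist_to (@bd_simplex R n) x.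
Proof.
move=> n2 sx; have i : 'I_n by apply: (@Ordinal _ 0); exact: ltn_trans n2.
have [y by_ _] := bd_dist_le i n2 sx.
by apply: lb_le_inf => [|_ [z _ <-]]; [exists (eucl_dist x y); exists y|exact: sqrtr_ge0].
Qed.

(** Every single coordinate gives such a bound, sqrt 2 being the distance between two vertices;
    hence the index set is arbitrary. *)
Lemma dist_to_bd_le (I : {pred 'I_n}) x : (2 <= n)%N -> simplex x ->
  dist_to (@bd_simplex R n) x <= Num.sqrt 2 * min_coord I x.
Proof.
move=> n2 sx; have s2 : 0 < Num.sqrt 2 :> R by rewrite sqrtr_gt0.
have le_i i : dist_to (@bd_simplex R n) x <= Num.sqrt 2 * x i 0.
  have [y by_] := bd_dist_le i n2 sx; apply: le_trans.
  by apply: ge_inf; [exact: bd_dist_bounded|exists y].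
rewrite mulrC -ler_pdivrMr//; apply: le_bigmin => [|i _]; last first.
  by rewrite ler_pdivrMr// mulrC.
(* The default value 1 of the minimum is bounded by way of an arbitrary coordinate, which is at most
   1. *)
have i : 'I_n by apply: (@Ordinal _ 0); exact: ltn_trans n2.
rewrite ler_pdivrMr// mul1r; apply: (le_trans (le_i i)).
by rewrite ler_piMr ?(ltW s2)//; case: sx => /(_ i)/andP[].
Qed.

Lemma simplex_poly_neg (g : 'cV[R]_n -> R) : poly_fun g ->
  (forall x, simplex x -> g x < 0) ->
  exists2 delta : R, 0 < delta & forall x, simplex x -> g x <= - delta.
Proof.
move=> pg gneg.
pose S : set 'rV[R]_n := [set v | simplex v^T].
have cS : compact S.
  have cB : compact [set v : 'rV[R]_n | forall i, v ord0 i \in `[(0 : R), 1]].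
    by apply: (@rV_compact _ _ (fun=> `[(0 : R), 1]%classic)) => _; exact: segment_compact.
  have sumP : poly_fun (fun x => \sum_i x i 0) by apply: poly_sum => i; exact: poly_coord.
  have cC : closed [set v : 'rV[R]_n | \sum_i v^T i 0 = 1].
    apply: (@preimage_closed _ _ (fun v : 'rV[R]_n => \sum_i v^T i 0) [set 1]).
      by move=> v _; exact: (poly_continuous sumP).
    exact: closed_eq.
  have -> : S = [set v : 'rV[R]_n | forall i, v ord0 i \in `[(0 : R), 1]] `&`
      [set v | \sum_i v^T i 0 = 1].
    apply/seteqP; split=> v /= [h1 h2]; by split => // i; have := h1 i; rewrite /= in_itv/= ?mxE.
  by apply: compact_closedI.
(* The simplex is empty only for n = 0, and then any [delta] will do. *)
have [[v Sv]|S0] := pselect (S !=set0); last first.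
  exists 1 => // x sx; exfalso; apply: S0; exists x^T.
  by rewrite /S/= trmxK.
have [||u Su hu] := @compact_EVT_max _ R (fun v => g v^T) S _ cS.
- by exists v.
- by apply: continuous_subspaceT; exact: poly_continuous.
rewrite inE in Su; exists (- g u^T); first by rewrite oppr_gt0; exact: gneg.
move=> x sx; rewrite opprK -[x]trmxK; apply: hu.
by rewrite inE /S/= trmxK.
Qed.

End Geometry.

(** * Negativity of the drift *)

Section DriftNegativity.
Context {R : realType} {n : nat}.
Variables (A : 'M[R]_n) (sigma : 'I_n -> R).
Local Notation At := (tilde A sigma).
Local Notation beta := (drift_rate A sigma).
Local Notation gamma := (diffusion_rate sigma).
Implicit Types (x p : 'cV[R]_n).

Let form (y z : 'cV[R]_n) : R := \sum_i y i 0 * (At *m z) i 0.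

(** The entries of At p are all equal and those of x - p sum to 0, so the pairing of x - p with At p
    vanishes. *)
Let formE x p : \sum_i x i 0 = 1 -> \sum_i p i 0 = 1 ->
  (forall i j, (At *m p) i 0 = (At *m p) j 0) ->
  ((x - p)^T *m At *m (x - p)) 0 0 = form x x - form p x.
Proof.
move=> x1 p1 pe.
have -> : ((x - p)^T *m At *m (x - p)) 0 0 = form (x - p) (x - p).
  by rewrite -mulmxA mxE; apply: eq_bigr => i _; rewrite mxE.
have xp : form (x - p) p = 0.
  have [i _|n0] := pickP 'I_n; last by rewrite /form big1// => i; have := n0 i.
  rewrite /form (eq_bigr (fun j => (x j 0 - p j 0) * (At *m p) i 0)).
    by rewrite -mulr_suml sumrB x1 p1 subrr mul0r.
  by move=> j _; rewrite (pe i j) !mxE.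
transitivity (form (x - p) x - form (x - p) p).
  by rewrite /form -sumrB; apply: eq_bigr => i _; rewrite mulmxBr !mxE; ring.
rewrite xp subr0 /form -sumrB; apply: eq_bigr => i _.
by rewrite [(x - p) i 0]mxE [(- p) i 0]mxE mulrBl.
Qed.

(** The ith summand without its weight p_i is (At x)_i minus a term common to all i, which survives
    unchanged because p sums to 1. The common term is x^T At x plus half of the noise sum. The Ito
    correction of the logarithm supplies the shift - sigma_i^2 / 2 that turns A into [tilde]. *)
Lemma drift_form x p : \sum_i x i 0 = 1 -> \sum_i p i 0 = 1 ->
  (forall i j, (At *m p) i 0 = (At *m p) j 0) ->
  \sum_i p i 0 * (beta i x - (\sum_k gamma i k x * gamma i k x) / 2) =
  - ((x - p)^T *m At *m (x - p)) 0 0 - (\sum_i sigma i ^+ 2 * (x i 0 * (1 - x i 0))) / 2.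
Proof.
move=> x1 p1 pe; rewrite formE//.
pose ax i := \sum_l A i l * x l 0.
have AtE i : (At *m x) i 0 = ax i - sigma i ^+ 2 / 2.
  rewrite mxE /ax; under eq_bigr do rewrite mxE mulrBl.
  by rewrite sumrB -mulr_sumr x1 mulr1.
pose Q := \sum_k sigma k ^+ 2 * x k 0 ^+ 2.
have gE i : \sum_k gamma i k x * gamma i k x = sigma i ^+ 2 * (1 - 2 * x i 0) + Q.
  rewrite /Q (bigD1 i)//= [in RHS](bigD1 i)//= addrA; congr (_ + _).
    by rewrite /diffusion_rate eqxx /=; ring.
  apply: eq_bigr => k /negbTE ki; rewrite /diffusion_rate eq_sym ki /=; ring.
have fE : \sum_k x k 0 * fitness A sigma k x = \sum_k x k 0 * ax k - Q.
  by rewrite /Q -sumrB; apply: eq_bigr => k _; rewrite /fitness -/(ax k); ring.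
rewrite (eq_bigr (fun i => p i 0 * (ax i - sigma i ^+ 2 / 2) -
    p i 0 * (\sum_k x k 0 * ax k - Q + Q / 2))); last first.
  by move=> i _; rewrite gE /drift_rate fE /fitness -/(ax i); field.
rewrite sumrB -mulr_suml p1 mul1r /form.
rewrite (eq_bigr (fun i => p i 0 * (ax i - sigma i ^+ 2 / 2)) (F1 := fun i => p i 0 * (At *m x) i 0)); last first.
  by move=> i _; rewrite AtE.
rewrite (eq_bigr (fun i => x i 0 * ax i - sigma i ^+ 2 * x i 0 / 2) (F1 := fun i => x i 0 * (At *m x) i 0)); last first.
  by move=> i _; rewrite AtE; field.
rewrite (eq_bigr (fun i => sigma i ^+ 2 * x i 0 - sigma i ^+ 2 * x i 0 ^+ 2)
    (F1 := fun i => sigma i ^+ 2 * (x i 0 * (1 - x i 0)))); last first.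
  by move=> i _; ring.
rewrite !sumrB -!mulr_suml -/Q.
move: (\sum_i p i 0 * _) (\sum_k x k 0 * ax k) (\sum_i sigma i ^+ 2 * x i 0) => u1 u2 u3.
by field.
Qed.

(** For x different from p the quadratic form is positive. At x = p, possible if p lies in the
    simplex, the form vanishes and the noise term decides: it is 0 only if all coordinates are 0 or
    1, that is, at a vertex. *)
Lemma drift_neg p : (forall i, 0 < sigma i) -> (forall k, p <> delta_mx k 0) ->
  (forall i j, (At *m p) i 0 = (At *m p) j 0) -> \sum_i p i 0 = 1 -> cond_pos_def At ->
  exists2 delta : R, 0 < delta & forall x, simplex x ->
  \sum_i p i 0 * (beta i x - (\sum_k gamma i k x * gamma i k x) / 2) <= - delta.
Proof.
move=> sigma0 pv pe p1 cpd; apply: simplex_poly_neg.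
  apply: poly_sum => i; apply: poly_mul; first exact: poly_cst.
  apply: poly_sub; first exact: drift_rate_poly.
  apply: poly_mul; last exact: poly_cst.
  by apply: poly_sum => k; apply: poly_mul; exact: diffusion_rate_poly.
move=> x [x01 x1]; rewrite drift_form// -opprD oppr_lt0.
have s0 i : 0 <= sigma i ^+ 2 * (x i 0 * (1 - x i 0)).
  by have /andP[h0 h1] := x01 i; apply: mulr_ge0; [exact: sqr_ge0|rewrite mulr_ge0 ?subr_ge0].
have [xp|xp] := eqVneq x p; last first.
  rewrite ltr_wpDr ?divr_ge0 ?sumr_ge0//; apply: cpd; first by rewrite subr_eq0.
  rewrite (eq_bigr (fun i => x i 0 - p i 0)); last by move=> i _; rewrite !mxE.
  by rewrite sumrB x1 p1 subrr.
rewrite xp subrr trmx0 mul0mx mul0mx mxE add0r -xp divr_gt0// lt_neqAle sumr_ge0// andbT eq_sym.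
apply/eqP => /eqP; rewrite psumr_eq0// => /allP h.
have x_bin i : (x i 0 == 0) || (x i 0 == 1).
  have := h i (mem_index_enum i); rewrite /= mulf_eq0 gt_eqF ?exprn_gt0//= mulf_eq0 subr_eq0.
  by rewrite [1 == _]eq_sym.
have [k /eqP xk|x0] := pickP (fun i => x i 0 == 1); last first.
  move: x1; rewrite big1 => [/eqP|i _]; first by rewrite eq_sym oner_eq0.
  by have := x_bin i; rewrite x0 orbF => /eqP.
apply: (pv k); rewrite -xp; apply/colP => i; rewrite mxE eqxx andbT.
have [->//|ik] := eqVneq i k.
move: x1; rewrite (bigD1 k)//= xk -[RHS]addr0 => /addrI /eqP.
rewrite psumr_eq0 => [/allP|j _]; last by case/andP: (x01 j).
by move=> /(_ i (mem_index_enum i)); rewrite ik => /eqP.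
Qed.

End DriftNegativity.

Theorem theorem4p5 (R : realType) (d : measure_display) (T : measurableType d)
    (P : probability T R) (n : nat) (n_ge2 : (2 <= n)%N)
    (A : 'M[R]_n) (sigma : 'I_n -> R) (sigma_gt0 : forall i, 0 < sigma i)
    (x0 : 'cV[R]_n) (x0_int : int_simplex x0)
    (W : 'I_n -> R -> T -> R) (BW : standard_brownian_motion P W)
    (X : R -> T -> 'cV[R]_n) (SX : stochastic_replicator P A sigma x0 W X)
    (p : 'cV[R]_n) (p_vertex : forall k : 'I_n, p <> delta_mx k 0)
    (p_equal : forall i j : 'I_n,
       (tilde A sigma *m p) i 0 = (tilde A sigma *m p) j 0)
    (p_sum : \sum_i p i 0 = 1)
    (A_cpd : cond_pos_def (tilde A sigma)) :
  {ae P, forall w,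
     min_coord [pred i | 0 < p i 0] (X t w) @[t --> +oo] --> (0 : R)} /\
  transient P X.
Proof.
have [Y [Ysimplex Ycont FY jY [Y0 Ysol]] XY] := regularization x0_int BW SX.
have Ybox r w : in_box (Y r w) by case: (Ysimplex r w).
have gen := generator_estimate BW (drift_poly A sigma) (diffusion_poly sigma) Ybox FY jY Ysol.
have [delta delta0 neg] := drift_neg sigma_gt0 p_vertex p_equal p_sum A_cpd.
have [eps [c [eps0 c0 decay]]] := pot_decay BW (fun i x => replicator_driftE A sigma x i)
  (fun i j x => replicator_diffusionE sigma x i j) (drift_rate_poly A sigma)
  (diffusion_rate_poly sigma) x0_int Ysimplex FY Y0 gen delta0 neg.
have Ymin := min_coord_cvg0 BW x0_int Ysimplex Ycont FY Y0 c0 decay.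
(* Multiplication by eps > 0 preserves signs, so the coordinates with positive exponent are those of
   I^+. *)
have IE : [pred i | 0 < eps * p i 0] = [pred i | 0 < p i 0] :> {pred 'I_n}.
  by apply/funext => i; rewrite /= pmulr_rgt0.
rewrite IE in Ymin.
have min0 : {ae P, forall w,
    min_coord [pred i | 0 < p i 0] (X t w) @[t --> +oo] --> (0 : R)}.
  apply: filterS2 XY Ymin => w XYw; apply: cvg_trans; apply: near_eq_cvg.
  near=> t; rewrite XYw//; near: t; apply: nbhs_pinfty_ge; exact: num_real.
split=> //; apply: filterS2 XY Ymin => w XYw cY.
apply: (@squeeze_cvgr _ _ _ _ (fun=> 0) (fun t => Num.sqrt 2 * min_coord [pred i | 0 < p i 0] (Y t w))).
- near=> t; have t0 : 0 <= t by near: t; apply: nbhs_pinfty_ge; exact: num_real.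
  by rewrite XYw// dist_to_bd_ge0// dist_to_bd_le.
- exact: cvg_cst.
- by rewrite -[X in _ --> X](mulr0 (Num.sqrt 2)); apply: cvgMr.
Unshelve. all: end_near.
Qed.
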